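(* Let $(M^2,g)$ be a Riemannian surface with Gaussian curvature $K$ satisfying $(\operatorname{grad}K)(p)\neq0$ and $K(p)<0$ at any point $p\in M$. Let $X_1=\frac{\operatorname{grad}K}{|\operatorname{grad}K|}$ and let $X_2$ be a vector field on $M$ such that $\{X_1(p),X_2(p)\}$ is a positively oriented orthonormal basis at any point $p\in M$. Then $$X_2X_1K=0\quad\text{and}\quad \nabla_{X_2}X_2=\frac{3X_1K}{8K}X_1$$ if and only if the Riemannian metric $g$ can be locally written as $$g_C(u,v)=C(\cosh u)^6(du^2+dv^2),\qquad u\neq0,$$ where $C\in\mathbb{R}$ is a positive constant.
   Context: $\nabla$ is the Levi-Civita connection of $g$, and $X_2X_1K=X_2(X_1(K))$. ''Locally written'' means that around each point of $M$ there are local coordinates $(u,v)$ in which $g$ has the stated form. *)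

(* Defs.v *)
From HB Require Import structures.
From mathcomp Require Import all_boot all_order all_algebra.
From mathcomp Require Import all_classical all_reals all_analysis.

Set Implicit Arguments.
Unset Strict Implicit.
Unset Printing Implicit Defensive.

Import Order.TTheory GRing.Theory Num.Theory.
Import numFieldNormedType.Exports.

Local Open Scope classical_set_scope.
Local Open Scope ring_scope.

Notation plane R := 'rV[R]_2.

(** * Riemannian geometry on open subsets of the plane

    A metric is given by its Gram matrices [h x = (g_ij(x))], a vector field by
    its components [X x = (X^1(x), X^2(x))]. *)
Section Local.
Variable R : realType.
Implicit Types (x : plane R) (f : plane R -> R) (X Y : plane R -> plane R)
  (h : plane R -> 'M[R]_2) (D : set (plane R)).

Definition pd (i : 'I_2) f x : R := 'D_(delta_mx 0 i) f x.

(** [C^oo] on an open set [D]: all iterated partial derivatives exist and are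
    continuous at every point of [D]. *)
Definition smooth_on D f : Prop :=
  forall (s : seq 'I_2) x, D x ->
    {for x, continuous (foldr pd f s)} /\
    forall i : 'I_2, derivable (foldr pd f s) x (delta_mx 0 i).

Definition dirder X f x : R := \sum_i X x 0 i * pd i f x.

Definition ip h x (v w : plane R) : R := (v *m h x *m w^T) 0 0.

(** Components [sum_i g^(ik) d_i f]. *)
Definition local_grad h f x : plane R := (\row_i pd i f x) *m invmx (h x).

(** [Gamma^k_ij], the Christoffel symbols of the Levi-Civita connection. *)
Definition christoffel h (k i j : 'I_2) x : R :=
  2^-1 * \sum_l invmx (h x) k l *
    (pd i (fun y => h y j l) x + pd j (fun y => h y i l) x
     - pd l (fun y => h y i j) x).

Definition local_nabla h X Y x : plane R :=
  \row_k (dirder X (fun y => Y y 0 k) x +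
          \sum_i \sum_j christoffel h k i j x * X x 0 i * Y x 0 j).

(** Sectional curvature [<R(e1,e2)e2, e1> / (|e1|^2 |e2|^2 - <e1,e2>^2)], where
    [R(e1,e2) = nabla_e1 nabla_e2 - nabla_e2 nabla_e1] because the coordinate
    fields [e1], [e2] commute. *)
Definition local_gauss h x : R :=
  let e1 := fun _ : plane R => delta_mx 0 0 : plane R in
  let e2 := fun _ : plane R => delta_mx 0 1 : plane R in
  ip h x (local_nabla h e1 (local_nabla h e2 e2) x
          - local_nabla h e2 (local_nabla h e1 e2) x) (e1 x)
  / (ip h x (e1 x) (e1 x) * ip h x (e2 x) (e2 x) - ip h x (e1 x) (e2 x) ^+ 2).

Definition cosh (t : R) : R := (expR t + expR (- t)) / 2.

(** [C (cosh u)^6 (du^2 + dv^2)] at [x = (u, v)]. *)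
Definition metric_gC (C : R) x : 'M[R]_2 := (C * cosh (x 0 0) ^+ 6)%:M.

End Local.

(** * Oriented smooth surfaces *)

(** A homeomorphism from an open subset of [M] onto an open subset of the plane;
    [chart_map] is meaningless outside [chart_dom], and [chart_inv] outside
    [chart_im]. *)
Record chart (R : realType) (M : topologicalType) := Chart {
  chart_dom : set M;
  chart_map :> M -> plane R;
  chart_inv : plane R -> M;
  chart_dom_open : open chart_dom;
  chart_im_open : open (chart_map @` chart_dom);
  chart_mapK : forall p, chart_dom p -> chart_inv (chart_map p) = p;
  chart_map_cont : {within chart_dom, continuous chart_map};
  chart_inv_cont : {within chart_map @` chart_dom, continuous chart_inv}
}.

Section Charts.
Variables (R : realType) (M : topologicalType).
Implicit Types c d : chart R M.

Definition chart_im c : set (plane R) := c @` chart_dom c.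

Definition overlap c d : set (plane R) := c @` (chart_dom c `&` chart_dom d).

Definition transition c d : plane R -> plane R := d \o chart_inv c.

Definition smooth_transition c d : Prop :=
  forall i : 'I_2, smooth_on (overlap c d) (fun x => transition c d x 0 i).

End Charts.

(** Smooth structure: a maximal smooth atlas.  Orientation: a subatlas with
    orientation-preserving transition maps. *)
Record surface (R : realType) := Surface {
  surface_space :> topologicalType;
  _ : hausdorff_space surface_space;
  _ : @second_countable surface_space;
  atlas : set (chart R surface_space);
  atlas_compat : forall c d, atlas c -> atlas d -> smooth_transition c d;
  atlas_maximal : forall c,
    (forall d, atlas d -> smooth_transition c d /\ smooth_transition d c) ->
    atlas c;
  positive : set (chart R surface_space);
  positive_atlas : positive `<=` atlas;
  positive_cover : forall p, exists2 c, positive c & chart_dom c p;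
  positive_det : forall c d x, positive c -> positive d -> overlap c d x ->
    0 < \det ('J (transition c d) x)
}.

(** * Tensor fields on a surface

    Scalar functions, vector fields and metrics are given by their local
    expressions: for a chart [c] of the atlas and [x] in its image, [F c x] is
    the value, or the components in the chart [c], of [F] at the point
    [chart_inv c x].  Values at other [c] and [x] are irrelevant. *)
Section Fields.
Variables (R : realType) (M : surface R).

Definition local_expr (T : Type) := chart R M -> plane R -> T.
Definition scalar_field := local_expr R.
Definition tangent_field := local_expr (plane R).

Definition everywhere (P : chart R M -> plane R -> Prop) : Prop :=
  forall c, atlas c -> forall x, chart_im c x -> P c x.

Definition is_vector_field (X : tangent_field) : Prop :=
  (forall c, atlas c ->
     forall i : 'I_2, smooth_on (chart_im c) (fun x => X c x 0 i)) /\
  (forall c d, atlas c -> atlas d -> forall x, overlap c d x ->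
     X d (transition c d x) = X c x *m 'J (transition c d) x).

Record metric := Metric {
  gram :> chart R M -> plane R -> 'M[R]_2;
  gram_smooth : forall c, atlas c ->
    forall i j : 'I_2, smooth_on (chart_im c) (fun x => gram c x i j);
  gram_law : forall c d, atlas c -> atlas d -> forall x, overlap c d x ->
    let J := 'J (transition c d) x in
    gram c x = J *m gram d (transition c d x) *m J^T;
  gram_sym : everywhere (fun c x => (gram c x)^T = gram c x);
  gram_pos : everywhere (fun c x =>
    forall v : plane R, v != 0 -> 0 < ip (gram c) x v v)
}.

Variable g : metric.
Implicit Types (f : scalar_field) (X Y : tangent_field).

Definition inner X Y : scalar_field := fun c x => ip (g c) x (X c x) (Y c x).

Definition scale f X : tangent_field := fun c x => f c x *: X c x.

(** [X f]. *)
Definition apply_field X f : scalar_field := fun c => dirder (X c) (f c).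

Definition grad f : tangent_field := fun c => local_grad (g c) (f c).

Definition normalize X : tangent_field :=
  scale (fun c x => (Num.sqrt (inner X X c x))^-1) X.

Definition nabla X Y : tangent_field := fun c => local_nabla (g c) (X c) (Y c).

Definition gauss_curvature : scalar_field := fun c => local_gauss (g c).

Definition positive_orthonormal X Y : Prop :=
  everywhere (fun c x =>
    [/\ inner X X c x = 1, inner Y Y c x = 1 & inner X Y c x = 0]) /\
  (forall c, positive c -> forall x, chart_im c x ->
     0 < \det (col_mx (X c x) (Y c x) : 'M[R]_2)).

(** Some local coordinates [(u, v)] around [p], of either orientation, in which
    [g] is [C (cosh u)^6 (du^2 + dv^2)] with [u != 0]. *)
Definition locally_gC (C : R) (p : M) : Prop :=
  exists c : chart R M, [/\ atlas c, chart_dom c p &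
    forall x, chart_im c x -> x 0 0 != 0 /\ g c x = metric_gC C x].

End Fields.

(* Main.v *)
From HB Require Import structures.
Require Import Defs.
From mathcomp Require Import all_boot all_order all_algebra ring lra.
From mathcomp Require Import all_classical all_reals all_analysis.
Set Implicit Arguments.
Unset Strict Implicit.
Unset Printing Implicit Defensive.
Import Order.TTheory GRing.Theory Num.Theory.
Import numFieldNormedType.Exports.
Local Open Scope classical_set_scope.
Local Open Scope ring_scope.

(** Write [k = - K] and [f = X1 K = |grad K|], and suppose the two conditions
    on the frame.  Since [X2 K = 0] and [X2 f = 0], the bracket [[X1, X2]] kills
    [K], hence equals [b X2] for a function [b], and Cartan's structure equations
    ([frame_curvature]) give [nabla_X2 X2 = b X1] and [K = X1 b - b ^ 2].  The
    second condition says [b = 3 f / (8 K)], so [K] and [f] satisfy a system of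
    ordinary differential equations along [X1] ([frame_ode]).  Put
    [q = sqrt 3 f / (8 k ^ (3 / 2))].  The system has the first integral
    [k (1 + q ^ 2) ^ 4]; the function [u = arsinh q] satisfies [X1 u = s] and
    [X2 u = 0] for [s = sqrt (k (1 + q ^ 2) / 3)]; and [X1 s = b s], which says
    that the one-form [s <X2, .>] is closed.  If [v] is a local primitive of it
    ([poincare]), then [du] and [dv] are [s] times the coframe dual to [X1, X2],
    so [g = s ^ (- 2) (du ^ 2 + dv ^ 2)], and
    [s ^ (- 2) = 3 / (k (1 + q ^ 2)) = C cosh u ^ 6] with
    [C = 3 / (k (1 + q ^ 2) ^ 4)], a constant ([frame_coordinates]).  By the
    inverse function theorem ([local_inverse]) the pair [(u, v)] is a chart, and
    it belongs to the maximal atlas ([new_chart_atlas]).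

    Conversely, let [g = g_C] in some chart with coordinates [(u, v)].  In any
    other chart the coordinate functions [u], [v] still determine an orthonormal
    frame with bracket [[Z1, Z2] = s' (u) Z2], where [s = C ^ (- 1 / 2) cosh ^ (- 3)].
    The same lemma [frame_curvature] yields [K = - 3 / (C cosh u ^ 8)] in that
    chart, so no transformation law of the curvature has to be established.  The
    gradient of [K] is a multiple of [Z1] with the sign of [u], and both
    conditions can be read off ([std_condition]).

    Finally [K] and [|grad K| ^ 2] at a point determine [C]
    ([locally_gC_unique]); therefore [C] is locally constant, and constant on a
    connected surface ([gC_constant]). *)

(** * Differential calculus in the plane *)

Lemma ord2P (i : 'I_2) : i = 0 \/ i = 1.
Proof. by case: i => [[|[|//]] p]; [left|right]; apply/val_inj. Qed.

Lemma sum2 (V : nmodType) (F : 'I_2 -> V) : \sum_i F i = F 0 + F 1.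
Proof. by rewrite big_ord_recl big_ord1; congr (_ + F _); exact/val_inj. Qed.

(** The form in which differentiability is established below: a candidate for
    the differential together with an epsilon estimate. *)
Lemma differentiable_eps (R : realType) (V W : normedModType R) (f : V -> W)
    (L : {linear V -> W}) (x : V) : continuous L ->
  (forall eps : R, 0 < eps ->
     \forall h \near (0 : V), `|f (h + x) - f x - L h| <= eps * `|h|) ->
  differentiable f x /\ ('d f x = L :> (V -> W)).
Proof.
move=> Lc h.
have key : f \o shift x = cst (f x) + L +o_ (0 : V) id.
  apply/eqaddoE; apply/eqaddoP => eps eps0; apply: filterS (h _ eps0) => y.
  by rewrite -addrA -opprD.
have E := diff_unique Lc key.
by split => //; apply/diff_locallyP; rewrite E; split.
Qed.

Section Calculus.
Variable R : realType.
Implicit Types (x y v : plane R) (f g : plane R -> R) (X Y : plane R -> plane R)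
  (D : set (plane R)).

Local Notation e_ i := (delta_mx 0 i : plane R).

Lemma plane_sum (x : plane R) : x = \sum_i x 0 i *: e_ i.
Proof. exact: row_sum_delta. Qed.

Lemma normv_coord (x : plane R) i : `|x 0 i| <= `|x|.
Proof.
rewrite [leRHS]/Num.norm /= mx_normrE.
by apply: (le_bigmax _ (fun ij => `|x ij.1 ij.2|) (0, i)).
Qed.

Lemma normv_le (x : plane R) a : 0 <= a -> (forall i, `|x 0 i| <= a) -> `|x| <= a.
Proof.
move=> a0 h; rewrite [leLHS]/Num.norm /= mx_normrE.
by apply: bigmax_le => // -[i j] _ /=; rewrite (ord1 i).
Qed.

Lemma line_derive f x v (t : R) : derivable f (x + t *: v) v ->
  is_derive t 1 (fun s => f (x + s *: v)) ('D_v f (x + t *: v)).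
Proof.
have E : (fun h : R => h^-1 *: (((fun s => f (x + s *: v)) \o shift t) (h *: (1 : R))
  - f (x + t *: v)))
       = (fun h : R => h^-1 *: ((f \o shift (x + t *: v)) (h *: v) - f (x + t *: v))).
  apply/funext => h /=; congr (_ *: (f _ - _)).
  by rewrite [h%:A]mulr1 scalerDl addrCA.
by move=> df; apply: DeriveDef; rewrite /derivable /derive E.
Qed.

Lemma mvt_line f x v : (forall t : R, 0 <= t <= 1 -> derivable f (x + t *: v) v) ->
  exists2 t : R, 0 <= t <= 1 & f (x + v) - f x = 'D_v f (x + t *: v).
Proof.
move=> df; pose F (s : R) := f (x + s *: v).
have dF (t : R) : 0 <= t <= 1 -> is_derive t 1 F ('D_v f (x + t *: v)).
  by move=> t01; apply: line_derive; exact: df.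
have [||c] := @MVT_segment R F (fun t => 'D_v f (x + t *: v)) 0 1 ler01.
- by move=> t; rewrite in_itv /= => /andP[/ltW t0 /ltW t1]; apply: dF; rewrite t0.
- apply: derivable_within_continuous => t; rewrite in_itv /= => t01.
  by have [] := dF _ t01.
- rewrite in_itv /= => c01; rewrite subr0 mulr1 /F scale1r scale0r addr0 => ->.
  by exists c.
Qed.

Lemma derive_scale f x v (a : R) : derivable f x v ->
  is_derive x (a *: v) f (a * 'D_v f x).
Proof.
move=> df.
have [->|a0] := eqVneq a 0.
  by rewrite scale0r mul0r; apply: is_derive0.
have := @line_derive f x v 0; rewrite scale0r addr0 => /(_ df) d0.
have d1 : is_derive (0 : R) 1 (fun s : R => a * s) a.
  by apply: is_derive_eq; rewrite /GRing.scale /= !mulr1.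
have d2 : is_derive (0 : R) 1 ((fun s => f (x + s *: v)) \o (fun s : R => a * s)) ('D_v f x * a).
  by apply: is_derive1_comp; rewrite mulr0.
have E : (fun h : R => h^-1 *:
    ((((fun s => f (x + s *: v)) \o (fun s : R => a * s)) \o shift 0) (h *: (1 : R)) - f x)) =
  (fun h : R => h^-1 *: ((f \o shift x) (h *: (a *: v)) - f x)).
  apply/funext => h /=; congr (_ *: (f _ - _)).
  by rewrite addr0 [h%:A]mulr1 scalerA addrC [a * h]mulrC.
case: d2; rewrite /derivable /derive /= mulr0 scale0r addr0 E => c2 v2.
by apply: DeriveDef => //; rewrite [LHS]v2 mulrC.
Qed.

Lemma dirderE X f x : differentiable f x -> dirder X f x = 'D_(X x) f x.
Proof.
move=> df; rewrite deriveE // [in RHS](plane_sum (X x)) linear_sum /=.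
by apply: eq_bigr => i _; rewrite linearZ /= /pd deriveE.
Qed.

Lemma ball_plane x r : ball x r = [set y | `|x - y| < r].
Proof. by rewrite -ball_normE. Qed.

Lemma open_ballP D x : open D -> D x ->
  exists2 r : R, 0 < r & forall y, `|y - x| < r -> D y.
Proof.
move=> oD Dx; have /nbhs_ballP[r /= r0 h] := open_nbhs_nbhs (conj oD Dx).
by exists r => // y xy; apply: h; rewrite ball_plane /= distrC.
Qed.

(** Increments are controlled one coordinate at a time: moving from [x] to
    [x + h] along the two axes stays in any sup-norm ball around [x]. *)
Lemma differentiable_pd D f x : open D -> D x ->
  (forall i y, D y -> derivable f y (e_ i)) ->
  (forall i, {for x, continuous (pd i f)}) -> differentiable f x.
Proof.
move=> oD Dx df cf.
pose L (h : plane R) : R := \sum_i h 0 i * pd i f x.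
have Llin : linear L.
  move=> a u v; rewrite /L scaler_sumr -big_split /=; apply: eq_bigr => i _.
  by rewrite !mxE mulrDl [_ *: (_ * _)]mulrA.
pose LL : {linear plane R -> R} := HB.pack L (GRing.isLinear.Build _ _ _ _ _ Llin).
have Lc : continuous LL.
  have -> : (LL : plane R -> R) = \sum_i (fun h : plane R => h 0 i * pd i f x).
    by apply/funext => h; rewrite fct_sumE.
  move=> h; elim/big_ind : _ => [|u w cu cw|i _].
  - exact: cst_continuous.
  - exact: (@continuousD _ _ _ u w).
  - apply: (@continuousM _ _ (fun h : plane R => h 0 i) (fun=> pd i f x));
      first exact: coord_continuous.
    exact: cst_continuous.
apply: (proj1 (differentiable_eps Lc _)) => eps eps0.
have [r r0 rD] := open_ballP oD Dx.
have e2 : 0 < eps / 2 by rewrite divr_gt0.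
have /(_ 0) := cf; move=> /cvgrPdist_le /(_ _ e2) /nbhs_ballP[r1 /= r10 h1].
have /(_ 1) := cf; move=> /cvgrPdist_le /(_ _ e2) /nbhs_ballP[r2 /= r20 h2].
have rr : 0 < Num.min r (Num.min r1 r2) by rewrite !lt_min r0 r10 r20.
apply/nbhs_ballP; exists (Num.min r (Num.min r1 r2)) => //= h.
rewrite ball_plane /= sub0r normrN !lt_min => /and3P[hr hr1 hr2].
pose h0 := h 0 0 *: e_ 0; pose h1' := h 0 1 *: e_ 1.
have hE : h = h0 + h1' by rewrite {1}(plane_sum h) sum2.
have small (t a b : R) : 0 <= t <= 1 -> `|a| <= 1 -> `|b| <= 1 -> `|a *: h0 + b *: h1'| <= `|h|.
  move=> _ a1 b1; apply: normv_le => // i.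
  apply: le_trans (normv_coord h i).
  rewrite !mxE; case: (ord2P i) => -> /=;
    rewrite ?mulr1 ?mulr0 ?addr0 ?add0r normrM -[leRHS]mul1r ler_wpM2r//.
have small1 (t : R) : 0 <= t <= 1 -> `|t *: h0| <= `|h|.
  move=> t01; have := @small t t 0 t01; rewrite scale0r addr0; apply; rewrite ?normr0 //.
  by case/andP: t01 => t0 t1; rewrite ger0_norm.
have small2 (t : R) : 0 <= t <= 1 -> `|h0 + t *: h1'| <= `|h|.
  move=> t01; have := @small t 1 t t01; rewrite scale1r; apply; rewrite ?normr1 //.
  by case/andP: t01 => t0 t1; rewrite ger0_norm.
have [t t01 Et] : exists2 t : R, 0 <= t <= 1 & f (x + h0) - f x = 'D_h0 f (x + t *: h0).
  apply: mvt_line => t t01; have [] // := @derive_scale f (x + t *: h0) (e_ 0) (h 0 0) _.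
  by apply: df; apply: rD; rewrite addrAC subrr add0r (le_lt_trans (small1 _ t01)).
have [u u01 Eu] : exists2 u : R, 0 <= u <= 1 & f (x + h0 + h1') - f (x + h0) =
  'D_h1' f (x + h0 + u *: h1').
  apply: mvt_line => u u01; have [] // := @derive_scale f (x + h0 + u *: h1') (e_ 1) (h 0 1) _.
  by apply: df; apply: rD; rewrite -(addrA x) addrAC subrr add0r (le_lt_trans (small2 _ u01)).
have -> : f (h + x) - f x - L h =
   h 0 0 * (pd 0 f (x + t *: h0) - pd 0 f x) + h 0 1 * (pd 1 f (x + h0 + u *: h1') - pd 1 f x).
  rewrite /L sum2.
  have -> : f (h + x) = f x + ('D_h0 f (x + t *: h0)) + 'D_h1' f (x + h0 + u *: h1').
    by rewrite -Et -Eu [in LHS]addrC {1}hE addrA; ring.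
  rewrite (_ : 'D_h0 f _ = h 0 0 * pd 0 f (x + t *: h0)); last first.
    apply: derive_val; apply: derive_scale; apply: df; apply: rD.
    by rewrite addrAC subrr add0r (le_lt_trans (small1 _ t01)).
  rewrite (_ : 'D_h1' f _ = h 0 1 * pd 1 f (x + h0 + u *: h1')); last first.
    apply: derive_val; apply: derive_scale; apply: df; apply: rD.
    by rewrite -(addrA x) addrAC subrr add0r (le_lt_trans (small2 _ u01)).
  ring.
apply: le_trans (ler_normD _ _) _;
  rewrite !normrM (_ : eps * _ = `|h| * (eps / 2) + `|h| * (eps / 2)); last first.
  by rewrite -mulrDr -splitr mulrC.
apply: lerD; apply: ler_pM; rewrite ?normv_coord //.
  rewrite distrC; apply: h1; rewrite ball_plane /= opprD addNKr normrN.
  exact: le_lt_trans (small1 _ t01) _.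
rewrite distrC; apply: h2; rewrite ball_plane /= opprD opprD !addrA subrr add0r -opprD normrN.
exact: le_lt_trans (small2 _ u01) _.
Qed.

Lemma addrCK (V : zmodType) (a b : V) : a + b - a = b.
Proof. by rewrite addrC addKr. Qed.

Lemma open_near D x : open D -> D x -> \near x, D x.
Proof. by move=> oD Dx; apply: open_nbhs_nbhs. Qed.

Lemma near_eq_on D f g x : open D -> D x -> (forall y, D y -> f y = g y) ->
  \near x, f x = g x.
Proof. by move=> oD Dx fg; apply: filterS (open_near oD Dx). Qed.

Lemma pd_eq_on D f g i x : open D -> (forall y, D y -> f y = g y) -> D x ->
  pd i f x = pd i g x.
Proof. by move=> oD fg Dx; apply/near_eq_derive/(near_eq_on oD). Qed.

Lemma dirder_eq_on D X f g x : open D -> (forall y, D y -> f y = g y) -> D x ->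
  dirder X f x = dirder X g x.
Proof.
by move=> oD fg Dx; apply: eq_bigr => i _; rewrite (pd_eq_on _ oD fg).
Qed.

Lemma differentiable_near (V W : normedModType R) (f g : V -> W) (x : V) :
  (\near x, f x = g x) -> differentiable f x -> differentiable g x.
Proof.
move=> fg df; have L := diff_continuous df.
have fgx : f x = g x := nbhs_singleton fg.
have fg0 : \forall h \near (0 : V), f (h + x) = g (h + x).
  by move: fg; rewrite (near_shift 0 x) subr0 /=.
apply: (proj1 (@differentiable_eps R V W g ('d f x) x L _)) => eps eps0.
have /diff_locallyP[_ /eqaddoE/eqaddoP/(_ _ eps0)] := df.
apply: filterS2 fg0 => h <-; rewrite -fgx -addrA -opprD.
exact.
Qed.

Lemma differentiable_eq_on D f g x : open D -> (forall y, D y -> f y = g y) -> D x ->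
  differentiable f x -> differentiable g x.
Proof. by move=> oD fg Dx; apply/differentiable_near/(near_eq_on oD). Qed.

Lemma differentiable_comp1 (F : R -> R) f x a : is_derive (f x) 1 F a ->
  differentiable f x -> differentiable (F \o f) x.
Proof.
move=> dF df; apply: differentiable_comp => //.
by apply/derivable1_diffP; case: dF.
Qed.

Lemma derive_comp1 (F : R -> R) f x v a : is_derive (f x) 1 F a ->
  differentiable f x -> 'D_v (F \o f) x = a * 'D_v f x.
Proof.
move=> dF df.
have dF' : differentiable F (f x) by apply/derivable1_diffP; case: dF.
rewrite !deriveE //; last exact: differentiable_comp.
rewrite diff_comp //= diff1E // derive1E.
by case: dF => _ ->; rewrite mulrC.
Qed.

Lemma differentiable_coords X x : (forall i, differentiable (fun y => X y 0 i) x) ->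
  differentiable X x.
Proof.
move=> dX; have -> : X = \sum_i (fun y => X y 0 i *: e_ i).
  by apply/funext => y; rewrite fct_sumE -plane_sum.
by apply: differentiable_sum => i; apply: differentiableZl.
Qed.

Lemma differentiable_coordE X x i : differentiable X x ->
  differentiable (fun y => X y 0 i) x.
Proof.
move=> dX; apply: (@differentiable_comp _ _ _ _ X (fun y : plane R => y 0 i)) => //.
exact: differentiable_coord.
Qed.

Lemma derive_coord X x v i : differentiable X x ->
  'D_v (fun y => X y 0 i) x = 'D_v X x 0 i.
Proof.
by move=> dX; rewrite derive_mx ?mxE //; apply: diff_derivable.
Qed.

Lemma jacobianE X x i j : differentiable X x -> 'J X x i j = pd i (fun y => X y 0 j) x.
Proof.
move=> dX; rewrite /pd derive_coord // deriveEjacobian //.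
by rewrite -rowE [RHS]mxE.
Qed.

Lemma pd_comp f X x i : differentiable f (X x) -> differentiable X x ->
  pd i (f \o X) x = \sum_j pd i (fun y => X y 0 j) x * pd j f (X x).
Proof.
move=> df dX; rewrite /pd deriveE; last exact: differentiable_comp.
rewrite diff_comp //= [X in 'd f _ X](plane_sum) linear_sum; apply: eq_bigr => j _.
by rewrite linearZ /= derive_coord // !deriveE.
Qed.

Lemma derive_sum_pd f x v : differentiable f x -> 'D_v f x = \sum_i v 0 i * pd i f x.
Proof. by move=> df; rewrite -(dirderE (fun=> v) df). Qed.

(** The constant is [2] because [`|v|] bounds both coordinates of [v]. *)
Lemma lipschitz_pd f (c : plane R) (r eps : R) x y :
  (forall z, `|z - c| < r -> differentiable f z) ->
  (forall z i, `|z - c| < r -> `|pd i f z| <= eps) ->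
  `|x - c| < r -> `|y - c| < r -> `|f y - f x| <= 2 * eps * `|y - x|.
Proof.
move=> df bf xr yr; pose v := y - x.
have seg (t : R) : 0 <= t <= 1 -> `|x + t *: v - c| < r.
  case/andP => t0 t1.
  have -> : x + t *: v - c = (1 - t) *: (x - c) + t *: (y - c).
    by rewrite /v !scalerBr scalerBl scale1r scalerBl scale1r;
      apply/matrixP => i j; rewrite !mxE; ring.
  apply: le_lt_trans (ler_normD _ _) _; rewrite !normrZ (ger0_norm t0) ger0_norm ?subr_ge0//.
  move: t0; rewrite le_eqVlt => /orP[/eqP <-|t0]; first by rewrite subr0 mul1r mul0r addr0.
  rewrite [ltRHS](_ : r = (1 - t) * r + t * r); last by ring.
  by rewrite ler_ltD // ?ltr_pM2l // ler_wpM2l ?subr_ge0 // ltW.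
have [t t01] := @mvt_line f x v (fun t t01 => diff_derivable (df _ (seg t t01))).
have -> : x + v = y by rewrite /v addrC subrK.
move=> ->; rewrite derive_sum_pd; last exact/df/seg.
rewrite sum2; apply: le_trans (ler_normD _ _) _; rewrite !normrM.
rewrite (_ : 2 * eps * _ = `|v| * eps + `|v| * eps); last by rewrite /v; ring.
by apply: lerD; apply: ler_pM => //; rewrite ?normv_coord // bf // seg.
Qed.

Lemma cst_of_pd0 f (c : plane R) (r : R) x y :
  (forall z, `|z - c| < r -> differentiable f z) ->
  (forall z i, `|z - c| < r -> pd i f z = 0) ->
  `|x - c| < r -> `|y - c| < r -> f y = f x.
Proof.
move=> df bf xr yr; have := @lipschitz_pd f c r 0 x y df _ xr yr.
rewrite mulr0 mul0r => h; apply/subr0_eq/eqP; rewrite -normr_le0; apply: h.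
by move=> z i zr; rewrite bf // normr0.
Qed.

Lemma is_derive_shiftv f x v (c : plane R) (df : R) : is_derive (x + c) v f df ->
  is_derive x v (fun y => f (y + c)) df.
Proof.
move=> [d1 d2].
have E : (fun h : R => h^-1 *: (((fun y => f (y + c)) \o shift x) (h *: v) - f (x + c)))
  = (fun h : R => h^-1 *: ((f \o shift (x + c)) (h *: v) - f (x + c))).
  by apply/funext => h /=; rewrite addrA.
by apply: DeriveDef; rewrite /derivable /derive E.
Qed.

(** The mean value theorem in the direction [e_i], applied to the increment
    [y |-> f (y + h *: e_j) - f y], then in the direction [e_j]. *)
Lemma second_difference f x (h : R) (i j : 'I_2) :
  (forall s t : R, 0 <= s <= 1 -> 0 <= t <= 1 ->
    let z := x + s *: (h *: e_ i) + t *: (h *: e_ j) in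
    derivable f z (e_ i) /\ derivable (pd i f) z (e_ j)) ->
  exists s t : R, [/\ 0 <= s <= 1, 0 <= t <= 1 &
    f (x + h *: e_ i + h *: e_ j) - f (x + h *: e_ i) - (f (x + h *: e_ j) - f x)
    = h * h * pd j (pd i f) (x + s *: (h *: e_ i) + t *: (h *: e_ j))].
Proof.
have i0 : 0 <= (0 : R) <= 1 by rewrite lexx ler01.
have i1 : 0 <= (1 : R) <= 1 by rewrite lexx ler01.
move=> H; pose F y := f (y + h *: e_ j) - f y.
have dF (s : R) : 0 <= s <= 1 -> let y := x + s *: (h *: e_ i) in
    is_derive y (h *: e_ i) F (h * pd i f (y + h *: e_ j) - h * pd i f y).
  move=> s01; have [d1 _] := H s 1 s01 i1; have [d2 _] := H s 0 s01 i0.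
  move: d1 d2; cbv zeta; rewrite scale1r scale0r addr0 => d1 d2.
  have D2 := derive_scale h d2; have D1 := is_derive_shiftv (derive_scale h d1).
  exact: is_deriveB.
have [s s01 Es] := mvt_line (fun t t01 => @ex_derive _ _ _ _ _ _ _ (dF t t01)).
have [t t01 Et] : exists2 t : R, 0 <= t <= 1 &
    pd i f (x + s *: (h *: e_ i) + h *: e_ j) - pd i f (x + s *: (h *: e_ i)) =
    'D_(h *: e_ j) (pd i f) (x + s *: (h *: e_ i) + t *: (h *: e_ j)).
  by apply: mvt_line => t t01; have [_ /derive_scale] := H s t s01 t01; case/(_ h).
exists s, t; split => //; move: Es; rewrite /F (derive_val (is_derive := dF _ s01)).
rewrite [x + h *: e_ i + _]addrAC => ->.
rewrite -mulrBr Et -mulrA; congr (_ * _).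
by apply: derive_val; apply: derive_scale; have [] := H s t s01 t01.
Qed.

Lemma dist_le_halves (a b c d : R) : `|b - c| <= d / 2 -> `|a - c| <= d / 2 -> `|a - b| <= d.
Proof.
rewrite [`|b - c|]distrC => bc ac; rewrite -(subrKA c) (splitr d).
by apply: le_trans (ler_normD _ _) _; exact: lerD.
Qed.

(** Both mixed derivatives are limits of the same second difference quotient,
    which is symmetric in the two directions. *)
Lemma pd_sym D f x i j : open D -> D x ->
  (forall y k, D y -> derivable f y (e_ k)) ->
  (forall y k l, D y -> derivable (pd k f) y (e_ l)) ->
  (forall k l, {for x, continuous (pd k (pd l f))}) ->
  pd i (pd j f) x = pd j (pd i f) x.
Proof.
move=> oD Dx d1 d2 cf.
apply/subr0_eq/eqP; rewrite -normr_le0; apply/ler_addgt0Pr => eps eps0; rewrite add0r.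
have [r r0 rD] := open_ballP oD Dx.
have e2 : 0 < eps / 2 by rewrite divr_gt0.
have /(_ i j) := cf; move=> /cvgrPdist_le /(_ _ e2) /nbhs_ballP[r1 /= r10 h1].
have /(_ j i) := cf; move=> /cvgrPdist_le /(_ _ e2) /nbhs_ballP[r2 /= r20 h2].
have rr : 0 < Num.min r (Num.min r1 r2) by rewrite !lt_min r0 r10 r20.
move: rr; set rho := Num.min _ _ => rr.
have [h h0 h3] : exists2 h : R, 0 < h & h * 3 = rho.
  by exists (rho / 3); rewrite ?divr_gt0 // divfK.
have small (k l : 'I_2) (s t : R) : 0 <= s <= 1 -> 0 <= t <= 1 ->
    `|s *: (h *: e_ k) + t *: (h *: e_ l)| < rho.
  move=> /andP[s0 s1] /andP[t0 t1].
  have b (u : R) m : 0 <= u -> u <= 1 -> `|u *: (h *: e_ m)| <= h.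
    move=> u0 u1; apply: normv_le; first exact: ltW.
    move=> n; rewrite !mxE eqxx /= !normrM (ger0_norm u0) (gtr0_norm h0).
    case: (n == m); rewrite ?normr1 ?normr0 ?mulr1 ?mulr0 ?(ltW h0) //.
    by rewrite ler_piMl // ltW.
  apply: le_lt_trans (ler_normD _ _) _.
  apply: le_lt_trans (lerD (b _ _ s0 s1) (b _ _ t0 t1)) _.
  by move: h3 rr h0; lra.
have inD (k l : 'I_2) (s t : R) : 0 <= s <= 1 -> 0 <= t <= 1 ->
    D (x + s *: (h *: e_ k) + t *: (h *: e_ l)).
  move=> s01 t01; apply: rD; rewrite -(addrA x) addrCK.
  by apply: lt_le_trans (small _ _ _ _ s01 t01) _; rewrite /rho ge_min lexx.
have [|s [t [s01 t01 E1]]] := @second_difference f x h i j.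
  by move=> s t s01 t01 z; split; [apply: d1|apply: d2]; apply: inD.
have [|s' [t' [s01' t01' E2]]] := @second_difference f x h j i.
  by move=> ? ? ? ? z; split; [apply: d1|apply: d2]; apply: inD.
have : h * h * pd j (pd i f) (x + s *: (h *: e_ i) + t *: (h *: e_ j)) =
       h * h * pd i (pd j f) (x + s' *: (h *: e_ j) + t' *: (h *: e_ i)).
  have swap (a b c d : R) : a - b - (c - d) = a - c - (b - d) by ring.
  apply: etrans (esym E1) _; apply: etrans _ E2.
  rewrite (addrAC x (h *: e_ j)); exact: swap.
have hh : h * h != 0 by rewrite mulf_neq0 // gt_eqF.
move/(mulfI hh) => E.
have C1 : `|pd j (pd i f) x - pd j (pd i f) (x + s *: (h *: e_ i) + t *: (h *: e_ j))| <= eps / 2.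
  apply: h2; rewrite ball_plane /= -(addrA x) opprD addNKr normrN.
  by apply: lt_le_trans (small _ _ _ _ s01 t01) _; rewrite /rho !ge_min lexx !orbT.
have C2 : `|pd i (pd j f) x - pd i (pd j f) (x + s' *: (h *: e_ j) + t' *: (h *: e_ i))| <= eps / 2.
  apply: h1; rewrite ball_plane /= -(addrA x) opprD addNKr normrN.
  by apply: lt_le_trans (small _ _ _ _ s01' t01') _; rewrite /rho !ge_min lexx !orbT.
rewrite E in C1.
exact: dist_le_halves C1 C2.
Qed.

End Calculus.

(** * Smooth functions *)

Lemma det2 (F : comRingType) (A : 'M[F]_2) :
  \det A = A 0 0 * A 1 1 - A 0 1 * A 1 0.
Proof.
have l0 : lift 0 0 = 1 :> 'I_2 by exact/val_inj.
have l1 : lift 1 0 = 0 :> 'I_2 by exact/val_inj.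
by rewrite (expand_det_row _ 0) sum2 /cofactor !det_mx11 !mxE l0 l1 /= expr0 expr1; ring.
Qed.

Section Smooth.
Variable R : realType.
Implicit Types (x y v : plane R) (f g : plane R -> R) (X Y : plane R -> plane R)
  (D E : set (plane R)).

Local Notation e_ i := (delta_mx 0 i : plane R).

Lemma smooth_cont D f x : smooth_on D f -> D x -> {for x, continuous f}.
Proof. by move=> sf Dx; have [] := sf [::] x Dx. Qed.

Lemma smooth_derivable D f x i : smooth_on D f -> D x -> derivable f x (e_ i).
Proof. by move=> sf Dx; have [_] := sf [::] x Dx. Qed.

Lemma smooth_pd D f i : smooth_on D f -> smooth_on D (pd i f).
Proof. by move=> sf s x Dx; have := sf (rcons s i) x Dx; rewrite foldr_rcons. Qed.

Lemma smooth_differentiable D f x : open D -> smooth_on D f -> D x ->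
  differentiable f x.
Proof.
move=> oD sf Dx; apply: (differentiable_pd oD Dx) => [i y Dy|i].
  exact: smooth_derivable Dy.
exact/(smooth_cont _ Dx)/smooth_pd.
Qed.

Lemma smooth_pd_sym D f i j x : open D -> smooth_on D f -> D x ->
  pd i (pd j f) x = pd j (pd i f) x.
Proof.
move=> oD sf Dx; apply: (@pd_sym R D f x i j oD Dx) => [y k Dy|y k l Dy|k l].
- exact: smooth_derivable sf Dy.
- exact: smooth_derivable (smooth_pd _ sf) Dy.
- exact: smooth_cont (smooth_pd _ (smooth_pd _ sf)) Dx.
Qed.

Lemma smooth_sub D E f : E `<=` D -> smooth_on D f -> smooth_on E f.
Proof. by move=> ED sf s x /ED; apply: sf. Qed.

Lemma smooth_of_pd D f : (forall x, D x -> differentiable f x) ->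
  (forall i, smooth_on D (pd i f)) -> smooth_on D f.
Proof.
move=> df sf s x Dx; case/lastP: s => [|s i]; last by rewrite foldr_rcons; apply: sf.
split => [|i]; first exact/differentiable_continuous/df.
exact/diff_derivable/df.
Qed.

(** The functions obtained from a basic class [B] by the operations of the
    calculus.  One induction over this class, instead of one per operation,
    shows that it is stable under partial derivatives as soon as it contains
    those of the functions in [B]. *)
Inductive generated (B : (plane R -> R) -> Prop) D : (plane R -> R) -> Prop :=
| gen_base f : B f -> generated B D f
| gen_cst (c : R) : generated B D (fun=> c)
| gen_add f g : generated B D f -> generated B D g ->
    generated B D (fun x => f x + g x)
| gen_mul f g : generated B D f -> generated B D g ->
    generated B D (fun x => f x * g x)
| gen_inv f : generated B D f -> (forall x, D x -> f x != 0) ->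
    generated B D (fun x => (f x)^-1)
| gen_sqrt f : generated B D f -> (forall x, D x -> 0 < f x) ->
    generated B D (fun x => Num.sqrt (f x))
| gen_ln f : generated B D f -> (forall x, D x -> 0 < f x) ->
    generated B D (fun x => ln (f x))
| gen_exp f : generated B D f -> generated B D (fun x => expR (f x))
| gen_comp E f X : open E -> smooth_on E f -> (forall x, D x -> E (X x)) ->
    (forall j, generated B D (fun x => X x 0 j)) -> generated B D (f \o X)
| gen_ext f g : (forall x, D x -> f x = g x) -> generated B D f ->
    generated B D g.

Section Generated.
Variables (B : (plane R -> R) -> Prop) (D : set (plane R)).
Hypothesis oD : open D.
Hypothesis dB : forall f x, B f -> D x -> differentiable f x.
Hypothesis pB : forall f i, B f -> generated B D (pd i f).

Lemma generated_comp1 (F F' : R -> R) f :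
  (forall x, D x -> is_derive (f x) 1 F (F' (f x))) ->
  (forall x, D x -> differentiable f x) -> (forall i, generated B D (pd i f)) ->
  generated B D (F' \o f) ->
  (forall x, D x -> differentiable (F \o f) x) /\
  (forall i, generated B D (pd i (F \o f))).
Proof.
move=> dF df pf gF; split => [x Dx|i].
  by apply: differentiable_comp1 (dF _ Dx) (df _ Dx).
apply: gen_ext (gen_mul gF (pf i)) => x Dx.
by rewrite /pd (derive_comp1 _ (dF _ Dx) (df _ Dx)).
Qed.

Lemma generated_pd f : generated B D f ->
  (forall x, D x -> differentiable f x) /\ (forall i, generated B D (pd i f)).
Proof.
elim => {f} [f Bf|c|f g _ [df pf] _ [dg pg]|f g gf [df pf] gg [dg pg]|f gf [df pf] f0
  |f gf [df pf] f0|f gf [df pf] f0|f gf [df pf]|E f X oE sf EX gX IH|f g fg gf [df pf]].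
- by split => [x Dx|i]; [exact: dB|exact: pB].
- split => [x Dx|i]; first exact: differentiable_cst.
  by apply: gen_ext (gen_cst _ _ 0) => x Dx; rewrite /pd derive_cst.
- split => [x Dx|i]; first by apply: (@differentiableD _ _ _ f g); auto.
  apply: gen_ext (gen_add (pf i) (pg i)) => x Dx.
  by rewrite /pd (@deriveD _ _ _ f g) //; apply: diff_derivable; auto.
- split => [x Dx|i]; first by apply: (@differentiableM _ _ f g); auto.
  apply: gen_ext (gen_add (gen_mul gf (pg i)) (gen_mul gg (pf i))) => x Dx.
  by rewrite /pd (@deriveM _ _ f g) //; apply: diff_derivable; auto.
- split => [x Dx|i]; first by apply: (@differentiableV _ _ f); auto.
  apply: gen_ext (gen_mul (gen_mul (gen_cst _ _ (-1)) (gen_mul (gen_inv gf f0) (gen_inv gf f0)))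
    (pf i)) => x Dx.
  rewrite /pd (@deriveV _ _ f); [|exact: f0|by apply: diff_derivable; auto].
  by rewrite /GRing.scale /= mulN1r -exprVn expr2.
- apply: (@generated_comp1 Num.sqrt (fun t => (2 * Num.sqrt t)^-1) f) => // [x Dx|].
    by apply: is_derive1_sqrt; apply: f0.
  apply: gen_inv => [|x Dx]; first exact/gen_mul/gen_sqrt/f0/gf/gen_cst.
  by rewrite mulf_neq0 // gt_eqF // sqrtr_gt0 f0.
- apply: (@generated_comp1 (@ln R) (fun t => t^-1) f) => // [x Dx|].
    by apply: is_derive1_ln; apply: f0.
  by apply: gen_inv => // x Dx; rewrite gt_eqF // f0.
- by apply: (@generated_comp1 expR expR f) => //; exact: gen_exp.
- have dX x : D x -> differentiable X x.
    by move=> Dx; apply: differentiable_coords => j; have [dj _] := IH j; apply: dj.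
  have df x : D x -> differentiable f (X x).
    by move=> Dx; apply: smooth_differentiable oE sf (EX _ Dx).
  split => [x Dx|i]; first by apply: differentiable_comp; auto.
  apply: gen_ext (gen_add (gen_mul ((IH 0).2 i) (gen_comp oE (smooth_pd 0 sf) EX gX))
     (gen_mul ((IH 1).2 i) (gen_comp oE (smooth_pd 1 sf) EX gX))) => x Dx.
  by rewrite pd_comp ?sum2 //; auto.
- split => [x Dx|i]; first exact: differentiable_eq_on oD fg Dx (df _ Dx).
  by apply: gen_ext (pf i) => x Dx; apply: pd_eq_on fg Dx.
Qed.

Lemma generated_smooth f : generated B D f -> smooth_on D f.
Proof.
move=> gf s; have gs : generated B D (foldr (@pd R) f s).
  by elim: s => //= i s IH; apply: (generated_pd IH).2.
move=> x Dx; split => [|i]; [apply: differentiable_continuous|apply: diff_derivable];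
  exact: (generated_pd gs).1.
Qed.

End Generated.

Section Closure.
Variable D : set (plane R).
Hypothesis oD : open D.

Let smooth_gen f : generated (smooth_on D) D f -> smooth_on D f.
Proof.
apply: generated_smooth => // [g x sg Dx|g i sg].
  exact: smooth_differentiable sg Dx.
exact/gen_base/smooth_pd.
Qed.

Lemma smooth_cst (c : R) : smooth_on D (fun=> c).
Proof. exact/smooth_gen/gen_cst. Qed.

Lemma smooth_ext f g : (forall x, D x -> f x = g x) -> smooth_on D f ->
  smooth_on D g.
Proof. by move=> fg sf; apply/smooth_gen/(gen_ext fg)/gen_base. Qed.

Lemma smooth_add f g : smooth_on D f -> smooth_on D g ->
  smooth_on D (fun x => f x + g x).
Proof. by move=> sf sg; apply/smooth_gen/gen_add; apply: gen_base. Qed.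

Lemma smooth_mul f g : smooth_on D f -> smooth_on D g ->
  smooth_on D (fun x => f x * g x).
Proof. by move=> sf sg; apply/smooth_gen/gen_mul; apply: gen_base. Qed.

Lemma smooth_opp f : smooth_on D f -> smooth_on D (fun x => - f x).
Proof.
move=> sf; apply: smooth_ext (smooth_mul (smooth_cst (-1)) sf) => x _.
by rewrite mulN1r.
Qed.

Lemma smooth_inv f : smooth_on D f -> (forall x, D x -> f x != 0) ->
  smooth_on D (fun x => (f x)^-1).
Proof. by move=> sf f0; apply/smooth_gen/gen_inv => //; apply: gen_base. Qed.

Lemma smooth_sqrt f : smooth_on D f -> (forall x, D x -> 0 < f x) ->
  smooth_on D (fun x => Num.sqrt (f x)).
Proof. by move=> sf f0; apply/smooth_gen/gen_sqrt => //; apply: gen_base. Qed.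

Lemma smooth_ln f : smooth_on D f -> (forall x, D x -> 0 < f x) ->
  smooth_on D (fun x => ln (f x)).
Proof. by move=> sf f0; apply/smooth_gen/gen_ln => //; apply: gen_base. Qed.

Lemma smooth_exp f : smooth_on D f -> smooth_on D (fun x => expR (f x)).
Proof. by move=> sf; apply/smooth_gen/gen_exp; apply: gen_base. Qed.

Lemma smooth_comp E f X : open E -> smooth_on E f ->
  (forall x, D x -> E (X x)) -> (forall j, smooth_on D (fun x => X x 0 j)) ->
  smooth_on D (f \o X).
Proof.
move=> oE sf EX sX; apply/smooth_gen/(gen_comp oE sf EX) => j.
exact: gen_base.
Qed.

Lemma smooth_sum (I : finType) (F : I -> plane R -> R) :
  (forall i, smooth_on D (F i)) -> smooth_on D (fun x => \sum_i F i x).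
Proof.
move=> sF; suff H (s : seq I) : smooth_on D (fun x => \sum_(i <- s) F i x) by exact: H.
elim: s => [|i s IH].
  by apply: smooth_ext (smooth_cst 0) => x _; rewrite big_nil.
by apply: smooth_ext (smooth_add (sF i) IH) => x _; rewrite big_cons.
Qed.

Lemma smooth_exprn f n : smooth_on D f -> smooth_on D (fun x => f x ^+ n).
Proof.
move=> sf; elim: n => [|n IH].
  by apply: smooth_ext (smooth_cst 1) => x _; rewrite expr0.
by apply: smooth_ext (smooth_mul sf IH) => x _; rewrite exprS.
Qed.

Lemma smooth_dirder X f : (forall i, smooth_on D (fun x => X x 0 i)) ->
  smooth_on D f -> smooth_on D (dirder X f).
Proof.
move=> sX sf; apply: smooth_sum => i; exact: smooth_mul (sX i) (smooth_pd i sf).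
Qed.

Lemma smooth_mulmx m n p (A : plane R -> 'M[R]_(m, n)) (B : plane R -> 'M[R]_(n, p)) :
  (forall i j, smooth_on D (fun x => A x i j)) ->
  (forall i j, smooth_on D (fun x => B x i j)) ->
  forall i j, smooth_on D (fun x => (A x *m B x) i j).
Proof.
move=> sA sB i j.
have : smooth_on D (fun x => \sum_k A x i k * B x k j).
  by apply: smooth_sum => k; apply: smooth_mul.
by apply: smooth_ext => x _; rewrite mxE.
Qed.

Lemma smooth_det (A : plane R -> 'M[R]_2) :
  (forall i j, smooth_on D (fun x => A x i j)) -> smooth_on D (fun x => \det (A x)).
Proof.
move=> sA; have : smooth_on D (fun x => A x 0 0 * A x 1 1 + - (A x 0 1 * A x 1 0)).
  by apply: smooth_add; [|apply: smooth_opp]; apply: smooth_mul.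
by apply: smooth_ext => x _; rewrite det2.
Qed.

Lemma smooth_invmx (A : plane R -> 'M[R]_2) :
  (forall i j, smooth_on D (fun x => A x i j)) ->
  (forall x, D x -> A x \in unitmx) ->
  forall i j, smooth_on D (fun x => invmx (A x) i j).
Proof.
move=> sA uA i j.
have dinv : smooth_on D (fun x => (\det (A x))^-1).
  apply: smooth_inv => [|x Dx]; first exact: smooth_det.
  by have := uA x Dx; rewrite unitmxE unitfE.
have sadj : smooth_on D (fun x => (\adj (A x)) i j).
  have : smooth_on D (fun x => (-1) ^+ (j + i) * A x (lift j 0) (lift i 0)).
    exact: (smooth_mul (smooth_cst _) (sA _ _)).
  by apply: smooth_ext => x _; rewrite mxE /cofactor det_mx11 !mxE.
apply: smooth_ext (smooth_mul dinv sadj) => x Dx.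
rewrite /invmx (uA x Dx). by rewrite [RHS]mxE.
Qed.

End Closure.
End Smooth.

(** * The inverse function theorem *)

Section Inverse.
Variable R : realType.
Implicit Types (x y v : plane R) (f g : plane R -> R) (X Y : plane R -> plane R)
  (D E : set (plane R)).

Local Notation e_ i := (delta_mx 0 i : plane R).

Lemma coordB x y j : (x - y) 0 j = x 0 j - y 0 j.
Proof. by rewrite !mxE. Qed.

Lemma mulmx_bound (L : 'M[R]_2) : exists2 k : R, 0 < k & forall v, `|v *m L| <= k * `|v|.
Proof.
pose k := \sum_i \sum_j `|L i j|.
have k0 : 0 <= k by apply: sumr_ge0 => i _; apply: sumr_ge0.
exists (k + 1) => [|v]; first by rewrite ltr_wpDl.
apply: normv_le => [|j]; first by rewrite mulr_ge0 ?addr_ge0.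
apply: (@le_trans _ _ (k * `|v|)); last by rewrite ler_wpM2r // lerDl.
rewrite mxE mulr_suml; apply: le_trans (ler_norm_sum _ _ _) _.
apply: ler_sum => i _; rewrite normrM mulrC ler_pM ?normv_coord //.
by rewrite (bigD1 j) //= lerDl sumr_ge0.
Qed.

Lemma pd_coord i j x : pd i (fun y : plane R => y 0 j) x = (i == j)%:R.
Proof.
rewrite /pd (@derive_coord R id); last exact: ex_diff.
by rewrite derive_id mxE eqxx eq_sym.
Qed.

Lemma smooth_coord D j : open D -> smooth_on D (fun y : plane R => y 0 j).
Proof.
move=> oD; apply: smooth_of_pd => [x _|i]; first exact: differentiable_coord.
by apply: smooth_ext (smooth_cst oD ((i == j)%:R : R)) => // x _; rewrite pd_coord.
Qed.

(** A perturbation of the identity with small derivative is handled by the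
    contraction principle: the equation [w - N w = z] reads [w = N w + z]. *)
Lemma contraction_solve (N : plane R -> plane R) x (r : R) (z : plane R) : 0 < r ->
  (forall u w, `|u - x| <= r -> `|w - x| <= r -> `|N u - N w| <= 2^-1 * `|u - w|) ->
  `|N x + z - x| <= r / 2 ->
  exists2 w, `|w - x| <= r & w = N w + z.
Proof.
move=> r0 lip zr.
pose U := closed_ball x r.
have UE u : U u = (`|u - x| <= r) by rewrite /U closed_ballE //= distrC.
have fS u : U u -> U (N u + z).
  rewrite !UE => ur.
  have -> : N u + z - x = (N u - N x) + (N x + z - x).
    by apply/matrixP => i j; rewrite !mxE; ring.
  apply: le_trans (ler_normD _ _) _; rewrite (splitr r) lerD // (le_trans (lip _ _ ur _)) //.
    by rewrite subrr normr0 ltW.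
  by rewrite mulrC ler_wpM2r ?invr_ge0.
pose F : {fun U >-> U} := HB.pack (fun u => N u + z) (isFun.Build _ _ U U (fun u => N u + z) fS).
have cF : is_contraction F.
  have h0 : (0 : R) <= 2^-1 by rewrite invr_ge0.
  exists (NngNum h0); split => /=; first by rewrite invf_lt1 ?ltr1n.
  case=> u w [/= Uu Uw]; rewrite UE in Uu; rewrite UE in Uw.
  by rewrite opprD addrACA subrr addr0; apply: lip.
pose V : completeNormedModType R := HB.pack (plane R).
have [||w Uw wE] := @banach_fixed_point R V U F cF.
- exact: closed_ball_closed.
- by exists x; rewrite UE subrr normr0 ltW.
- by exists w => //; rewrite -UE.
Qed.

Lemma mulmxr_continuous (L : 'M[R]_2) : continuous (mulmxr L : plane R -> plane R).
Proof.
have [k k0 kL] := mulmx_bound L.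
apply/(@linear_bounded_continuous _ _ _ (mulmxr L)); apply/linear_boundedP; near=> r => x.
rewrite /=; apply: le_trans (kL x) _; rewrite ler_wpM2r //.
Unshelve. all: by end_near. Qed.

Lemma smooth_jacobian D X i j : open D -> (forall k, smooth_on D (fun x => X x 0 k)) ->
  smooth_on D (fun x => 'J X x i j).
Proof.
move=> oD sX; apply: smooth_ext (smooth_pd i (sX j)) => // x Dx.
by rewrite jacobianE //; apply: differentiable_coords => k;
  exact: smooth_differentiable oD (sX k) Dx.
Qed.

(** With [J] the Jacobian of [X], the remainder of [Y] is that of [X] multiplied
    by [J^-1]; it is negligible because [Y] is Lipschitz at [y]. *)
Lemma differentiable_inverse (X Y : plane R -> plane R) y (k : R) :
  differentiable X (Y y) -> 'J X (Y y) \in unitmx -> 0 < k ->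
  (\near y, X (Y y) = y) ->
  (\forall z \near y, `|Y z - Y y| <= k * `|z - y|) ->
  differentiable Y y /\ 'J Y y = invmx ('J X (Y y)).
Proof.
move=> dX uJ k0 XY lip; set J := 'J X (Y y) in uJ *.
have [k' k'0 kJ] := mulmx_bound (invmx J).
have [] := @differentiable_eps R _ _ Y (mulmxr (invmx J)) y (@mulmxr_continuous _).
  move=> eps eps0; pose eps' := eps / (k' * k).
  have eps'0 : 0 < eps' by rewrite divr_gt0 // mulr_gt0.
  have /diff_locallyP[_ /eqaddoE/eqaddoP/(_ _ eps'0)] := dX.
  move/nbhs_ballP => [r /= r0 hr].
  have XYy : X (Y y) = y := nbhs_singleton XY.
  have lip0 : \forall h \near (0 : plane R), `|Y (h + y) - Y y| <= k * `|h|.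
    move: lip; rewrite (near_shift 0 y) subr0 /=; apply: filterS => h.
    by rewrite /= addrK.
  have XY0 : \forall h \near (0 : plane R), X (Y (h + y)) = h + y.
    by move: XY; rewrite (near_shift 0 y) subr0 /=.
  have rk : 0 < r / k by rewrite divr_gt0.
  have small : \forall h \near (0 : plane R), `|h| < r / k.
    apply/nbhs_ballP; exists (r / k) => // h /=.
    by rewrite ball_plane /= sub0r normrN.
  apply: filterS3 lip0 XY0 small => h hl hX hs; pose w := Y (h + y) - Y y.
  have wr : ball 0 r w.
    rewrite ball_plane /= sub0r normrN; apply: le_lt_trans hl _.
    by rewrite mulrC -ltr_pdivlMr.
  have := hr w wr; rewrite /= -[X in `|X|]/(X (w + Y y) - (X (Y y) + 'd X (Y y) w)).
  rewrite /w subrK hX XYy -/w opprD addrA addrK => hh.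
  have dE : 'd X (Y y) w = w *m J by rewrite /J /jacobian mul_rV_lin1.
  have -> : Y (h + y) - Y y - mulmxr (invmx J) h = - ((h - w *m J) *m invmx J).
    by rewrite /= mulmxBl mulmxK // opprB.
  rewrite normrN; apply: le_trans (kJ _) _; rewrite -dE.
  apply: le_trans (_ : k' * (eps' * (k * `|h|)) <= _).
    apply: ler_wpM2l; first exact: ltW.
    by apply: le_trans hh _; apply: ler_wpM2l => //; exact: ltW.
  by rewrite /eps' le_eqVlt; apply/orP; left; apply/eqP; field; rewrite !gt_eqF.
move=> dY dE; split => //; apply/matrixP => i j.
by rewrite /jacobian dE [LHS]mxE /= -rowE [LHS]mxE.
Qed.

(** For [L] the inverse of the Jacobian at [x0], the map [x - X x *m L] has small
    derivative near [x0], and [contraction_solve] inverts [X] there.  The partial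
    derivatives of the inverse [Y] are smooth functions of [Y], so they lie in the
    class generated by the coordinates of [Y], which are therefore smooth. *)
Lemma local_inverse D (X : plane R -> plane R) x0 : open D -> D x0 ->
  (forall j, smooth_on D (fun x => X x 0 j)) ->
  (forall x, D x -> 'J X x \in unitmx) ->
  exists (W : set (plane R)) (Y : plane R -> plane R),
  [/\ open W, W x0 & W `<=` D] /\
  [/\ open (X @` W), (forall x, W x -> Y (X x) = x) &
      forall j, smooth_on (X @` W) (fun y => Y y 0 j)].
Proof.
move=> oD Dx0 sX uJ; pose L := invmx ('J X x0).
have uL : L \in unitmx by rewrite unitmx_inv uJ.
pose N x := x - X x *m L.
have sN j : smooth_on D (fun x => N x 0 j).
  have sXL : smooth_on D (fun x => (X x *m L) 0 j).
    apply: (@smooth_mulmx _ _ oD _ _ _ X (fun=> L)) => [i k|i k]; last exact: smooth_cst.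
    by rewrite (ord1 i).
  apply: smooth_ext (smooth_add oD (smooth_coord j oD) (smooth_opp oD sXL)) => // x _.
  by rewrite /N !mxE.
have dX x : D x -> differentiable X x.
  by move=> Dx; apply: differentiable_coords => j; exact: smooth_differentiable oD (sX j) Dx.
have N0 i j : pd i (fun x => N x 0 j) x0 = 0.
  pose G k : plane R -> R := fun x => X x 0 k.
  have dG k : derivable (G k) x0 (e_ i) := smooth_derivable (sX k) Dx0.
  have NE : (fun x => N x 0 j) = (fun x => x 0 j) - \sum_k (L k j \*: G k).
    apply/funext => x; rewrite /N mxE [in LHS]mxE mxE.
    rewrite -[RHS]/(x 0 j - (\sum_k (L k j \*: G k)) x) fct_sumE.
    by congr (_ - _); apply: eq_bigr => k _; rewrite mulrC.
  rewrite /pd NE deriveB; last first.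
  - by apply: derivable_sum => k; apply: derivableZ.
  - exact: smooth_derivable (smooth_coord j oD) Dx0.
  rewrite derive_sum => [|k]; last exact: derivableZ.
  have -> : 'D_(e_ i) (fun x : plane R => x 0 j) x0 = (i == j)%:R by exact: pd_coord.
  have JL : ('J X x0 *m L) i j = (i == j)%:R by rewrite mulmxV ?uJ // mxE.
  rewrite -JL mxE; apply/eqP; rewrite subr_eq0; apply/eqP; apply: eq_bigr => k _.
  by rewrite deriveZ // [RHS]mulrC jacobianE //; exact: dX.
have [r r0 [rD rN]] : exists2 r : R, 0 < r &
    (forall y, `|y - x0| < r -> D y) /\
    (forall y i j, `|y - x0| < r -> `|pd i (fun x => N x 0 j) y| <= 4^-1).
  have [r1 r10 h1] := open_ballP oD Dx0.
  have q0 : (0 : R) < 4^-1 by rewrite invr_gt0.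
  have : \forall y \near x0, forall ij : 'I_2 * 'I_2, `|pd ij.1 (fun x => N x 0 ij.2) y| <= 4^-1.
    apply: (@filter_forall _ _ (fun ij y => `|pd ij.1 (fun x => N x 0 ij.2) y| <= 4^-1)
      (nbhs x0) (nbhs_filter x0)) => -[i j] /=.
    have := smooth_cont (smooth_pd i (sN j)) Dx0.
    move=> /cvgrPdist_le /(_ _ q0); apply: filterS => y.
    by rewrite N0 sub0r normrN.
  move=> /nbhs_ballP[r2 /= r20 h2].
  exists (Num.min r1 r2); first by rewrite lt_min r10.
  split => [y|y i j]; rewrite lt_min => /andP[y1 y2]; first exact: h1.
  by apply: (h2 y _ (i, j)); rewrite ball_plane /= distrC.
have lip u w : `|u - x0| < r -> `|w - x0| < r -> `|N u - N w| <= 2^-1 * `|u - w|.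
  move=> ur wr; apply: normv_le => [|j]; first by rewrite mulr_ge0 ?invr_ge0.
  have -> : 2^-1 = 2 * 4^-1 :> R by field.
  have -> : (N u - N w) 0 j = N u 0 j - N w 0 j by exact: coordB.
  apply: (@lipschitz_pd _ (fun x => N x 0 j) x0 r 4^-1 w u) => // [z zr|z i zr].
    exact: smooth_differentiable oD (sN j) (rD _ zr).
  exact: rN.
have [k k0 kL] := mulmx_bound L.
have expand u w : `|u - x0| < r -> `|w - x0| < r -> `|u - w| <= 2 * k * `|X u - X w|.
  move=> ur wr; have := lip _ _ ur wr; have := kL (X u - X w).
  have : `|u - w| <= `|N u - N w| + `|(X u - X w) *m L|.
    have E : u - w = (N u - N w) + (X u - X w) *m L.
      by rewrite /N mulmxBl; apply/matrixP => i j; rewrite !mxE; ring.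
    by rewrite {1}E; exact: ler_normD.
  lra.
pose W := [set x : plane R | `|x - x0| < r].
have inj u w : W u -> W w -> X u = X w -> u = w.
  move=> Wu Ww uw; have := expand _ _ Wu Ww.
  by rewrite uw subrr normr0 mulr0 normr_le0 subr_eq0 => /eqP.
pose Y y := xget x0 [set w | W w /\ X w = y].
have YX x : W x -> Y (X x) = x.
  move=> Wx; have [Wy Xy] : [set w | W w /\ X w = X x] (Y (X x)).
    by apply: (@xgetPex _ x0 [set w | W w /\ X w = X x]); exists x.
  exact: inj.
have WY y : (X @` W) y -> W (Y y) /\ X (Y y) = y by case=> x Wx <-; rewrite YX.
have oW : open W.
  suff -> : W = ball x0 r by exact: ball_open.
  by rewrite ball_plane; apply/seteqP; split => y; rewrite /= distrC.
have oXW : open (X @` W).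
  rewrite openE => _ [x Wx <-].
  pose rho := (r - `|x - x0|) / 2.
  have rho0 : 0 < rho by rewrite divr_gt0 // subr_gt0.
  have rhoW u : `|u - x| <= rho -> W u.
    move=> ux; rewrite /W /=; have : `|u - x0| <= `|u - x| + `|x - x0|.
      by rewrite (le_trans _ (ler_normD _ _)) // addrA subrK.
    by move: Wx ux; rewrite /W /rho /=; lra.
  apply/nbhs_ballP; exists (rho / 2 / k); first by rewrite /= divr_gt0 // divr_gt0.
  move=> z; rewrite ball_plane /= => zx.
  have lipx u w : `|u - x| <= rho -> `|w - x| <= rho -> `|N u - N w| <= 2^-1 * `|u - w|.
    by move=> ur wr; apply: lip; apply: rhoW.
  have zN : `|N x + z *m L - x| <= rho / 2.
    have -> : N x + z *m L - x = (z - X x) *m L.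
      by rewrite /N mulmxBl; apply/matrixP => i j; rewrite !mxE; ring.
    by apply: le_trans (kL _) _; rewrite distrC mulrC -ler_pdivlMr // ltW.
  have [w wr wE] := contraction_solve rho0 lipx zN.
  exists w; first exact: rhoW.
  move: wE; rewrite /N => /(congr1 (fun v => v - w + X w *m L)).
  rewrite subrr add0r => E; apply: (can_inj (mulmxK uL)); rewrite E.
  by apply/matrixP => i j; rewrite !mxE; ring.
have dY y : (X @` W) y -> differentiable Y y /\ 'J Y y = invmx ('J X (Y y)).
  move=> Xy; have [Wy XYy] := WY _ Xy.
  apply: (@differentiable_inverse X Y y (2 * k)).
  - exact/dX/rD.
  - exact/uJ/rD.
  - by rewrite mulr_gt0.
  - by apply: filterS (open_near oXW Xy) => z /WY[].
  apply: filterS (open_near oXW Xy) => z Xz; have [Wz XYz] := WY _ Xz.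
  by rewrite -[X in _ <= _ * `|X - _|]XYz -[X in _ <= _ * `|_ - X|]XYy; apply: expand.
exists W, Y; split; first by split => //; rewrite /W /= subrr normr0.
split => // j.
pose B f := exists j, f = (fun y => Y y 0 j).
apply: (@generated_smooth R B (X @` W) oXW); last by apply: gen_base; exists j.
  by move=> _ y [l ->] Xy; apply: differentiable_coordE; apply: (dY y Xy).1.
move=> _ i [l ->].
have sJ : smooth_on W (fun x => invmx ('J X x) i l).
  apply: smooth_invmx => // [a b|x Wx]; last exact/uJ/rD.
  by apply: smooth_jacobian => // m; apply: smooth_sub (sX m) => x; apply: rD.
have gY m : generated B (X @` W) (fun y => Y y 0 m) by apply: gen_base; exists m.
apply: gen_ext (gen_comp oW sJ _ gY) => [y Xy|y /WY[]//].
by have [d JE] := dY y Xy; rewrite /= -JE jacobianE.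
Qed.

End Inverse.

(** * Primitives of closed one-forms *)

Section OneVariable.
Variable R : realType.
Notation mu := (@lebesgue_measure R).

Lemma continuous_seg_integrable (f : R -> R) (a b : R) :
  (forall u, a <= u <= b -> {for u, continuous f}) ->
  mu.-integrable `[a, b] (EFin \o f).
Proof.
move=> cf; apply: continuous_compact_integrable; first exact: segment_compact.
by apply: continuous_in_subspaceT => u; rewrite inE /= in_itv /=; apply: cf.
Qed.

Lemma primitive_is_derive (f : R -> R) (a b s : R) : a < s < b ->
  (forall u, a <= u <= b -> {for u, continuous f}) ->
  is_derive s 1 (fun s => \int[mu]_(u in `[a, s]) f u) (f s).
Proof.
move=> /andP[as_ sb] cf.
have [|d1 d2] := continuous_FTC1_closed sb (continuous_seg_integrable cf) as_.
  by apply: cf; rewrite !ltW.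
by apply: DeriveDef; [exact: d1|rewrite -derive1E].
Qed.

Lemma integral_derivative (f F : R -> R) (a b : R) : a < b ->
  (forall u, a <= u <= b -> is_derive u 1 F (f u)) ->
  (forall u, a <= u <= b -> {for u, continuous f}) ->
  \int[mu]_(u in `[a, b]) f u = F b - F a.
Proof.
move=> ab dF cf; rewrite /Rintegral (@continuous_FTC2 _ f F a b) //.
- by apply: continuous_in_subspaceT => u; rewrite inE /= in_itv /=; apply: cf.
- have cF u : a <= u <= b -> {for u, continuous F}.
    by move=> /dF[d _]; apply/differentiable_continuous/derivable1_diffP.
  split.
  + by move=> u; rewrite in_itv /= => /andP[/ltW au /ltW ub]; have [] := dF u; rewrite ?au.
  + by apply: cvg_at_right_filter; apply: cF; rewrite lexx ltW.
  + by apply: cvg_at_left_filter; apply: cF; rewrite lexx ltW.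
- move=> u; rewrite in_itv /= => /andP[/ltW au /ltW ub].
  by rewrite derive1E; have [] := dF u; rewrite ?au.
Qed.

Lemma is_derive_integral (f f' : R -> R -> R) (a b t t1 t2 M : R) :
  t1 < t < t2 ->
  (forall s u, t1 < s < t2 -> a <= u <= b -> {for u, continuous (f s)}) ->
  (forall s u, t1 < s < t2 -> a <= u <= b -> is_derive s 1 (f ^~ u) (f' s u)) ->
  (forall s u, t1 < s < t2 -> a <= u <= b -> `|f' s u| <= M) -> 0 <= M ->
  is_derive t 1 (fun s => \int[mu]_(u in `[a, b]) f s u)
    (\int[mu]_(u in `[a, b]) f' t u).
Proof.
move=> t12 cf df bf M0.
have mI : measurable (`[a, b]%classic : set R) by exact: measurable_itv.
have It : `]t1, t2[%classic t by rewrite /= in_itv.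
have If s : `]t1, t2[%classic s -> mu.-integrable `[a, b] (EFin \o f s).
  rewrite /= in_itv /= => s12; apply: continuous_seg_integrable => u ab; exact: cf.
have Df s u : `]t1, t2[%classic s -> `[a, b]%classic u -> derivable (f ^~ u) s 1.
  by rewrite /= !in_itv /= => s12 ab; have [] := df s u s12 ab.
have IM : mu.-integrable `[a, b] (EFin \o (fun=> M)).
  by apply: continuous_seg_integrable => u _; apply: cst_continuous.
have bM s u : `]t1, t2[%classic s -> `[a, b]%classic u -> `|partial1of2 f s u| <= M.
  rewrite /= !in_itv /= => s12 ab; rewrite partial1of2E.
  by have [_ ->] := df s u s12 ab; apply: bf.
apply: DeriveDef.
  exact: (@derivable_under_integral R _ _ mu f _ mI _ _ _ It If Df (fun=> M) (fun=> M0) IM bM).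
rewrite -derive1E.
rewrite (@differentiation_under_integral R _ _ mu f _ mI _ _ _ It If Df (fun=> M) (fun=> M0) IM bM).
apply: eq_Rintegral => u; rewrite inE /= in_itv /= => ab.
by rewrite partial1of2E; have [_ ->] := df t u t12 ab.
Qed.

End OneVariable.

Section Poincare.
Variable R : realType.
Implicit Types (x y v : plane R) (f g : plane R -> R) (D : set (plane R)).
Notation mu := (@lebesgue_measure R).

Local Notation e_ i := (delta_mx 0 i : plane R).

Definition point2 (s t : R) : plane R := \row_i (if i == 0 then s else t).

Lemma point2_0 s t : point2 s t 0 0 = s. Proof. by rewrite mxE. Qed.
Lemma point2_1 s t : point2 s t 0 1 = t. Proof. by rewrite mxE. Qed.

Lemma point2E x : point2 (x 0 0) (x 0 1) = x.
Proof. by apply/rowP => i; rewrite mxE; case: (ord2P i) => ->. Qed.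

Lemma point2_line0 s t : point2 s t = point2 0 t + s *: e_ 0.
Proof.
apply/rowP => i; rewrite !mxE.
by case: (ord2P i) => -> /=; rewrite ?mulr1 ?mulr0 ?add0r ?addr0.
Qed.

Lemma point2_line1 s t : point2 s t = point2 s 0 + t *: e_ 1.
Proof.
apply/rowP => i; rewrite !mxE.
by case: (ord2P i) => -> /=; rewrite ?mulr1 ?mulr0 ?add0r ?addr0.
Qed.

Lemma is_derive_point2_0 f s t : derivable f (point2 s t) (e_ 0) ->
  is_derive s 1 (fun u => f (point2 u t)) (pd 0 f (point2 s t)).
Proof.
have -> : (fun u => f (point2 u t)) = (fun u => f (point2 0 t + u *: e_ 0)).
  by apply/funext => u; rewrite point2_line0.
by rewrite /pd point2_line0; apply: line_derive.
Qed.

Lemma is_derive_point2_1 f s t : derivable f (point2 s t) (e_ 1) ->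
  is_derive t 1 (fun u => f (point2 s u)) (pd 1 f (point2 s t)).
Proof.
have -> : (fun u => f (point2 s u)) = (fun u => f (point2 s 0 + u *: e_ 1)).
  by apply/funext => u; rewrite point2_line1.
by rewrite /pd point2_line1; apply: line_derive.
Qed.

Lemma is_derive_pd0 f x d : is_derive (x 0 0) 1 (fun u => f (point2 u (x 0 1))) d ->
  is_derive x (e_ 0) f d.
Proof.
have E : (fun h : R => h^-1 *: ((f \o shift x) (h *: e_ 0) - f x)) =
  (fun h : R => h^-1 *: (((fun u => f (point2 u (x 0 1))) \o shift (x 0 0)) (h *: (1 : R))
    - f (point2 (x 0 0) (x 0 1)))).
  apply/funext => h /=; rewrite point2E; congr (_ *: (f _ - _)).
  rewrite -[in LHS](point2E x) (point2_line0 (x 0 0)) (point2_line0 (h%:A + _)).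
  by rewrite scalerDl [h%:A]mulr1 addrCA.
by case=> d1 d2; apply: DeriveDef; rewrite /derivable /derive E.
Qed.

Lemma is_derive_pd1 f x d : is_derive (x 0 1) 1 (fun u => f (point2 (x 0 0) u)) d ->
  is_derive x (e_ 1) f d.
Proof.
have E : (fun h : R => h^-1 *: ((f \o shift x) (h *: e_ 1) - f x)) =
  (fun h : R => h^-1 *: (((fun u => f (point2 (x 0 0) u)) \o shift (x 0 1)) (h *: (1 : R))
    - f (point2 (x 0 0) (x 0 1)))).
  apply/funext => h /=; rewrite point2E; congr (_ *: (f _ - _)).
  rewrite -[in LHS](point2E x) (point2_line1 (x 0 0)) (point2_line1 _ (h%:A + _)).
  by rewrite scalerDl [h%:A]mulr1 addrCA.
by case=> d1 d2; apply: DeriveDef; rewrite /derivable /derive E.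
Qed.

Lemma is_derive_cont (F : R -> R) (u d : R) : is_derive u 1 F d -> {for u, continuous F}.
Proof. by case=> dF _; apply/differentiable_continuous/derivable1_diffP. Qed.

Lemma smooth_bounded D f x0 (r : R) : open D -> smooth_on D f -> 0 < r ->
  (forall y, `|y - x0| <= r -> D y) ->
  exists2 M : R, 0 <= M & forall y, `|y - x0| <= r -> `|f y| <= M.
Proof.
move=> oD sf r0 rD; pose A := [set y : plane R | `|y - x0| <= r].
have cA : compact A.
  apply: bounded_closed_compact.
    exists (r + `|x0|); split; first by rewrite num_real.
    move=> M rM y /= yr; apply: ltW; apply: le_lt_trans rM.
    by rewrite -[y](subrK x0) (le_trans (ler_normD _ _)) // lerD2r.
  have -> : A = closed_ball x0 r.
    by rewrite closed_ballE //; apply/seteqP; split => y; rewrite /A /closed_ball_ /= distrC.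
  exact: closed_ball_closed.
have [||c Ac cmax] := @EVT_max_rV R 2 (fun y => `|f y|) A _ cA.
- by exists x0; rewrite /A /= subrr normr0 ltW.
- apply: continuous_in_subspaceT => y; rewrite inE => /rD Dy.
  apply: continuous_comp; first exact: smooth_cont sf Dy.
  exact: norm_continuous.
by exists `|f c| => // y yr; apply: cmax; rewrite inE.
Qed.

(** The primitive is the integral of the form along a vertical and then a
    horizontal segment, starting at a corner below and to the left of the region
    of interest, so that both segments are traversed in the positive direction. *)
Lemma poincare D x0 a b : open D -> D x0 -> smooth_on D a -> smooth_on D b ->
  (forall x, D x -> pd 1 a x = pd 0 b x) ->
  exists (W : set (plane R)) (V : plane R -> R),
  [/\ open W, W x0, W `<=` D, smooth_on W V &
      forall x, W x -> pd 0 V x = a x /\ pd 1 V x = b x].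
Proof.
move=> oD Dx0 sa sb ab; have [r r0 rD] := open_ballP oD Dx0.
pose p := x0 0 0; pose q := x0 0 1.
have [rho [rho0 rho1 rho2]] : exists rho : R, [/\ 0 < rho, rho < r & r < 2 * rho].
  by exists (3 / 4 * r); split; lra.
have box y : `|y - x0| <= rho -> D y by move=> yr; apply: rD; apply: le_lt_trans yr _.
have inbox s t : p - rho <= s <= p + rho -> q - rho <= t <= q + rho ->
    `|point2 s t - x0| <= rho.
  move=> sp tq; apply: normv_le => [|i]; first exact: ltW.
  rewrite coordB; case: (ord2P i) => ->; rewrite ?point2_0 ?point2_1 ler_distl //.
have Dbox s t : p - rho <= s <= p + rho -> q - rho <= t <= q + rho -> D (point2 s t).
  by move=> sp tq; apply: box; apply: inbox.
have ds f s t : smooth_on D f -> p - rho <= s <= p + rho -> q - rho <= t <= q + rho ->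
    is_derive s 1 (fun u => f (point2 u t)) (pd 0 f (point2 s t)).
  by move=> sf sp tq; apply: is_derive_point2_0; apply: smooth_derivable sf (Dbox _ _ sp tq).
have dt f s t : smooth_on D f -> p - rho <= s <= p + rho -> q - rho <= t <= q + rho ->
    is_derive t 1 (fun u => f (point2 s u)) (pd 1 f (point2 s t)).
  by move=> sf sp tq; apply: is_derive_point2_1; apply: smooth_derivable sf (Dbox _ _ sp tq).
have [M M0 bM] := smooth_bounded oD (smooth_pd 1 sa) rho0 box.
pose s0 := p - rho; pose t0 := q - rho.
pose V x := \int[mu]_(u in `[s0, x 0 0]) a (point2 u (x 0 1))
  + \int[mu]_(u in `[t0, x 0 1]) b (point2 s0 u).
pose W := [set x : plane R | `|x - x0| < r / 2].
have WD : W `<=` D by move=> x; rewrite /W /= => xr; apply: rD; lra.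
have coordW x i : W x -> x0 0 i - rho < x 0 i < x0 0 i + rho.
  rewrite /W /= => xr; have := normv_coord (x - x0) i; rewrite coordB => xi.
  by rewrite -ltr_distl; apply: le_lt_trans xi _; lra.
have s0box : p - rho <= s0 <= p + rho by rewrite /s0 lexx /=; lra.
have d0 x : W x -> is_derive x (e_ 0) V (a x).
  move=> Wx; apply: is_derive_pd0; have /andP[tl tr] := coordW x 1 Wx.
  have tq : q - rho <= x 0 1 <= q + rho by rewrite /q !ltW.
  have -> : (fun u => V (point2 u (x 0 1))) =
     (fun s => \int[mu]_(u in `[s0, s]) a (point2 u (x 0 1)))
     + cst (\int[mu]_(u in `[t0, x 0 1]) b (point2 s0 u)).
    by apply/funext => u; rewrite /V point2_0 point2_1.
  rewrite -[a x]addr0; apply: is_deriveD.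
  rewrite -[in a x](point2E x).
  apply: (@primitive_is_derive R (fun u => a (point2 u (x 0 1))) s0 (p + rho)); first exact: coordW.
  by move=> u up; apply: is_derive_cont (ds _ _ _ sa up tq).
have d1 x : W x -> is_derive x (e_ 1) V (b x).
  move=> Wx; apply: is_derive_pd1; have /andP[tl tr] := coordW x 1 Wx.
  have /andP[sl sr] := coordW x 0 Wx.
  have tq : q - rho <= x 0 1 <= q + rho by rewrite /q !ltW.
  have -> : (fun t => V (point2 (x 0 0) t)) =
     (fun t => \int[mu]_(u in `[s0, x 0 0]) a (point2 u t))
     + (fun t => \int[mu]_(u in `[t0, t]) b (point2 s0 u)).
    by apply/funext => u; rewrite /V point2_0 point2_1.
  have sub u : s0 <= u <= x 0 0 -> p - rho <= u <= p + rho.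
    by case/andP => u1 u2; rewrite u1 /=; apply: le_trans u2 _; exact: ltW.
  have subt t : q - rho < t < q + rho -> q - rho <= t <= q + rho by case/andP=> /ltW -> /ltW ->.
  have I : \int[mu]_(u in `[s0, x 0 0]) pd 1 a (point2 u (x 0 1)) = b x - b (point2 s0 (x 0 1)).
    rewrite -[in b x](point2E x).
    apply: (@integral_derivative R _ (fun u => b (point2 u (x 0 1)))) => // u /sub up.
      by rewrite ab; [exact: ds|exact: Dbox].
    exact: is_derive_cont (ds _ _ _ (smooth_pd 1 sa) up tq).
  rewrite -[b x](subrK (b (point2 s0 (x 0 1)))) -I; apply: is_deriveD.
    apply: (@is_derive_integral R (fun t u => a (point2 u t)) (fun t u => pd 1 a (point2 u t))
      _ _ _ (q - rho) (q + rho) M) => //.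
    + by rewrite /q tl.
    + by move=> t u /subt tt /sub up; apply: is_derive_cont (ds _ _ _ sa up tt).
    + by move=> t u /subt tt /sub up; exact: dt.
    + by move=> t u /subt tt /sub up; apply: bM; apply: inbox.
  apply: (@primitive_is_derive R (fun u => b (point2 s0 u)) t0 (q + rho)); first exact: coordW.
  by move=> u up; apply: is_derive_cont (dt _ _ _ sb s0box up).
have oW : open W.
  suff -> : W = ball x0 (r / 2) by exact: ball_open.
  by rewrite ball_plane; apply/seteqP; split => y; rewrite /= distrC.
have pV i x : W x -> pd i V x = (if i == 0 then a else b) x /\ derivable V x (e_ i).
  by move=> Wx; case: (ord2P i) => -> /=; [have [] := d0 x Wx|have [] := d1 x Wx].
have sV i : smooth_on W (pd i V).
  have sab : smooth_on W (if i == 0 then a else b) by case: ifP => _; apply: smooth_sub WD _.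
  by apply: smooth_ext sab => // x Wx; have [->] := pV i x Wx.
exists W, V; split => //.
- by rewrite /W /= subrr normr0 divr_gt0.
- apply: smooth_of_pd => // x Wx; apply: (differentiable_pd oW Wx) => [i y Wy|i].
    by have [] := pV i y Wy.
  exact: smooth_cont (sV i) Wx.
- by move=> x Wx; have [-> _] := pV 0 x Wx; have [-> _] := pV 1 x Wx.
Qed.

End Poincare.

(** * Orthonormal frames and curvature *)

Section FrameMatrix.
Variable R : realType.
Implicit Types (h : 'M[R]_2) (u v w : plane R).

Lemma mx2P (A B : 'M[R]_2) : A 0 0 = B 0 0 -> A 0 1 = B 0 1 -> A 1 0 = B 1 0 ->
  A 1 1 = B 1 1 -> A = B.
Proof.
move=> h1 h2 h3 h4; apply/matrixP => i j.
by case: (ord2P i) => ->; case: (ord2P j) => ->.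
Qed.

Definition frame_mx u v : 'M[R]_2 := \matrix_(a, k) (if a == 0 then u 0 k else v 0 k).

Lemma frame_mx0 u v : row 0 (frame_mx u v) = u.
Proof. by apply/rowP => k; rewrite !mxE. Qed.

Lemma frame_mx1 u v : row 1 (frame_mx u v) = v.
Proof. by apply/rowP => k; rewrite !mxE. Qed.

Lemma gram_rows h (P : 'M[R]_2) a b :
  (P *m h *m P^T) a b = (row a P *m h *m (row b P)^T) 0 0.
Proof. by rewrite tr_row -row_mul colE mulmxA -!row_mul [RHS]mxE -colE [RHS]mxE. Qed.

Lemma form_sym h u v : h^T = h -> (u *m h *m v^T) 0 0 = (v *m h *m u^T) 0 0.
Proof.
move=> hT; have -> : v *m h *m u^T = (u *m h *m v^T)^T.
  by rewrite !trmx_mul trmxK hT // mulmxA.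
by rewrite [RHS]mxE.
Qed.

Lemma frame_mx_gram h u v : h^T = h -> (u *m h *m u^T) 0 0 = 1 ->
  (v *m h *m v^T) 0 0 = 1 -> (u *m h *m v^T) 0 0 = 0 ->
  frame_mx u v *m h *m (frame_mx u v)^T = 1%:M.
Proof.
move=> hT uu vv uv; have vu := uv; rewrite (form_sym u v hT) in vu.
by apply: mx2P; rewrite gram_rows ?frame_mx0 ?frame_mx1 ?uu ?vv ?uv ?vu mxE.
Qed.

Lemma orthonormal_expand h u v w : h^T = h -> (u *m h *m u^T) 0 0 = 1 ->
  (v *m h *m v^T) 0 0 = 1 -> (u *m h *m v^T) 0 0 = 0 ->
  w = (w *m h *m u^T) 0 0 *: u + (w *m h *m v^T) 0 0 *: v.
Proof.
move=> hT uu vv uv; have PhP := frame_mx_gram hT uu vv uv.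
move: (frame_mx0 u v) (frame_mx1 u v) PhP; move: (frame_mx u v) => P P0 P1 PhP.
have hPP : h *m P^T *m P = 1%:M by move: PhP; rewrite -mulmxA => /mulmx1C.
have E a : (w *m h *m P^T) 0 a = (w *m h *m (row a P)^T) 0 0.
  by rewrite tr_row colE mulmxA -colE [RHS]mxE.
have wE : w = (w *m h *m P^T) *m P by rewrite -!mulmxA (mulmxA h) hPP mulmx1.
rewrite {1}wE; apply/rowP => k; rewrite mxE sum2 !E P0 P1 [RHS]mxE.
by congr (_ + _); rewrite [RHS]mxE; congr (_ * _); rewrite -?P0 -?P1 [RHS]mxE.
Qed.

End FrameMatrix.

Section MatrixCalculus.
Variable R : realType.
Implicit Types (x y : plane R) (D : set (plane R)).

Local Notation e_ i := (delta_mx 0 i : plane R).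

Definition smooth_mx m n D (A : plane R -> 'M[R]_(m, n)) :=
  forall i j, smooth_on D (fun x => A x i j).

Definition dmx m n (k : 'I_2) (A : plane R -> 'M[R]_(m, n)) x : 'M[R]_(m, n) :=
  \matrix_(i, j) pd k (fun y => A y i j) x.

Lemma dmx_eq_on m n D k (A B : plane R -> 'M[R]_(m, n)) x : open D ->
  (forall y, D y -> A y = B y) -> D x -> dmx k A x = dmx k B x.
Proof.
move=> oD AB Dx; apply/matrixP => i j; rewrite !mxE.
by apply: (pd_eq_on _ oD) => // y Dy; rewrite AB.
Qed.

Lemma dmx_cst m n k (A : 'M[R]_(m, n)) x : dmx k (fun=> A) x = 0.
Proof. by apply/matrixP => i j; rewrite !mxE /pd derive_cst. Qed.

Lemma pdM k (f g : plane R -> R) x : differentiable f x -> differentiable g x ->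
  pd k (fun y => f y * g y) x = f x * pd k g x + g x * pd k f x.
Proof. by move=> df dg; rewrite /pd (@deriveM _ _ f g) //; apply: diff_derivable. Qed.

Lemma pdD k (f g : plane R -> R) x : differentiable f x -> differentiable g x ->
  pd k (fun y => f y + g y) x = pd k f x + pd k g x.
Proof. by move=> df dg; rewrite /pd (@deriveD _ _ _ f g) //; apply: diff_derivable. Qed.

Section Rules.
Variables (D : set (plane R)) (oD : open D).

Lemma smooth_mx_mul m n p (A : plane R -> 'M[R]_(m, n)) (B : plane R -> 'M[R]_(n, p)) :
  smooth_mx D A -> smooth_mx D B -> smooth_mx D (fun x => A x *m B x).
Proof. by move=> sA sB i j; apply: smooth_mulmx. Qed.

Lemma smooth_mx_tr m n (A : plane R -> 'M[R]_(m, n)) :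
  smooth_mx D A -> smooth_mx D (fun x => (A x)^T).
Proof. by move=> sA i j; apply: smooth_ext (sA j i) => // x _; rewrite mxE. Qed.

Lemma smooth_mx_add m n (A B : plane R -> 'M[R]_(m, n)) :
  smooth_mx D A -> smooth_mx D B -> smooth_mx D (fun x => A x + B x).
Proof.
by move=> sA sB i j; apply: smooth_ext (smooth_add oD (sA i j) (sB i j)) => // x _; rewrite mxE.
Qed.

Lemma smooth_mx_scale m n (f : plane R -> R) (A : plane R -> 'M[R]_(m, n)) :
  smooth_on D f -> smooth_mx D A -> smooth_mx D (fun x => f x *: A x).
Proof.
by move=> sf sA i j; apply: smooth_ext (smooth_mul oD sf (sA i j)) => // x _; rewrite mxE.
Qed.

Lemma smooth_mx_d m n k (A : plane R -> 'M[R]_(m, n)) :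
  smooth_mx D A -> smooth_mx D (dmx k A).
Proof.
by move=> sA i j; apply: smooth_ext (smooth_pd k (sA i j)) => // x _; rewrite mxE.
Qed.

Lemma smooth_mx_cst m n (A : 'M[R]_(m, n)) : smooth_mx D (fun=> A).
Proof. by move=> i j; apply: smooth_cst. Qed.

Lemma dmxM m n k (A : plane R -> 'M[R]_(m, n)) p (B : plane R -> 'M[R]_(n, p)) x :
  smooth_mx D A -> smooth_mx D B -> D x ->
  dmx k (fun y => A y *m B y) x = dmx k A x *m B x + A x *m dmx k B x.
Proof.
move=> sA sB Dx; apply/matrixP => i j; rewrite !mxE.
rewrite -big_split /=.
pose F l : plane R -> R := fun y => A y i l * B y l j.
have dA l : differentiable (fun y => A y i l) x := smooth_differentiable oD (sA i l) Dx.
have dB l : differentiable (fun y => B y l j) x := smooth_differentiable oD (sB l j) Dx.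
have dF l : derivable (F l) x (e_ k) by apply: diff_derivable; apply: differentiableM.
have -> : (fun y => (A y *m B y) i j) = \sum_l F l.
  by apply/funext => y; rewrite fct_sumE mxE.
rewrite /pd derive_sum //; apply: eq_bigr => l _; rewrite !mxE.
rewrite -[LHS]/(pd k (fun y => A y i l * B y l j) x) pdM // [X in X + _]mulrC.
by rewrite addrC mulrC [in RHS]addrC [X in _ + X]mulrC addrC.
Qed.

Lemma dmxD m n k (A B : plane R -> 'M[R]_(m, n)) x :
  smooth_mx D A -> smooth_mx D B -> D x ->
  dmx k (fun y => A y + B y) x = dmx k A x + dmx k B x.
Proof.
move=> sA sB Dx; apply/matrixP => i j; rewrite !mxE.
have dA : differentiable (fun y => A y i j) x := smooth_differentiable oD (sA i j) Dx.
have dB : differentiable (fun y => B y i j) x := smooth_differentiable oD (sB i j) Dx.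
by rewrite -pdD //; congr (pd k _ x); apply/funext => y; rewrite mxE.
Qed.

Lemma dmxZ m n k (f : plane R -> R) (A : plane R -> 'M[R]_(m, n)) x :
  smooth_on D f -> smooth_mx D A -> D x ->
  dmx k (fun y => f y *: A y) x = pd k f x *: A x + f x *: dmx k A x.
Proof.
move=> sf sA Dx; apply/matrixP => i j; rewrite !mxE.
have dA : differentiable (fun y => A y i j) x := smooth_differentiable oD (sA i j) Dx.
have df : differentiable f x := smooth_differentiable oD sf Dx.
rewrite [X in X + _]mulrC addrC -pdM //; congr (pd k _ x); apply/funext => y.
by rewrite mxE.
Qed.

Lemma dmx_sym m n k l (A : plane R -> 'M[R]_(m, n)) x : smooth_mx D A -> D x ->
  dmx k (dmx l A) x = dmx l (dmx k A) x.
Proof.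
move=> sA Dx; apply/matrixP => i j; rewrite [LHS]mxE [RHS]mxE.
have E p : (fun y => dmx p A y i j) = pd p (fun y => A y i j).
  by apply/funext => y; rewrite mxE.
by rewrite !E; apply: smooth_pd_sym oD (sA i j) Dx.
Qed.

Lemma dmx_tr m n k (A : plane R -> 'M[R]_(m, n)) x :
  dmx k (fun y => (A y)^T) x = (dmx k A x)^T.
Proof.
by apply/matrixP => i j; rewrite !mxE; congr (pd k _ x); apply/funext => y; rewrite mxE.
Qed.

End Rules.
End MatrixCalculus.

Section Frame.
Variable R : realType.
Implicit Types (x y : plane R).

Local Notation e_ i := (delta_mx 0 i : plane R).

(** The quarter turn, which spans the skew-symmetric matrices. *)
Definition rot : 'M[R]_2 := \matrix_(i, j) (if i == j then 0 else if i == 0 then 1 else -1).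

Lemma row_rot (A : 'M[R]_2) :
  row 0 (rot *m A) = row 1 A /\ row 1 (rot *m A) = - row 0 A.
Proof. by split; apply/rowP => k; rewrite !mxE sum2 !mxE /=; ring. Qed.

Lemma row_comb (a b p q : R) (c : 'I_2) (A : 'M[R]_2) :
  a *: row c (p *: A) + b *: row c (q *: A) = (a * p + b * q) *: row c A.
Proof. by apply/rowP => k; rewrite !mxE; ring. Qed.

Lemma skew_rot (A : 'M[R]_2) : A + A^T = 0 -> A = A 0 1 *: rot.
Proof.
move=> AT.
have Aij a b : A a b = - A b a.
  have := congr1 (fun A : 'M[R]_2 => A a b) AT; rewrite !mxE => /eqP.
  by rewrite addr_eq0 => /eqP.
have A0 a : A a a = 0.
  by apply/eqP; have /eqP := Aij a a; rewrite -addr_eq0 -mulr2n mulrn_eq0.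
apply: mx2P; rewrite !mxE /= ?mulr0 ?A0 ?mulr1 ?mulrN1 //.
Qed.

Lemma curvature_algebra (H P G0 G1 A B J P0 P1 : 'M[R]_2) (w0 w1 p q : R) :
  P0 = w0 *: (J *m P) - P *m G0 -> P1 = w1 *: (J *m P) - P *m G1 ->
  H + P0 *m G1 + P *m A = p *: (J *m P) + w1 *: (J *m P0) ->
  H + P1 *m G0 + P *m B = q *: (J *m P) + w0 *: (J *m P1) ->
  P *m (A - B + G1 *m G0 - G0 *m G1) = (p - q) *: (J *m P).
Proof.
move=> -> ->; set Q := J *m P.
rewrite !mulmxBl !mulmxBr -!scalemxAl -!scalemxAr !mulmxA -/Q => E1 E2.
rewrite mulmxDr mulmxBr !mulmxA.
have -> : P *m A = p *: Q + w1 *: (w0 *: (J *m J *m P) - Q *m G0) - H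
  - (w0 *: (Q *m G1) - P *m G0 *m G1) by rewrite -E1; apply/matrixP => i j; rewrite !mxE; ring.
have -> : P *m B = q *: Q + w0 *: (w1 *: (J *m J *m P) - Q *m G1) - H
  - (w1 *: (Q *m G0) - P *m G1 *m G0) by rewrite -E2; apply/matrixP => i j; rewrite !mxE; ring.
move: (J *m J *m P) (Q *m G0) (Q *m G1) (P *m G0 *m G1) (P *m G1 *m G0) => a b c d e.
by apply/matrixP => i j; rewrite !mxE; ring.
Qed.

(** The Christoffel symbols as endomorphisms acting on row vectors from the right:
    the covariant derivative of [Y] along [e_i] is [d_i Y + Y *m connection h i]. *)
Definition connection (h : plane R -> 'M[R]_2) (i : 'I_2) x : 'M[R]_2 :=
  \matrix_(j, k) christoffel h k i j x.

Lemma local_nablaE h X Y x :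
  local_nabla h X Y x = \sum_i X x 0 i *: (dmx i Y x + Y x *m connection h i x).
Proof.
apply/rowP => k; rewrite mxE summxE.
rewrite /dirder -big_split /=; apply: eq_bigr => i _.
rewrite !mxE mulrDr mulr_sumr; congr (_ + _); apply: eq_bigr => j _.
by rewrite !mxE; ring.
Qed.

Lemma local_nabla_coord h Y x i :
  local_nabla h (fun=> e_ i) Y x = dmx i Y x + Y x *m connection h i x.
Proof.
rewrite local_nablaE (bigD1 i) //= big1 ?addr0 => [|j ji].
  by rewrite mxE !eqxx scale1r.
by rewrite mxE (negbTE ji) scale0r.
Qed.

Lemma smooth_christoffel D (h : plane R -> 'M[R]_2) : open D -> smooth_mx D h ->
  (forall x, D x -> h x \in unitmx) -> forall i, smooth_mx D (connection h i).
Proof.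
move=> oD sh uh i j k; have sc : smooth_on D (christoffel h k i j).
  apply: smooth_mul; [exact: oD|exact: smooth_cst|].
  apply: smooth_sum => // l; apply: smooth_mul => //.
    exact: (smooth_invmx oD sh uh).
  apply: smooth_add; [exact: oD| |exact/smooth_opp/smooth_pd/sh].
  by apply: smooth_add; [exact: oD|exact/smooth_pd/sh|exact/smooth_pd/sh].
by apply: smooth_ext sc => // x _; rewrite mxE.
Qed.

Section OrthonormalFrame.
Variables (D : set (plane R)) (h P : plane R -> 'M[R]_2).
Hypotheses (oD : open D) (sh : smooth_mx D h) (sP : smooth_mx D P).
Hypothesis hT : forall x, D x -> (h x)^T = h x.
Hypothesis PhP : forall x, D x -> P x *m h x *m (P x)^T = 1%:M.

Local Notation G := (connection h).

Lemma frame_hPP x : D x -> h x *m (P x)^T *m P x = 1%:M.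
Proof.
by move=> Dx; have := PhP Dx; rewrite -mulmxA => /mulmx1C.
Qed.

Lemma frame_unit x : D x -> P x \in unitmx.
Proof. by move=> Dx; have := PhP Dx; rewrite -mulmxA => /mulmx1_unit[]. Qed.

Lemma frame_hunit x : D x -> h x \in unitmx.
Proof. by move=> Dx; have := frame_hPP Dx; rewrite -mulmxA => /mulmx1_unit[]. Qed.

Lemma pd_hT i j k x : D x -> pd k (fun y => h y i j) x = pd k (fun y => h y j i) x.
Proof.
move=> Dx; apply: (pd_eq_on _ oD) => // y Dy.
by rewrite -[in LHS](hT Dy) mxE.
Qed.

Lemma connection_sym i j x : D x -> row j (G i x) = row i (G j x).
Proof.
move=> Dx; apply/rowP => k; rewrite !mxE /christoffel; congr (_ * _).
apply: eq_bigr => l _; congr (_ * _).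
by rewrite (pd_hT i j l Dx); ring.
Qed.

(** With the last index lowered, the two Christoffel symbols on the right add up
    to [d_i h_jl], the four other terms cancelling by symmetry of [h]. *)
Lemma connection_metric i x : D x -> dmx i h x = G i x *m h x + h x *m (G i x)^T.
Proof.
move=> Dx; pose C : 'M[R]_2 := \matrix_(j, l) (2^-1 *
   (pd i (fun y => h y j l) x + pd j (fun y => h y i l) x - pd l (fun y => h y i j) x)).
have GE : G i x = C *m invmx (h x).
  apply/matrixP => j k; rewrite !mxE /christoffel mulr_sumr; apply: eq_bigr => l _.
  rewrite !mxE.
  have -> : invmx (h x) l k = invmx (h x) k l by rewrite -[in RHS](hT Dx) -trmx_inv mxE.
  by ring.
have GC : G i x *m h x = C by rewrite GE mulmxKV // frame_hunit.
have -> : h x *m (G i x)^T = C^T by rewrite -GC trmx_mul hT.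
rewrite GC; apply/matrixP => j l; rewrite !mxE (pd_hT l j i Dx).
by field.
Qed.

Definition covd i x := dmx i P x + P x *m G i x.
(** The scalar product of the covariant derivative along [e_i] of the first row
    of [P] with its second row. *)
Definition connection_form i x := (covd i x *m h x *m (P x)^T) 0 1.

(** Differentiating [P h P^T = 1] shows that [covd i] is skew-symmetric with
    respect to the frame. *)
Lemma covdE i x : D x -> covd i x = connection_form i x *: (rot *m P x).
Proof.
move=> Dx; pose S := covd i x *m h x *m (P x)^T.
have SP : S *m P x = covd i x by rewrite /S -!mulmxA (mulmxA (h x)) frame_hPP // mulmx1.
have : dmx i (fun y => P y *m h y *m (P y)^T) x = 0.
  by rewrite (dmx_eq_on (B := fun=> 1%:M) _ oD) ?dmx_cst.
rewrite (dmxM oD _ (smooth_mx_mul oD sP sh) (smooth_mx_tr oD sP) Dx).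
rewrite (dmxM oD _ sP sh Dx) dmx_tr connection_metric // => E.
have ST : S + S^T = 0.
  rewrite -{}E /S /covd !trmx_mul trmxK hT // linearD /= trmx_mul.
  rewrite !mulmxDl !mulmxDr !mulmxA mulmxDl.
  rewrite -!addrA; congr (_ + (_ + _)); exact: addrC.
by rewrite -SP {1}(skew_rot ST) scalemxAl.
Qed.

Lemma smooth_connection i : smooth_mx D (G i).
Proof. exact: smooth_christoffel (fun x Dx => frame_hunit Dx) i. Qed.

Lemma smooth_covd i : smooth_mx D (covd i).
Proof.
exact: (smooth_mx_add oD (smooth_mx_d oD i sP)
  (smooth_mx_mul oD sP (smooth_connection i))).
Qed.

Lemma smooth_omega i : smooth_on D (connection_form i).
Proof.
apply: (smooth_mx_mul oD (smooth_mx_mul oD (smooth_covd i) sh) (smooth_mx_tr oD sP)).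
Qed.

(** Up to sign, the curvature form: the exterior derivative of the connection
    form, evaluated on the coordinate fields. *)
Definition curvature_form x := pd 0 (connection_form 1) x - pd 1 (connection_form 0) x.

(** The curvature endomorphism of the two coordinate fields, acting on row
    vectors from the right. *)
Definition curvature_mx x := dmx 0 (G 1) x - dmx 1 (G 0) x + G 1 x *m G 0 x - G 0 x *m G 1 x.

Lemma covd_d i j x : D x ->
  dmx j (dmx i P) x + dmx j P x *m G i x + P x *m dmx j (G i) x =
  pd j (connection_form i) x *: (rot *m P x) + connection_form i x *: (rot *m dmx j P x).
Proof.
move=> Dx; have := dmx_eq_on j oD (fun y Dy => covdE i Dy) Dx.
rewrite /covd (dmxD oD _ (smooth_mx_d oD i sP) (smooth_mx_mul oD sP (smooth_connection i)) Dx).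
rewrite (dmxM oD _ sP (smooth_connection i) Dx).
rewrite (dmxZ oD _ (smooth_omega i) (smooth_mx_mul oD (smooth_mx_cst oD rot) sP) Dx).
by rewrite (dmxM oD _ (smooth_mx_cst oD rot) sP Dx) dmx_cst mul0mx add0r addrA.
Qed.

(** Take the antisymmetric part of the derivative of [covdE]: the second
    derivatives of [P] cancel, and so do the terms that are quadratic in the
    connection form, because multiples of [rot] commute. *)
Lemma curvature_frame x : D x ->
  P x *m curvature_mx x = curvature_form x *: (rot *m P x).
Proof.
move=> Dx; have E1 := covd_d 1 0 Dx; have E2 := covd_d 0 1 Dx.
rewrite (dmx_sym oD 0 1 sP Dx) in E1.
have dP i : dmx i P x = connection_form i x *: (rot *m P x) - P x *m G i x.
  by rewrite -(covdE i Dx) /covd addrK.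
exact: curvature_algebra (dP 0) (dP 1) E1 E2.
Qed.

(** Relative to the orthonormal frame the curvature is [curvature_form *: rot];
    the change to the coordinate basis contributes a determinant. *)
Lemma local_gauss_form x : D x ->
  local_gauss h x = - curvature_form x * \det (P x).
Proof.
move=> Dx; pose e0 := e_ 0; pose e1 := e_ 1.
have N0 i j y : local_nabla h (fun=> e_ i) (fun=> e_ j) y = e_ j *m G i y.
  by rewrite local_nabla_coord dmx_cst add0r.
have N1 i j k : local_nabla h (fun=> e_ i) (local_nabla h (fun=> e_ j) (fun=> e_ k)) x =
    e_ k *m (dmx i (G j) x + G j x *m G i x).
  rewrite (_ : local_nabla h (fun=> e_ j) (fun=> e_ k) = fun y => e_ k *m G j y); last first.
    by apply/funext => y; rewrite N0.
  rewrite local_nabla_coord (dmxM oD _ (smooth_mx_cst oD _) (smooth_connection j) Dx).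
  by rewrite dmx_cst mul0mx add0r mulmxDr mulmxA.
rewrite /local_gauss N1 N1 -mulmxBr.
have -> : dmx 0 (G 1) x + G 1 x *m G 0 x - (dmx 1 (G 0) x + G 0 x *m G 1 x) = curvature_mx x.
  by rewrite /curvature_mx opprD addrA [X in X + _ = _]addrAC.
have ipE i j (A : 'M[R]_2) : (e_ i *m A *m (e_ j)^T) 0 0 = A i j.
  by rewrite -rowE trmx_delta -colE !mxE.
rewrite /ip -(mulmxA (e_ 1) (curvature_mx x)) !ipE.
have h10 : h x 1 0 = h x 0 1 by rewrite -[in LHS](hT Dx) mxE.
have -> : h x 0 0 * h x 1 1 - h x 0 1 ^+ 2 = \det (h x) by rewrite det2 h10 expr2.
have dP : \det (P x) ^+ 2 * \det (h x) = 1.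
  by have := congr1 determinant (PhP Dx); rewrite !det_mulmx det_tr det1 => <-; ring.
have FE : P x *m (curvature_mx x *m h x) *m (P x)^T = curvature_form x *: rot.
  rewrite mulmxA curvature_frame // -!scalemxAl -!mulmxA.
  by rewrite (mulmxA (P x)) PhP // mulmx1.
move: (curvature_mx x *m h x) FE => F FE.
have FQ : F = curvature_form x *: (invmx (P x) *m rot *m (invmx (P x))^T).
  rewrite scalemxAl scalemxAr -FE !mulmxA mulVmx ?frame_unit // mul1mx -mulmxA -trmx_mul.
  by rewrite mulVmx ?frame_unit // trmx1 mulmx1.
have rotE (Q : 'M[R]_2) : (Q *m rot *m Q^T) 1 0 = - \det Q.
  by rewrite det2 !mxE sum2 !mxE !sum2 !mxE /=; ring.
rewrite FQ mxE rotE det_inv.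
have dP0 : \det (P x) != 0 by have := frame_unit Dx; rewrite unitmxE unitfE.
have -> : \det (h x) = (\det (P x) ^+ 2)^-1.
  by rewrite -[RHS]mulr1 -dP mulKf // expf_neq0.
by field.
Qed.

End OrthonormalFrame.

Lemma ip_comb (h : plane R -> 'M[R]_2) x (a b : R) (u v w : plane R) :
  ip h x (a *: u - b *: v) w = a * ip h x u w - b * ip h x v w.
Proof.
rewrite /ip !mulmxBl -!scalemxAl; move: (u *m _ *m _) (v *m _ *m _) => A B.
by rewrite !mxE.
Qed.

Lemma ipZ (h : plane R -> 'M[R]_2) x (a : R) (u w : plane R) :
  ip h x (a *: u) w = a * ip h x u w.
Proof. by rewrite /ip -!scalemxAl mxE. Qed.

Lemma dirderD D X f g x : open D -> smooth_on D f -> smooth_on D g -> D x ->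
  dirder X (fun y => f y + g y) x = dirder X f x + dirder X g x.
Proof.
move=> oD sf sg Dx.
have df := smooth_differentiable oD sf Dx; have dg := smooth_differentiable oD sg Dx.
rewrite /dirder !sum2 (pdD 0 df dg) (pdD 1 df dg).
move: (pd 0 f x) (pd 1 f x) (pd 0 g x) (pd 1 g x) (X x 0 0) (X x 0 1).
by move=> {df dg sf sg} *; ring.
Qed.

Lemma dirderM D X f g x : open D -> smooth_on D f -> smooth_on D g -> D x ->
  dirder X (fun y => f y * g y) x = f x * dirder X g x + g x * dirder X f x.
Proof.
move=> oD sf sg Dx.
have df := smooth_differentiable oD sf Dx; have dg := smooth_differentiable oD sg Dx.
rewrite /dirder !sum2 (pdM 0 df dg) (pdM 1 df dg).
move: (pd 0 f x) (pd 1 f x) (pd 0 g x) (pd 1 g x) (X x 0 0) (X x 0 1) (f x) (g x).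
by move=> {df dg sf sg} *; ring.
Qed.
Lemma dirder_comb D X f u g v x : open D -> smooth_on D f -> smooth_on D u ->
  smooth_on D g -> smooth_on D v -> D x ->
  dirder X (fun y => f y * u y + g y * v y) x =
  u x * dirder X f x + v x * dirder X g x + f x * dirder X u x + g x * dirder X v x.
Proof.
move=> oD sf su sg sv Dx.
rewrite (dirderD X oD (smooth_mul oD sf su) (smooth_mul oD sg sv) Dx).
rewrite (dirderM X oD sf su Dx) (dirderM X oD sg sv Dx).
by move: (dirder X f x) (dirder X u x) (dirder X g x) (dirder X v x) (f x) (u x) (g x) (v x)
  => {sf su sg sv} *; ring.
Qed.

(** Cartan's formula for the exterior derivative of the one-form
    [w0 dx + w1 dy], evaluated on two vector fields. *)
Lemma exterior_derivative D X Y (w0 w1 : plane R -> R) x : open D ->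
  smooth_mx D X -> smooth_mx D Y -> smooth_on D w0 -> smooth_on D w1 -> D x ->
  dirder X (fun y => Y y 0 0 * w0 y + Y y 0 1 * w1 y) x
  - dirder Y (fun y => X y 0 0 * w0 y + X y 0 1 * w1 y) x
  - ((dirder X (fun y => Y y 0 0) x - dirder Y (fun y => X y 0 0) x) * w0 x
     + (dirder X (fun y => Y y 0 1) x - dirder Y (fun y => X y 0 1) x) * w1 x)
  = (X x 0 0 * Y x 0 1 - X x 0 1 * Y x 0 0) * (pd 0 w1 x - pd 1 w0 x).
Proof.
move=> oD sX sY s0 s1 Dx.
rewrite (dirder_comb X oD (sY 0 0) s0 (sY 0 1) s1 Dx).
rewrite (dirder_comb Y oD (sX 0 0) s0 (sX 0 1) s1 Dx).
move: (dirder X (fun y => Y y 0 0) x) (dirder X (fun y => Y y 0 1) x).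
move: (dirder Y (fun y => X y 0 0) x) (dirder Y (fun y => X y 0 1) x).
rewrite /dirder !sum2.
move: (pd 0 w0 x) (pd 0 w1 x) (pd 1 w0 x) (pd 1 w1 x) (w0 x) (w1 x).
move: (X x 0 0) (X x 0 1) (Y x 0 0) (Y x 0 1) => {sX sY s0 s1} *; ring.
Qed.

(** The bracket determines the connection form: it vanishes on [X] and equals
    [- b] on [Y].  The formula for the curvature is then Cartan's second structure
    equation.  Its right-hand side only uses derivatives along the frame, so it can
    be evaluated in any chart in which the frame is known. *)
Lemma frame_curvature D (h : plane R -> 'M[R]_2) (X Y : plane R -> plane R) (b : plane R -> R) :
  open D -> smooth_mx D h -> smooth_mx D X -> smooth_mx D Y -> smooth_on D b ->
  (forall x, D x -> (h x)^T = h x) ->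
  (forall x, D x -> [/\ ip h x (X x) (X x) = 1, ip h x (Y x) (Y x) = 1 & ip h x (X x) (Y x) = 0]) ->
  (forall x k, D x -> dirder X (fun y => Y y 0 k) x - dirder Y (fun y => X y 0 k) x =
    b x * Y x 0 k) ->
  forall x, D x -> local_nabla h Y Y x = b x *: X x /\
    local_gauss h x = dirder X b x - b x ^+ 2.
Proof.
move=> oD sh sX sY sb hT ort brk x0 Dx0.
pose P x := frame_mx (X x) (Y x).
have sP : smooth_mx D P.
  move=> a k; case: (ord2P a) => ->.
    by apply: smooth_ext (sX 0 k) => // y _; rewrite mxE.
  by apply: smooth_ext (sY 0 k) => // y _; rewrite mxE.
have P0 y : row 0 (P y) = X y by exact: frame_mx0.
have P1 y : row 1 (P y) = Y y by exact: frame_mx1.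
have PhP y : D y -> P y *m h y *m (P y)^T = 1%:M.
  by move=> Dy; have [XX YY XY] := ort y Dy; exact: frame_mx_gram (hT y Dy) XX YY XY.
pose w (Z : plane R -> plane R) y :=
  Z y 0 0 * connection_form h P 0 y + Z y 0 1 * connection_form h P 1 y.
have nab Z c y : D y -> local_nabla h Z (fun z => row c (P z)) y = w Z y *: row c (rot *m P y).
  move=> Dy; rewrite local_nablaE sum2.
  have E i : dmx i (fun z => row c (P z)) y + row c (P y) *m connection h i y =
      row c (connection_form h P i y *: (rot *m P y)).
    rewrite -(covdE oD sh sP hT PhP i Dy).
    apply/rowP => k; rewrite /covd [LHS]mxE [RHS]mxE [RHS]mxE; congr (_ + _).
      by rewrite [LHS]mxE [RHS]mxE; congr (pd i _ y); apply/funext => z; rewrite mxE.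
    by rewrite [LHS]mxE [RHS]mxE; apply: eq_bigr => j _; rewrite mxE.
  rewrite (E 0) (E 1); exact: row_comb.
have rot0 y : row 0 (rot *m P y) = Y y by rewrite (row_rot _).1 P1.
have rot1 y : row 1 (rot *m P y) = - X y by rewrite (row_rot _).2 P0.
have EX : (fun z => row 0 (P z)) = X by apply/funext.
have EY : (fun z => row 1 (P z)) = Y by apply/funext.
have nabX Z y : D y -> local_nabla h Z X y = w Z y *: Y y.
  by move=> Dy; rewrite -EX nab // rot0.
have nabY Z y : D y -> local_nabla h Z Y y = - w Z y *: X y.
  by move=> Dy; rewrite -EY nab // rot1 scalerN scaleNr.
have tors y : D y -> local_nabla h X Y y - local_nabla h Y X y = b y *: Y y.
  move=> Dy; apply/rowP => k; rewrite coordB [RHS]mxE -(brk y k Dy).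
  rewrite !(mxE _ _ 0 k) !sum2.
  have := congr1 (fun A : 'rV[R]_2 => A 0 k) (connection_sym oD hT 0 1 Dy).
  rewrite mxE [in X in _ = X]mxE [in X in _ = X]mxE mxE => ->; ring.
have wE y : D y -> w X y = 0 /\ w Y y = - b y.
  move=> Dy; have := tors y Dy; rewrite nabX // nabY //.
  have [XX YY XY] := ort y Dy.
  have YX : ip h y (Y y) (X y) = 0 by rewrite /ip (form_sym _ _ (hT y Dy)).
  have lin (p q r : R) u : - p *: X y - q *: Y y = r *: Y y ->
      - p * ip h y (X y) u - q * ip h y (Y y) u = r * ip h y (Y y) u.
    by move=> E; rewrite -ip_comb E ipZ.
  move=> E; have := lin _ _ _ (X y) E; have := lin _ _ _ (Y y) E.
  rewrite XX YY XY YX; move: (w X y) (w Y y) (b y) => p q r; split; lra.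
split; first by rewrite nabY // (wE x0 Dx0).2 opprK.
rewrite (local_gauss_form oD sh sP hT PhP Dx0) /curvature_form.
have so i := smooth_omega oD sh sP PhP i.
have EYX : dirder Y (w X) x0 = 0.
  rewrite (dirder_eq_on Y (g := fun=> 0) oD _ Dx0) => [|y Dy]; last exact: (wE y Dy).1.
  by rewrite /dirder big1 // => i _; rewrite /pd derive_cst mulr0.
have EXY : dirder X (w Y) x0 = - dirder X b x0.
  rewrite (dirder_eq_on X (g := fun y => (fun=> -1) y * b y) oD _ Dx0) => [|y Dy]; last first.
    by rewrite mulN1r; exact: (wE y Dy).2.
  rewrite (dirderM X oD (smooth_cst oD (-1)) sb Dx0) mulN1r.
  rewrite [X in _ + _ * X]/dirder [X in _ + _ * X]big1 ?mulr0 ?addr0 // => i _.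
  by rewrite /pd derive_cst mulr0.
have := exterior_derivative oD sX sY (so 0) (so 1) Dx0.
rewrite !(brk x0 _ Dx0) -[X in X - _ - _]/(dirder X (w Y) x0) -[X in _ - X - _]/(dirder Y (w X) x0).
have -> : b x0 * Y x0 0 0 * connection_form h P 0 x0
  + b x0 * Y x0 0 1 * connection_form h P 1 x0 = b x0 * w Y x0.
  by rewrite -!mulrA -mulrDr.
have -> : \det (P x0) = X x0 0 0 * Y x0 0 1 - X x0 0 1 * Y x0 0 0.
  by rewrite det2 !mxE.
rewrite EYX EXY (wE x0 Dx0).2 mulNr [in RHS]mulrC => <-.
by move: (dirder X b x0) (b x0) => *; ring.
Qed.
End Frame.

(** * Gradient and curvature of a metric *)

Section Metric.
Variable R : realType.
Implicit Types (x y : plane R) (X Y : plane R -> plane R) (f : plane R -> R).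

Local Notation e_ i := (delta_mx 0 i : plane R).

Section OneMetric.
Variables (D : set (plane R)) (h : plane R -> 'M[R]_2).
Hypotheses (oD : open D) (sh : smooth_mx D h).
Hypothesis hT : forall x, D x -> (h x)^T = h x.
Hypothesis h_pos : forall x, D x -> forall v, v != 0 -> 0 < ip h x v v.

Lemma metric_unit x : D x -> h x \in unitmx.
Proof.
move=> Dx; rewrite -row_free_unit -kermx_eq0; apply/rowV0P => v /sub_kermxP vh.
apply: contraPeq vh => v0 vh; have := h_pos Dx v0.
by rewrite /ip vh mul0mx mxE ltxx.
Qed.

Lemma metric_det x : D x -> h x 0 0 * h x 1 1 - h x 0 1 ^+ 2 != 0.
Proof.
move=> Dx; have := metric_unit Dx; rewrite unitmxE unitfE det2.
have -> : h x 1 0 = h x 0 1 by rewrite -[in LHS](hT Dx) mxE.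
by rewrite expr2.
Qed.

Lemma smooth_ip X Y : smooth_mx D X -> smooth_mx D Y ->
  smooth_on D (fun x => ip h x (X x) (Y x)).
Proof.
move=> sX sY.
exact: (smooth_mx_mul oD (smooth_mx_mul oD sX sh) (smooth_mx_tr oD sY)).
Qed.

Lemma smooth_local_nabla X Y : smooth_mx D X -> smooth_mx D Y ->
  smooth_mx D (local_nabla h X Y).
Proof.
move=> sX sY i j; rewrite (ord1 i).
have sG k : smooth_mx D (fun x => X x 0 k *: (dmx k Y x + Y x *m connection h k x)).
  exact: (smooth_mx_scale oD (sX 0 k) (smooth_mx_add oD (smooth_mx_d oD k sY)
    (smooth_mx_mul oD sY (smooth_christoffel oD sh metric_unit k)))).
apply: smooth_ext (smooth_mx_add oD (sG 0) (sG 1) 0 j) => // x _.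
by rewrite local_nablaE sum2.
Qed.

Lemma ip_coord x i j : ip h x (e_ i) (e_ j) = h x i j.
Proof. by rewrite /ip -rowE trmx_delta -colE !mxE. Qed.

Lemma smooth_gauss : smooth_on D (local_gauss h).
Proof.
have se i : smooth_mx D (fun=> e_ i) by exact: smooth_mx_cst.
have s1 := smooth_local_nabla (se 0) (smooth_local_nabla (se 1) (se 1)).
have s2 := smooth_local_nabla (se 1) (smooth_local_nabla (se 0) (se 1)).
have s3 := smooth_mx_add oD s1 (smooth_mx_scale oD (smooth_cst oD (-1)) s2).
have num := smooth_ip s3 (se 0).
have sden : smooth_on D (fun x => (h x 0 0 * h x 1 1 - h x 0 1 ^+ 2)^-1).
  apply: smooth_inv; [exact: oD| |exact: metric_det].
  exact: (smooth_add oD (smooth_mul oD (sh 0 0) (sh 1 1))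
    (smooth_opp oD (smooth_exprn oD 2 (sh 0 1)))).
apply: smooth_ext (smooth_mul oD num sden) => // x _.
by rewrite /local_gauss !ip_coord scaleN1r.
Qed.

Lemma smooth_grad f : smooth_on D f -> smooth_mx D (local_grad h f).
Proof.
move=> sf; apply: (smooth_mx_mul oD _ (smooth_invmx oD sh metric_unit)) => i j.
by apply: smooth_ext (smooth_pd j sf) => // x _; rewrite mxE.
Qed.

Lemma ipC x u v : D x -> ip h x u v = ip h x v u.
Proof. by move=> Dx; apply: form_sym; exact: hT. Qed.

Lemma grad_ip f x v : D x -> ip h x (local_grad h f x) v = \sum_i v 0 i * pd i f x.
Proof.
move=> Dx; rewrite /ip /local_grad mulmxKV ?metric_unit // mxE; apply: eq_bigr => i _.
by rewrite !mxE mulrC.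
Qed.

End OneMetric.

Lemma dirder_cst X (c : R) x : dirder X (fun=> c) x = 0.
Proof. by rewrite /dirder big1 // => i _; rewrite /pd derive_cst mulr0. Qed.

Lemma dirder_ln D X f x : open D -> smooth_on D f -> D x -> 0 < f x ->
  dirder X (fun y => ln (f y)) x = (f x)^-1 * dirder X f x.
Proof.
move=> oD sf Dx f0; have df := smooth_differentiable oD sf Dx.
rewrite /dirder mulr_sumr; apply: eq_bigr => i _.
rewrite (_ : pd i (fun y => ln (f y)) x = (f x)^-1 * pd i f x); last first.
  exact: (derive_comp1 _ (is_derive1_ln f0) df).
by rewrite mulrCA.
Qed.

(** The structure equations of the frame as relations between the values, at a
    point, of [r = sqrt (- K)], [f = X1 K], [a = 3 f / (8 K)],
    [q = sqrt 3 f / (8 r ^ 3)], [T = sqrt (1 + q ^ 2)] and of their derivatives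
    along [X1], with [c = sqrt 3]. *)
Lemma frame_ode (c r f a q T r' f' a' q' T' : R) : c * c = 3 -> 0 < r -> 0 < T ->
  r * r' + r * r' = - f -> 8 * (a * (r * r)) = - 3 * f ->
  8 * (a * (r * r' + r * r') + r * r * a') = - 3 * f' -> - (r * r) = a' - a ^+ 2 ->
  8 * (q * (r * (r * r))) = c * f ->
  8 * (q * (r * (r * r' + r * r') + r * r * r') + r * (r * r) * q') = c * f' ->
  T * T = 1 + q * q -> T * T' + T * T' = q * q' + q * q' ->
  [/\ q' = r * (T * T) * c / 3, T' = q * r * T * c / 3, r * T' + T * r' = a * (r * T) &
     (r * r' + r * r') * T + 8 * (r * r) * T' = 0].
Proof.
move=> cc r0 T0 h1 h2 h3 h4 h5 h6 h7 h8.
have rn : r != 0 by rewrite gt_eqF.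
have Tn : T != 0 by rewrite gt_eqF.
have cn : c != 0 by apply: contra_eq_neq cc => ->; rewrite mulr0 eq_sym pnatr_eq0.
have r'E : r' = - f / (2 * r) by rewrite -h1; field.
have aE : a = - 3 * f / (8 * (r * r)) by rewrite -h2; field.
have a'E : a' = a ^+ 2 - r * r by rewrite h4; ring.
have f'E : f' = (8 * (r ^+ 4) - 33 / 8 * f ^+ 2 / r ^+ 2) / 3.
  have -> : f' = - (8 * (a * (r * r' + r * r') + r * r * a')) / 3 by rewrite h3; field.
  by rewrite a'E r'E aE; field.
have qE : q = c * f / (8 * r ^+ 3) by rewrite -h5; field.
have q'E : q' = (c * f' / 8 - q * 3 * (r * r) * r') / (r ^+ 3) by rewrite -h6; field.
have fE : f = 8 * q * r ^+ 3 * c / 3.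
  have -> : 8 * q * r ^+ 3 * c = 3 * f by rewrite -cc -(mulrA c) -h5; ring.
  by field.
have Q : q' = r * (T * T) * c / 3.
  rewrite h7 q'E f'E r'E fE.
  have -> : (8 * q * r ^+ 3 * c / 3) ^+ 2 = 64 * q ^+ 2 * r ^+ 6 * (c * c) / 9 by field.
  by rewrite cc; field.
have T'E : T' = q * r * T * c / 3.
  have -> : T' = (T * T' + T * T') / (2 * T) by field.
  by rewrite h8 Q; field.
split => //.
- by rewrite T'E r'E aE fE; field.
- by rewrite h1 T'E fE; field.
Qed.

End Metric.

(** * Coordinates adapted to a frame *)

Section Forward.
Variable R : realType.
Implicit Types (x y : plane R).

Local Notation e_ i := (delta_mx 0 i : plane R).

Section OneFrame.
Variables (D : set (plane R)) (h : plane R -> 'M[R]_2) (X Y : plane R -> plane R).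
Hypotheses (oD : open D) (sh : smooth_mx D h) (sX : smooth_mx D X) (sY : smooth_mx D Y).
Hypothesis hT : forall x, D x -> (h x)^T = h x.
Hypothesis ort : forall x, D x ->
  [/\ ip h x (X x) (X x) = 1, ip h x (Y x) (Y x) = 1 & ip h x (X x) (Y x) = 0].

Definition bracket x : plane R :=
  \row_k (dirder X (fun y => Y y 0 k) x - dirder Y (fun y => X y 0 k) x).

Lemma smooth_bracket : smooth_mx D bracket.
Proof.
move=> i k; rewrite (ord1 i).
have sXk := smooth_dirder oD (sX 0) (sY 0 k).
have sYk := smooth_dirder oD (sY 0) (sX 0 k).
by apply: smooth_ext (smooth_add oD sXk (smooth_opp oD sYk)) => // x _; rewrite mxE.
Qed.

(** Cartan's formula for the exact form [dF]. *)
Lemma dirder_bracket F x : smooth_on D F -> D x ->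
  dirder bracket F x = dirder X (dirder Y F) x - dirder Y (dirder X F) x.
Proof.
move=> sF Dx.
have := exterior_derivative oD sX sY (smooth_pd 0 sF) (smooth_pd 1 sF) Dx.
rewrite (smooth_pd_sym 0 1 oD sF Dx) subrr mulr0 => /eqP.
rewrite subr_eq0 => /eqP E.
have dE Z : dirder Z F = fun y => Z y 0 0 * pd 0 F y + Z y 0 1 * pd 1 F y.
  by apply/funext => y; rewrite /dirder sum2.
by rewrite !dE E !mxE.
Qed.

Lemma frame_expand x (w : plane R) : D x ->
  w = ip h x w (X x) *: X x + ip h x w (Y x) *: Y x.
Proof.
by move=> Dx; have [XX YY XY] := ort Dx; exact: orthonormal_expand (hT Dx) XX YY XY.
Qed.

Lemma dirder_comb_field Z (a b : R) f x : Z x = a *: X x + b *: Y x ->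
  dirder Z f x = a * dirder X f x + b * dirder Y f x.
Proof. move=> ZE; rewrite /dirder !sum2 ZE !mxE; ring. Qed.

(** The bracket kills [K], because [Y K = 0] and [Y (X K) = 0]; so it is tangent to
    [Y], and [frame_curvature] recovers its length from the covariant derivative. *)
Lemma bracket_of_nabla (K b : plane R -> R) :
  smooth_on D K ->
  (forall x, D x -> dirder X K x != 0) -> (forall x, D x -> dirder Y K x = 0) ->
  (forall x, D x -> dirder Y (dirder X K) x = 0) ->
  (forall x, D x -> local_nabla h Y Y x = b x *: X x) ->
  forall x, D x -> bracket x = b x *: Y x /\ local_gauss h x = dirder X b x - b x ^+ 2.
Proof.
move=> sK XK YK YXK nab.
pose b' x := ip h x (bracket x) (Y x).
have sb' : smooth_on D b' := smooth_ip oD sh smooth_bracket sY.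
have brE x : D x -> bracket x = b' x *: Y x.
  move=> Dx; have E := frame_expand (bracket x) Dx.
  have := dirder_comb_field (Z := bracket) K E; rewrite (YK x Dx) mulr0 addr0.
  rewrite (dirder_bracket sK Dx) (YXK x Dx) subr0.
  rewrite (dirder_eq_on X (g := fun=> 0) oD YK Dx) dirder_cst => /esym/eqP.
  by rewrite mulf_eq0 (negbTE (XK x Dx)) orbF => /eqP b0; rewrite {1}E b0 scale0r add0r.
have brk x k : D x -> dirder X (fun y => Y y 0 k) x - dirder Y (fun y => X y 0 k) x =
  b' x * Y x 0 k.
  by move=> Dx; have := congr1 (fun v : plane R => v 0 k) (brE x Dx); rewrite !mxE.
have FC := frame_curvature oD sh sX sY sb' hT ort brk.
have bb' x : D x -> b' x = b x.
  move=> Dx; have [E _] := FC x Dx; rewrite (nab x Dx) in E.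
  have := congr1 (fun v => ip h x v (X x)) E; have [XX _ _] := ort Dx.
  by rewrite !ipZ XX !mulr1.
move=> x Dx; rewrite (brE x Dx) (FC x Dx).2 (bb' x Dx); split => //.
by rewrite (dirder_eq_on X oD bb' Dx).
Qed.

Lemma pd0_of_frame f x : D x -> dirder X f x = 0 -> dirder Y f x = 0 -> forall i, pd i f x = 0.
Proof.
move=> Dx X0 Y0 i; have E := frame_expand (e_ i) Dx.
have := dirder_comb_field (Z := fun=> e_ i) f E.
rewrite X0 Y0 !mulr0 addr0 => <-.
rewrite /dirder (bigD1 i) //= big1 ?addr0 => [|j ji].
  by rewrite mxE !eqxx mul1r.
by rewrite mxE (negbTE ji) mul0r.
Qed.

Lemma frame_det x : D x -> X x 0 0 * Y x 0 1 - X x 0 1 * Y x 0 0 != 0.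
Proof.
move=> Dx; have E0 := frame_expand (e_ 0) Dx; have E1 := frame_expand (e_ 1) Dx.
move: (ip h x (e_ 0) (X x)) (ip h x (e_ 0) (Y x)) E0 => a b E0.
move: (ip h x (e_ 1) (X x)) (ip h x (e_ 1) (Y x)) E1 => c d E1.
have := congr1 (fun v : plane R => v 0 0) E0; have := congr1 (fun v : plane R => v 0 1) E0.
have := congr1 (fun v : plane R => v 0 0) E1; have := congr1 (fun v : plane R => v 0 1) E1.
rewrite !mxE /=; move: (X x 0 0) (X x 0 1) (Y x 0 0) (Y x 0 1) => {E0 E1} x0 x1 y0 y1 e4 e3 e2 e1.
apply/eqP => d0.
have : (a * d - b * c) * (x0 * y1 - x1 * y0) = 1.
  have -> : (a * d - b * c) * (x0 * y1 - x1 * y0) =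
    (a * x0 + b * y0) * (c * x1 + d * y1) - (a * x1 + b * y1) * (c * x0 + d * y0) by ring.
  by rewrite -e1 -e2 -e3 -e4; ring.
by rewrite d0 mulr0 => /eqP; rewrite eq_sym oner_eq0.
Qed.

(** An orthonormal frame determines the metric, and here the Jacobian maps the
    frame to [s] times the standard basis. *)
Lemma frame_jacobian (J : 'M[R]_2) (s : R) x : D x -> s != 0 ->
  X x *m J = s *: e_ 0 -> Y x *m J = s *: e_ 1 ->
  J \in unitmx /\ h x = s ^- 2 *: (J *m J^T).
Proof.
move=> Dx s0 XJ YJ; have [XX YY XY] := ort Dx.
have PhP := frame_mx_gram (hT Dx) XX YY XY.
move: (frame_mx0 (X x) (Y x)) (frame_mx1 (X x) (Y x)) PhP.
move: (frame_mx (X x) (Y x)) => P P0 P1 PhP.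
have PJ : P *m J = s%:M.
  apply/row_matrixP => a; rewrite row_mul; case: (ord2P a) => ->.
    rewrite P0 XJ; apply/rowP => k; rewrite !mxE.
    by case: (ord2P k) => -> /=; rewrite ?mulr1 ?mulr0.
  rewrite P1 YJ; apply/rowP => k; rewrite !mxE.
  by case: (ord2P k) => -> /=; rewrite ?mulr1 ?mulr0.
have uP : P \in unitmx by have := PhP; rewrite -mulmxA => /mulmx1_unit[].
have JE : J = s *: invmx P by rewrite -[LHS](mulKmx uP) PJ mul_mx_scalar.
split; first by rewrite JE unitmxZ ?unitfE // unitmx_inv.
have hE : h x = invmx P *m (invmx P)^T.
  have -> : invmx P *m (invmx P)^T = invmx P *m (P *m h x *m P^T) *m (invmx P)^T.
    by rewrite PhP mulmx1.
  by rewrite !mulmxA mulVmx // mul1mx -mulmxA -trmx_mul mulVmx // trmx1 mulmx1.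
rewrite hE JE linearZ /= -scalemxAl -scalemxAr !scalerA.
have -> : s ^- 2 * s * s = 1 by field.
by rewrite scale1r.
Qed.

End OneFrame.
Lemma dirder_scale D Z (c : R) f x : open D -> smooth_on D f -> D x ->
  dirder Z (fun y => c * f y) x = c * dirder Z f x.
Proof.
move=> oD sf Dx; rewrite (dirderM Z oD (smooth_cst oD c) sf Dx).
by rewrite dirder_cst mulr0 addr0.
Qed.

Lemma cosh_arsinh (q T : R) : 0 < q + T -> T * T = 1 + q * q ->
  cosh (ln (q + T)) = T.
Proof.
move=> qT TT; rewrite /cosh expRN lnK ?posrE //.
have -> : (q + T)^-1 = T - q.
  apply: (mulIf (lt0r_neq0 qT)); rewrite mulVf ?lt0r_neq0 //.
  have -> : (T - q) * (q + T) = T * T - q * q by ring.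
  by rewrite TT; ring.
by field.
Qed.

(** The coordinate [u] is explicit: [sinh u = q] for the invariant [q] of the
    frame, and [sqrt (1 + q ^ 2) = T] is then [cosh u].  The structure equations
    say that [u] grows along [X] at the rate [s = r T / sqrt 3], and that the
    one-form dual to [Y] becomes closed after multiplication by [s]. *)
Lemma frame_coordinates D (h : plane R -> 'M[R]_2) (X Y : plane R -> plane R)
    (K : plane R -> R) x0 :
  open D -> smooth_mx D h -> smooth_mx D X -> smooth_mx D Y ->
  (forall x, D x -> (h x)^T = h x) ->
  (forall x, D x -> [/\ ip h x (X x) (X x) = 1, ip h x (Y x) (Y x) = 1 & ip h x (X x) (Y x) = 0]) ->
  smooth_on D K -> (forall x, D x -> K x = local_gauss h x) -> (forall x, D x -> K x < 0) ->
  (forall x, D x -> 0 < dirder X K x) -> (forall x, D x -> dirder Y K x = 0) ->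
  (forall x, D x -> dirder Y (dirder X K) x = 0) ->
  (forall x, D x -> local_nabla h Y Y x = (3 * dirder X K x / (8 * K x)) *: X x) ->
  D x0 ->
  exists (C : R) (W : set (plane R)) (F : plane R -> plane R),
  [/\ 0 < C, open W, W x0 & W `<=` D] /\
  [/\ forall j, smooth_on W (fun x => F x 0 j),
      forall x, W x -> 'J F x \in unitmx,
      forall x, W x -> F x 0 0 != 0 &
      forall x, W x -> h x = (C * cosh (F x 0 0) ^+ 6) *: ('J F x *m ('J F x)^T)].
Proof.
move=> oD sh sX sY hT ort sK KE Kneg XK YK YXK nab Dx0.
pose f := dirder X K; have sf : smooth_on D f := smooth_dirder oD (sX 0) sK.
have f0 x : D x -> 0 < f x by exact: XK.
pose a x := 3 * f x / (8 * K x).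
have XK0 x : D x -> dirder X K x != 0 by move=> Dx; rewrite gt_eqF // XK.
have BR := bracket_of_nabla oD sh sX sY hT ort sK XK0 YK YXK nab.
have BK x : D x -> bracket X Y x = a x *: Y x by move=> Dx; have [] := BR x Dx.
have KA x : D x -> K x = dirder X a x - a x ^+ 2.
  by move=> Dx; rewrite KE //; have [] := BR x Dx.
pose c : R := Num.sqrt 3; have cc : c * c = 3 by rewrite -expr2 sqr_sqrtr.
have c0 : 0 < c by rewrite sqrtr_gt0.
pose r x := Num.sqrt (- K x).
have Kpos x : D x -> 0 < - K x by move=> Dx; rewrite oppr_gt0 Kneg.
have sr : smooth_on D r := smooth_sqrt oD (smooth_opp oD sK) Kpos.
have r0 x : D x -> 0 < r x by move=> Dx; rewrite sqrtr_gt0 Kpos.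
have rr x : D x -> r x * r x = - K x by move=> Dx; rewrite -expr2 sqr_sqrtr // ltW // Kpos.
have srr := smooth_mul oD sr sr; have srrr := smooth_mul oD sr srr.
(* The hyperbolic sine of the coordinate [u]. *)
pose q x := (c * f x) * (8 * (r x * (r x * r x)))^-1.
have rrr0 x : D x -> 8 * (r x * (r x * r x)) != 0.
  by move=> /r0 rp; rewrite !mulf_neq0 // gt_eqF.
have sq : smooth_on D q.
  apply: (smooth_mul oD (smooth_mul oD (smooth_cst oD c) sf)).
  exact: (smooth_inv oD (smooth_mul oD (smooth_cst oD 8) srrr) rrr0).
have q0 x : D x -> 0 < q x.
  move=> Dx; have rp := r0 x Dx; apply: mulr_gt0; first by rewrite mulr_gt0 // f0.
  by rewrite invr_gt0 !mulr_gt0.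
have qE x : D x -> 8 * (q x * (r x * (r x * r x))) = c * f x.
  move=> /rrr0; rewrite /q; move: (c * f x) (r x * (r x * r x)) => u m m0; field.
  by move: m0; rewrite mulf_eq0 negb_or => /andP[].
pose T x := Num.sqrt (1 + q x * q x).
have T20 x : D x -> 0 < 1 + q x * q x by move=> _; rewrite ltr_pwDl // -expr2 sqr_ge0.
have sT : smooth_on D T :=
  smooth_sqrt oD (smooth_add oD (smooth_cst oD 1) (smooth_mul oD sq sq)) T20.
have T0 x : D x -> 0 < T x by move=> Dx; rewrite sqrtr_gt0 T20.
have TT x : D x -> T x * T x = 1 + q x * q x by move=> Dx; rewrite -expr2 sqr_sqrtr // ltW // T20.
have sa : smooth_on D a.
  apply: (smooth_mul oD (smooth_mul oD (smooth_cst oD 3) sf)).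
  apply: (smooth_inv oD (smooth_mul oD (smooth_cst oD 8) sK)) => x Dx.
  by rewrite mulf_neq0 // lt_eqF // Kneg.
have aE x : D x -> 8 * (a x * (r x * r x)) = - 3 * f x.
  move=> Dx; rewrite rr // /a; field.
  by rewrite lt_eqF // Kneg.
have rZ Z x : D x -> r x * dirder Z r x + r x * dirder Z r x = - dirder Z K x.
  move=> Dx; rewrite -(dirderM Z oD sr sr Dx) -mulN1r -(dirder_scale Z _ oD sK Dx).
  by apply: dirder_eq_on oD _ Dx => y Dy; rewrite mulN1r rr.
have rrZ Z x : D x -> dirder Z (fun y => r y * r y) x = r x * dirder Z r x + r x * dirder Z r x.
  by move=> Dx; rewrite (dirderM Z oD sr sr Dx).
have aZ Z x : D x -> 8 * (a x * (r x * dirder Z r x + r x * dirder Z r x)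
  + r x * r x * dirder Z a x)
    = - 3 * dirder Z f x.
  move=> Dx; rewrite -(rrZ Z x Dx) -(dirderM Z oD sa srr Dx).
  rewrite -(dirder_scale Z _ oD (smooth_mul oD sa srr) Dx) -(dirder_scale Z _ oD sf Dx).
  exact: dirder_eq_on oD aE Dx.
have qZ Z x : D x -> 8 * (q x * (r x * (r x * dirder Z r x + r x * dirder Z r x)
  + r x * r x * dirder Z r x)
    + r x * (r x * r x) * dirder Z q x) = c * dirder Z f x.
  move=> Dx; rewrite -(rrZ Z x Dx) -(dirderM Z oD sr srr Dx) -(dirderM Z oD sq srrr Dx).
  rewrite -(dirder_scale Z _ oD (smooth_mul oD sq srrr) Dx) -(dirder_scale Z _ oD sf Dx).
  exact: dirder_eq_on oD qE Dx.
have sqq := smooth_mul oD sq sq.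
have TZ Z x : D x -> T x * dirder Z T x + T x * dirder Z T x =
  q x * dirder Z q x + q x * dirder Z q x.
  move=> Dx; rewrite -(dirderM Z oD sT sT Dx) -(dirderM Z oD sq sq Dx).
  rewrite (dirder_eq_on Z oD TT Dx) (dirderD Z oD (smooth_cst oD 1) sqq Dx).
  by rewrite dirder_cst add0r.
have ODE x : D x -> [/\ dirder X q x = r x * (T x * T x) * c / 3,
  dirder X T x = q x * r x * T x * c / 3,
    r x * dirder X T x + T x * dirder X r x = a x * (r x * T x) &
    (r x * dirder X r x + r x * dirder X r x) * T x + 8 * (r x * r x) * dirder X T x = 0].
  move=> Dx; apply: (frame_ode cc (r0 x Dx) (T0 x Dx) (rZ X x Dx) (aE x Dx) (aZ X x Dx) _
    (qE x Dx) (qZ X x Dx) (TT x Dx) (TZ X x Dx)).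
  by rewrite rr // opprK KA.
have Yr x : D x -> dirder Y r x = 0.
  move=> Dx; have := rZ Y x Dx; rewrite YK // oppr0 -mulr2n => /eqP.
  by rewrite mulrn_eq0 /= mulf_eq0 gt_eqF ?r0 //= => /eqP.
have Yq x : D x -> dirder Y q x = 0.
  move=> Dx; have := qZ Y x Dx; rewrite Yr // YXK // !(mulr0, addr0, add0r).
  by move=> /eqP; rewrite !mulf_eq0 pnatr_eq0 (gt_eqF (r0 x Dx)) /= => /eqP.
have YT x : D x -> dirder Y T x = 0.
  move=> Dx; have := TZ Y x Dx; rewrite Yq // !mulr0 addr0 -mulr2n => /eqP.
  by rewrite mulrn_eq0 /= mulf_eq0 gt_eqF ?T0 //= => /eqP.
have qT0 x : D x -> 0 < q x + T x by move=> Dx; rewrite addr_gt0 ?q0 ?T0.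
have sqT := smooth_add oD sq sT.
pose U x := ln (q x + T x); have sU : smooth_on D U := smooth_ln oD sqT qT0.
pose s x := c / 3 * (r x * T x).
have srT := smooth_mul oD sr sT; have ss : smooth_on D s := smooth_mul oD (smooth_cst oD _) srT.
have s0 x : D x -> s x != 0.
  by move=> Dx; rewrite gt_eqF // mulr_gt0 ?divr_gt0 // mulr_gt0 ?r0 ?T0.
have XU x : D x -> dirder X U x = s x.
  move=> Dx; have [Xq XT _ _] := ODE x Dx; have tn := T0 x Dx; have qn := qT0 x Dx.
  rewrite /U (dirder_ln X oD sqT Dx qn) (dirderD X oD sq sT Dx) Xq XT /s.
  by move: qn; move: (q x) (T x) (r x) => q1 T1 r1 qn; field; rewrite gt_eqF.
have YU x : D x -> dirder Y U x = 0.
  move=> Dx; rewrite /U (dirder_ln Y oD sqT Dx (qT0 x Dx)) (dirderD Y oD sq sT Dx).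
  by rewrite Yq // YT // addr0 mulr0.
have Xs x : D x -> dirder X s x = a x * s x.
  move=> Dx; have [_ _ E _] := ODE x Dx.
  rewrite /s (dirder_scale X _ oD srT Dx) (dirderM X oD sr sT Dx) E.
  by rewrite mulrCA.
(* [Q] is the first integral; the constant is [C = 3 / Q]. *)
pose w x := T x * T x; have sw : smooth_on D w := smooth_mul oD sT sT.
pose w4 x := (w x * w x) * (w x * w x).
have sww := smooth_mul oD sw sw; have sw4 : smooth_on D w4 := smooth_mul oD sww sww.
pose Q x := (r x * r x) * w4 x; have sQ : smooth_on D Q := smooth_mul oD srr sw4.
have QZ Z x : D x -> dirder Z Q x = T x ^+ 7 *
    ((r x * dirder Z r x + r x * dirder Z r x) * T x + 8 * (r x * r x) * dirder Z T x).
  move=> Dx; rewrite /Q (dirderM Z oD srr sw4 Dx) /w4 (dirderM Z oD sww sww Dx).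
  rewrite (dirderM Z oD sw sw Dx) /w (dirderM Z oD sT sT Dx) rrZ //.
  by move: (T x) (r x) (dirder Z T x) (dirder Z r x) => *; ring.
have Qpd i x : D x -> pd i Q x = 0.
  move=> Dx; apply: (pd0_of_frame hT ort Dx); rewrite QZ //.
    by have [_ _ _ ->] := ODE x Dx; rewrite mulr0.
  by rewrite Yr // YT // !(mulr0, addr0, mul0r).
(* The one-form dual to [Y], multiplied by [s]. *)
pose eta i x := s x * (Y x *m h x) 0 i.
have seta i : smooth_on D (eta i) := smooth_mul oD ss (smooth_mx_mul oD sY sh 0 i).
have etaV (V : plane R) x : V 0 0 * eta 0 x + V 0 1 * eta 1 x = s x * ip h x (Y x) V.
  rewrite /ip [(_ *m V^T) 0 0]mxE sum2 /eta ![V^T _ 0]mxE.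
  by move: ((Y x *m h x) 0 0) ((Y x *m h x) 0 1) => *; ring.
have closed_eta x : D x -> pd 1 (eta 0) x = pd 0 (eta 1) x.
  move=> Dx; have := exterior_derivative oD sX sY (seta 0) (seta 1) Dx.
  have -> : dirder X (fun y => Y y 0 0 * eta 0 y + Y y 0 1 * eta 1 y) x = dirder X s x.
    apply: dirder_eq_on oD _ Dx => y Dy.
    by rewrite etaV; have [_ -> _] := ort y Dy; rewrite mulr1.
  have -> : dirder Y (fun y => X y 0 0 * eta 0 y + X y 0 1 * eta 1 y) x = 0.
    rewrite (dirder_eq_on Y (g := fun=> 0) oD _ Dx) ?dirder_cst // => y Dy.
    by rewrite etaV (ipC hT _ _ Dy); have [_ _ ->] := ort y Dy; rewrite mulr0.
  have -> : (dirder X (fun y => Y y 0 0) x - dirder Y (fun y => X y 0 0) x) * eta 0 x +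
     (dirder X (fun y => Y y 0 1) x - dirder Y (fun y => X y 0 1) x) * eta 1 x = a x * s x.
    have -> : (dirder X (fun y => Y y 0 0) x - dirder Y (fun y => X y 0 0) x) =
      bracket X Y x 0 0 by rewrite mxE.
    have -> : (dirder X (fun y => Y y 0 1) x - dirder Y (fun y => X y 0 1) x) =
      bracket X Y x 0 1 by rewrite mxE.
    rewrite etaV BK // (ipC hT _ _ Dx) ipZ; have [_ -> _] := ort x Dx.
    by rewrite mulr1 mulrC.
  rewrite Xs // subr0 subrr => /esym/eqP; rewrite mulf_eq0 (negbTE (frame_det hT ort Dx)) /=.
  by rewrite subr_eq0 => /eqP.
have [W' [V [oW' W'x0 W'D sV VE]]] := poincare oD Dx0 (seta 0) (seta 1) closed_eta.
have [rho rho0 rhoW] := open_ballP oW' W'x0.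
pose W := [set x : plane R | `|x - x0| < rho].
have WW' : W `<=` W' by exact: rhoW.
have WD : W `<=` D by move=> x /WW' /W'D.
have oW : open W.
  suff -> : W = ball x0 rho by exact: ball_open.
  by rewrite ball_plane; apply/seteqP; split => y; rewrite /= distrC.
have Wx0 : W x0 by rewrite /W /= subrr normr0.
pose F x := point2 (U x) (V x).
have F0 : (fun x => F x 0 0) = U by apply/funext => x; rewrite /F point2_0.
have F1 : (fun x => F x 0 1) = V by apply/funext => x; rewrite /F point2_1.
have sF j : smooth_on W (fun x => F x 0 j).
  case: (ord2P j) => ->; first by rewrite F0; exact: smooth_sub WD sU.
  by rewrite F1; exact: smooth_sub WW' sV.
have JF x : W x -> 'J F x \in unitmx /\ h x = s x ^- 2 *: ('J F x *m ('J F x)^T).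
  move=> Wx; have Dx := WD x Wx; have [V0 V1] := VE x (WW' x Wx).
  have dF : differentiable F x.
    by apply: differentiable_coords => j; exact: smooth_differentiable oW (sF j) Wx.
  have ZJ (Z : plane R -> plane R) : Z x *m 'J F x =
    dirder Z U x *: e_ 0 + (s x * ip h x (Y x) (Z x)) *: e_ 1.
    apply/rowP => k; rewrite [LHS]mxE sum2 !jacobianE // -etaV.
    case: (ord2P k) => ->; rewrite ?F0 ?F1 !mxE /= ?mulr1 ?mulr0 ?addr0 ?add0r.
      by rewrite /dirder sum2.
    by rewrite V0 V1.
  have [XX YY XY] := ort x Dx.
  apply: (frame_jacobian hT ort Dx (s0 x Dx)).
    by rewrite ZJ XU // (ipC hT _ _ Dx) XY mulr0 scale0r addr0.
  by rewrite ZJ YU // YY mulr1 scale0r add0r.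
have Q0 x : D x -> 0 < Q x by move=> Dx; rewrite /Q /w4 /w !mulr_gt0 ?r0 ?T0.
exists (3 / Q x0), W, F; split; first by split => //; rewrite divr_gt0 ?Q0.
split => //.
- by move=> x /JF[].
- move=> x /WD Dx; rewrite [F x 0 0](congr1 (fun G => G x) F0) gt_eqF // ln_gt0 //.
  have := q0 x Dx; have := TT x Dx; have := T0 x Dx; move: (q x) (T x) => q1 T1; nra.
- move=> x Wx; have [_ ->] := JF x Wx; have Dx := WD x Wx; congr (_ *: _).
  rewrite [F x 0 0](congr1 (fun G => G x) F0) cosh_arsinh ?qT0 ?TT //.
  have -> : Q x0 = Q x.
    apply: (@cst_of_pd0 R Q x0 rho x x0) => // [y Wy|y i Wy].
      exact: smooth_differentiable oD sQ (WD y Wy).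
    exact: Qpd (WD y Wy).
  have := r0 x Dx; have := T0 x Dx; rewrite /Q /w4 /w /s.
  have -> : (c / 3 * (r x * T x)) ^- 2 = (c * c * (r x * T x) ^+ 2 / 9)^-1.
    by congr (_^-1); field.
  rewrite cc; move: (r x) (T x) => r1 T1 T1_gt0 r1_gt0; field.
  by rewrite !gt_eqF.
Qed.

End Forward.

(** * Charts *)

Section NormalizedGradient.
Variable R : realType.
Implicit Types (x y : plane R).

Definition unit_grad (h : plane R -> 'M[R]_2) (K : plane R -> R) x : plane R :=
  (Num.sqrt (ip h x (local_grad h K x) (local_grad h K x)))^-1 *: local_grad h K x.

Variables (D : set (plane R)) (h : plane R -> 'M[R]_2).
Hypotheses (oD : open D) (sh : smooth_mx D h).
Hypothesis hT : forall x, D x -> (h x)^T = h x.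
Hypothesis h_pos : forall x, D x -> forall v, v != 0 -> 0 < ip h x v v.
Let K := local_gauss h.
Let G := local_grad h K.
Let n x := Num.sqrt (ip h x (G x) (G x)).
Hypothesis G0 : forall x, D x -> G x != 0.

Lemma norm_grad_gt0 x : D x -> 0 < n x.
Proof. by move=> Dx; rewrite sqrtr_gt0; apply: h_pos => //; exact: G0. Qed.

Lemma smooth_unit_grad : smooth_mx D (unit_grad h K).
Proof.
have sG : smooth_mx D G := smooth_grad oD sh h_pos (smooth_gauss oD sh hT h_pos).
have sn : smooth_on D n.
  by apply: (smooth_sqrt oD (smooth_ip oD sh sG sG)) => x Dx; apply: h_pos => //; exact: G0.
apply: (smooth_mx_scale oD (smooth_inv oD sn _) sG) => x Dx.
by rewrite gt_eqF // norm_grad_gt0.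
Qed.

Lemma dirder_ip_grad (Z : plane R -> plane R) x : D x -> dirder Z K x = ip h x (G x) (Z x).
Proof. by move=> Dx; rewrite (grad_ip h_pos). Qed.

Lemma grad_scale x : D x -> G x = n x *: unit_grad h K x.
Proof.
by move=> Dx; rewrite /unit_grad scalerA -/(n x) mulfV ?scale1r // gt_eqF // norm_grad_gt0.
Qed.

Lemma condition_coordinates (Y : plane R -> plane R) x0 :
  (forall x, D x -> K x < 0) -> smooth_mx D Y ->
  (forall x, D x -> [/\ ip h x (unit_grad h K x) (unit_grad h K x) = 1, ip h x (Y x) (Y x) = 1
     & ip h x (unit_grad h K x) (Y x) = 0]) ->
  (forall x, D x -> dirder Y (dirder (unit_grad h K) K) x = 0) ->
  (forall x, D x -> local_nabla h Y Y x
     = (3 * dirder (unit_grad h K) K x / (8 * K x)) *: unit_grad h K x) ->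
  D x0 ->
  exists (C : R) (W : set (plane R)) (F : plane R -> plane R),
  [/\ 0 < C, open W, W x0 & W `<=` D] /\
  [/\ forall j, smooth_on W (fun x => F x 0 j),
      forall x, W x -> 'J F x \in unitmx,
      forall x, W x -> F x 0 0 != 0 &
      forall x, W x -> h x = (C * cosh (F x 0 0) ^+ 6) *: ('J F x *m ('J F x)^T)].
Proof.
move=> Kneg sY ort YXK nab Dx0.
have sK : smooth_on D K := smooth_gauss oD sh hT h_pos.
apply: (frame_coordinates oD sh smooth_unit_grad sY hT ort sK _ Kneg _ _ YXK nab Dx0) => // x Dx.
  rewrite dirder_ip_grad // grad_scale // ipZ; have [-> _ _] := ort x Dx.
  by rewrite mulr1 norm_grad_gt0.
rewrite dirder_ip_grad // grad_scale // ipZ; have [_ _ ->] := ort x Dx.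
by rewrite mulr0.
Qed.

End NormalizedGradient.

Section Charts.
Variable R : realType.

Lemma chart_map_continuous (M : topologicalType) (c : chart R M) p :
  chart_dom c p -> {for p, continuous c}.
Proof.
move=> cp; have := @chart_map_cont _ _ c;
  rewrite (continuous_open_subspace _ (@chart_dom_open _ _ c)).
by apply; rewrite inE.
Qed.

Lemma chart_inv_continuous (M : topologicalType) (c : chart R M) x :
  chart_im c x -> {for x, continuous (chart_inv c)}.
Proof.
move=> cx; have := @chart_inv_cont _ _ c;
  rewrite (continuous_open_subspace _ (@chart_im_open _ _ c)).
by apply; rewrite inE.
Qed.

Lemma chart_invP (M : topologicalType) (c : chart R M) x : chart_im c x ->
  chart_dom c (chart_inv c x) /\ c (chart_inv c x) = x.
Proof. by case=> p cp <-; rewrite chart_mapK. Qed.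

Lemma chart_imP (M : topologicalType) (c : chart R M) p : chart_dom c p -> chart_im c (c p).
Proof. by move=> cp; exists p. Qed.

Lemma open_preimage (T U : topologicalType) (f : T -> U) (A : set T) (B : set U) :
  open A -> open B -> (forall x, A x -> {for x, continuous f}) -> open (A `&` f @^-1` B).
Proof.
move=> oA oB cf; have := continuous_inP f oA => -[+ _]; apply => // x.
by rewrite inE; apply: cf.
Qed.

Lemma overlapE (M : topologicalType) (c d : chart R M) :
  overlap c d = chart_im c `&` chart_inv c @^-1` chart_dom d.
Proof.
apply/seteqP; split => [x [p [cp dp] <-]|x [[p cp <-]]] /=.
  by split; [exists p|rewrite /= chart_mapK].
by rewrite chart_mapK // => dp; exists p.
Qed.

Lemma open_overlap (M : topologicalType) (c d : chart R M) : open (overlap c d).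
Proof.
rewrite overlapE; apply: open_preimage; [exact: chart_im_open|exact: chart_dom_open|].
exact: chart_inv_continuous.
Qed.

Lemma smooth_differentiable_mx D (F : plane R -> plane R) x : open D ->
  (forall j, smooth_on D (fun x => F x 0 j)) -> D x -> differentiable F x.
Proof.
move=> oD sF Dx; apply: differentiable_coords => j.
exact: smooth_differentiable oD (sF j) Dx.
Qed.

Lemma jacobian_eq_on D (F t : plane R -> plane R) x : open D ->
  (forall j, smooth_on D (fun x => F x 0 j)) -> (forall y, D y -> t y = F y) -> D x ->
  'J t x = 'J F x.
Proof.
move=> oD sF tF Dx; apply/matrixP => i j.
have dF := smooth_differentiable_mx oD sF Dx.
have dt : differentiable t x.
  apply: differentiable_near dF; apply: filterS (open_near oD Dx) => y Dy.
  by rewrite tF.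
have tFj y : D y -> t y 0 j = F y 0 j by move=> Dy; rewrite tF.
have E := pd_eq_on i oD tFj Dx.
exact: (etrans (jacobianE i j dt) (etrans E (esym (jacobianE i j dF)))).
Qed.

Section NewChart.
Variables (M : surface R) (c : chart R M) (W : set (plane R)) (F Y : plane R -> plane R).
Hypotheses (Ac : atlas c) (oW : open W) (Wc : W `<=` chart_im c) (oFW : open (F @` W)).
Hypothesis YF : forall x, W x -> Y (F x) = x.
Hypothesis sF : forall j, smooth_on W (fun x => F x 0 j).
Hypothesis sY : forall j, smooth_on (F @` W) (fun y => Y y 0 j).

Let dom := chart_dom c `&` c @^-1` W.

Let dom_open : open dom.
Proof.
apply: open_preimage => //; first exact: chart_dom_open.
exact: chart_map_continuous.
Qed.

Let imE : (F \o c) @` dom = F @` W.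
Proof.
apply/seteqP; split => [_ [p [_ Wp] <-]|_ [x Wx <-]]; first by exists (c p).
have [dx cx] := chart_invP (Wc Wx).
by exists (chart_inv c x) => /=; [split => //=; rewrite cx|rewrite cx].
Qed.

Let im_open : open ((F \o c) @` dom). Proof. by rewrite imE. Qed.

Let mapK p : dom p -> (chart_inv c \o Y) ((F \o c) p) = p.
Proof. by case=> cp Wp; rewrite /= YF // chart_mapK. Qed.

Let map_cont : {within dom, continuous (F \o c)}.
Proof.
apply: continuous_in_subspaceT => p; rewrite inE => -[cp Wp].
apply: continuous_comp; first exact: chart_map_continuous.
exact/differentiable_continuous/(smooth_differentiable_mx oW sF).
Qed.

Let inv_cont : {within (F \o c) @` dom, continuous (chart_inv c \o Y)}.
Proof.
apply: continuous_in_subspaceT => y; rewrite inE imE => Wy.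
apply: continuous_comp; first exact/differentiable_continuous/(smooth_differentiable_mx oFW sY).
by case: Wy => x Wx <-; rewrite YF //; apply/chart_inv_continuous/Wc.
Qed.

Definition new_chart : chart R M :=
  Chart dom_open im_open mapK map_cont inv_cont.

(** The transition maps between [new_chart] and another chart are those of [c]
    composed with [F] or with its inverse [Y]. *)
Lemma new_chart_atlas : atlas new_chart.
Proof.
apply: atlas_maximal => e Ae; split => i.
  have sce := atlas_compat Ac Ae i.
  apply: (smooth_comp (@open_overlap _ new_chart e) (@open_overlap _ c e) sce).
    move=> y [p [[cp Wp] ep] <-] /=; rewrite YF //; by exists p.
  move=> j; apply: smooth_sub (sY j) => y [p [[cp Wp] ep] <-] /=.
  by exists (c p).
have sec := atlas_compat Ae Ac.
have oen := @open_overlap _ e new_chart.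
apply: (@smooth_comp R _ oen W (fun x => F x 0 i) (transition e c) oW (sF i)).
  by move=> x [p [ep [cp Wp]] <-]; rewrite /transition /= chart_mapK.
by move=> j; apply: smooth_sub (sec j) => x [p [ep [cp Wp]] <-]; exists p.
Qed.

Lemma new_chart_jacobian x : W x ->
  overlap c new_chart x /\ transition c new_chart x = F x /\
  'J (transition c new_chart) x = 'J F x.
Proof.
move=> Wx; have [dx cx] := chart_invP (Wc Wx).
have tE y : W y -> transition c new_chart y = F y.
  by move=> Wy; rewrite /transition /= (chart_invP (Wc Wy)).2.
have ov : overlap c new_chart x.
  by exists (chart_inv c x) => //; split => //; split => //=; rewrite cx.
split; first exact: ov.
move: (transition c new_chart) tE => t tE; split; first exact: tE.
exact: jacobian_eq_on oW sF tE Wx.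
Qed.

End NewChart.
End Charts.

(** * The metrics g_C *)

Section Reverse.
Variable R : realType.
Implicit Types (x y : plane R).

Local Notation e_ i := (delta_mx 0 i : plane R).

Definition sinh (t : R) : R := (expR t - expR (- t)) / 2.

Lemma cosh_gt0 (t : R) : 0 < cosh t.
Proof. by rewrite divr_gt0 // addr_gt0 ?expR_gt0. Qed.

Lemma cosh2E (t : R) : cosh t ^+ 2 = 1 + sinh t ^+ 2.
Proof.
rewrite /cosh /sinh expRN; have := expR_gt0 t; move: (expR t) => u u0.
by field; rewrite gt_eqF.
Qed.

Lemma sinh_sign (e t : R) : 0 < e * t -> 0 < e * sinh t.
Proof.
rewrite /sinh => et; have [t0|t0] := ltP 0 t.
  have e0 : 0 < e by move: et; rewrite pmulr_lgt0.
  by rewrite mulr_gt0 // divr_gt0 // subr_gt0 ltr_expR; move: t0; lra.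
have t1 : t < 0 by rewrite lt_neqAle t0 andbT; apply: contraTneq et => ->; rewrite mulr0 ltxx.
have e0 : e < 0 by move: et; rewrite nmulr_lgt0.
by rewrite nmulr_rgt0 // pmulr_llt0 ?invr_gt0 // subr_lt0 ltr_expR; move: t1; lra.
Qed.

Lemma smooth_cosh D f : open D -> smooth_on D f -> smooth_on D (fun x => cosh (f x)).
Proof.
move=> oD sf; have s1 := smooth_exp oD sf; have s2 := smooth_exp oD (smooth_opp oD sf).
exact: (smooth_mul oD (smooth_add oD s1 s2) (smooth_cst oD 2^-1)).
Qed.

Lemma smooth_sinh D f : open D -> smooth_on D f -> smooth_on D (fun x => sinh (f x)).
Proof.
move=> oD sf; have s1 := smooth_exp oD sf; have s2 := smooth_exp oD (smooth_opp oD sf).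
exact: (smooth_mul oD (smooth_add oD s1 (smooth_opp oD s2)) (smooth_cst oD 2^-1)).
Qed.

Lemma is_derive_cosh (t : R) : is_derive t 1 (@cosh R) (sinh t).
Proof.
have d1 := is_derive_expR t.
have d2 : is_derive t 1 (fun t : R => expR (- t)) (expR (- t) * (-1)).
  exact: (@is_derive1_comp R expR (fun t => - t)).
by rewrite /cosh; apply: is_derive_eq; rewrite /sinh /GRing.scale /=; field.
Qed.

Lemma is_derive_sinh (t : R) : is_derive t 1 sinh (cosh t).
Proof.
have d1 := is_derive_expR t.
have d2 : is_derive t 1 (fun t : R => expR (- t)) (expR (- t) * (-1)).
  exact: (@is_derive1_comp R expR (fun t => - t)).
by rewrite /sinh; apply: is_derive_eq; rewrite /cosh /GRing.scale /=; field.
Qed.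

Lemma is_derive_monomial (a : R) (m n : nat) (t : R) :
  is_derive t 1 (fun t => a * (sinh t ^+ m * cosh t ^- n))
    (a * (m%:R * sinh t ^+ m.-1 * cosh t * cosh t ^- n - n%:R * sinh t ^+ m.+1 * cosh t ^- n.+1)).
Proof.
have d1 := is_derive_sinh t; have d2 := is_derive_cosh t; have c0 := cosh_gt0 t.
have d3 : is_derive t 1 (fun t => sinh t ^+ m) (m%:R * sinh t ^+ m.-1 * cosh t).
  rewrite (_ : (fun t => sinh t ^+ m) = sinh ^+ m); first exact: is_deriveX.
  by apply/funext => u; rewrite exprfctE.
have d4 : is_derive t 1 (fun t => cosh t ^+ n) (n%:R * cosh t ^+ n.-1 * sinh t).
  rewrite (_ : (fun t => cosh t ^+ n) = (@cosh R) ^+ n); first exact: is_deriveX.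
  by apply/funext => u; rewrite exprfctE.
have cn : cosh t ^+ n != 0 by rewrite expf_neq0 // gt_eqF.
have d5 : is_derive t 1 (fun t => cosh t ^- n) (- (cosh t ^+ n) ^- 2 *
  (n%:R * cosh t ^+ n.-1 * sinh t)).
  have [d6 d7] := d4; apply: DeriveDef; first exact: derivableV.
  by rewrite (@deriveV _ _ (fun t => cosh t ^+ n)) // d7.
apply: is_derive_eq; rewrite /GRing.scale /=.
have E : (cosh t ^+ n) ^- 2 * (n%:R * cosh t ^+ n.-1 * sinh t) = n%:R * sinh t * cosh t ^- n.+1.
  case: n {d4 d5} cn => [|k] cn; first by rewrite !mul0r mulr0.
  have ck : cosh t ^+ k != 0 by rewrite expf_neq0 // gt_eqF.
  have c1 : cosh t != 0 by rewrite gt_eqF.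
  rewrite /= !exprS; move: (cosh t ^+ k) (cosh t) (sinh t) ck c1 => u v w u0 v0.
  by field; rewrite u0.
by rewrite mulNr E [sinh t ^+ m.+1]exprS; move: (cosh t ^- n) (cosh t ^- n.+1) => *; ring.
Qed.

(** Derivatives along a field [Z] of the functions of [u] that occur below. *)
Lemma dirder_monomial D (Z : plane R -> plane R) f x (a : R) m n : open D -> smooth_on D f -> D x ->
  dirder Z (fun y => a * (sinh (f y) ^+ m * cosh (f y) ^- n)) x =
  a * (m%:R * sinh (f x) ^+ m.-1 * cosh (f x) * cosh (f x) ^- n
       - n%:R * sinh (f x) ^+ m.+1 * cosh (f x) ^- n.+1) * dirder Z f x.
Proof.
move=> oD sf Dx; have df := smooth_differentiable oD sf Dx.
rewrite /dirder mulr_sumr; apply: eq_bigr => i _; rewrite mulrCA; congr (_ * _).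
exact: (derive_comp1 _ (is_derive_monomial a m n (f x)) df).
Qed.

Lemma sign_close (a b : R) : a * a = 1 -> b * b = 1 -> `|b - a| < 1 -> a = b.
Proof.
move=> aa bb; rewrite ltr_norml => ab.
have : (a - b) * (a + b) = 0.
  have -> : (a - b) * (a + b) = a * a - b * b by ring.
  by rewrite aa bb subrr.
move/eqP; rewrite mulf_eq0 subr_eq0 => /orP[/eqP //|]; rewrite addr_eq0 => /eqP ab'.
exfalso; move: aa bb ab; rewrite ab' => aa bb /andP[]; nra.
Qed.

Lemma local_nabla_eq_on D h (X Y : plane R -> plane R) x : open D ->
  (forall y, D y -> X y = Y y) -> D x -> local_nabla h X X x = local_nabla h Y Y x.
Proof.
move=> oD XY Dx; rewrite !local_nablaE; apply: eq_bigr => i _.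
by rewrite XY // (dmx_eq_on i oD XY Dx).
Qed.

Section StandardFrame.
Variables (D : set (plane R)) (h : plane R -> 'M[R]_2) (F : plane R -> plane R) (C : R).
Hypotheses (oD : open D) (sh : smooth_mx D h).
Hypothesis hT : forall x, D x -> (h x)^T = h x.
Hypothesis sF : forall j, smooth_on D (fun x => F x 0 j).
Hypothesis uJ : forall x, D x -> 'J F x \in unitmx.
Hypothesis C0 : 0 < C.
Hypothesis hE : forall x, D x -> h x = (C * cosh (F x 0 0) ^+ 6) *: ('J F x *m ('J F x)^T).

Let u x := F x 0 0.
Let c := (Num.sqrt C)^-1.

Let c_gt0 : 0 < c. Proof. by rewrite invr_gt0 sqrtr_gt0. Qed.
Let ccC : c * c * C = 1.
Proof. by rewrite /c -invfM -expr2 sqr_sqrtr ?ltW // mulVf // gt_eqF. Qed.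

(** The orthonormal frame along the coordinate lines; the signs [e] allow for
    both orientations of either axis. *)
Definition std_frame (i : 'I_2) (e : R) x : plane R :=
  (e * (c * (sinh (u x) ^+ 0 * cosh (u x) ^- 3))) *: row i (invmx ('J F x)).

Let su : smooth_on D u := sF 0.

Lemma smooth_monomial (a : R) m n :
  smooth_on D (fun x => a * (sinh (u x) ^+ m * cosh (u x) ^- n)).
Proof.
have s1 := smooth_exprn oD m (smooth_sinh oD su).
have s2 : smooth_on D (fun x => cosh (u x) ^- n).
  apply: (smooth_inv oD (smooth_exprn oD n (smooth_cosh oD su))) => x _.
  by rewrite expf_neq0 // gt_eqF // cosh_gt0.
exact: (smooth_mul oD (smooth_cst oD a) (smooth_mul oD s1 s2)).
Qed.

Lemma smooth_std_frame i e : smooth_mx D (std_frame i e).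
Proof.
apply: (smooth_mx_scale oD (smooth_mul oD (smooth_cst oD e) (smooth_monomial c 0 3))) => a b.
have sJ k l : smooth_on D (fun x => 'J F x k l) by apply: smooth_jacobian.
by apply: smooth_ext (smooth_invmx oD sJ uJ i b) => // x _; rewrite mxE.
Qed.

Lemma std_frame_jacobian i e x : D x ->
  std_frame i e x *m 'J F x = (e * (c * (sinh (u x) ^+ 0 * cosh (u x) ^- 3))) *: e_ i.
Proof.
by move=> Dx; rewrite /std_frame -scalemxAl -row_mul mulVmx ?uJ // row1.
Qed.

Lemma dirderJ Z x j : D x -> dirder Z (fun y => F y 0 j) x = (Z x *m 'J F x) 0 j.
Proof.
move=> Dx; rewrite [RHS]mxE; apply: eq_bigr => i _; congr (_ * _); apply/esym/jacobianE.
exact: smooth_differentiable_mx oD sF Dx.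
Qed.

Lemma dirder_std i j e x : D x ->
  dirder (std_frame i e) (fun y => F y 0 j) x =
  e * (i == j)%:R * (c * (sinh (u x) ^+ 0 * cosh (u x) ^- 3)).
Proof.
by move=> Dx; rewrite dirderJ // std_frame_jacobian // !mxE eqxx /= eq_sym mulrAC.
Qed.

Lemma dirder_std0 e (f : plane R -> R) (a : R) m n x : D x ->
  (forall y, D y -> f y = a * (sinh (u y) ^+ m * cosh (u y) ^- n)) ->
  dirder (std_frame 0 e) f x = e * (c * a) *
    (m%:R * sinh (u x) ^+ m.-1 * cosh (u x) * cosh (u x) ^- n
       - n%:R * sinh (u x) ^+ m.+1 * cosh (u x) ^- n.+1) * cosh (u x) ^- 3.
Proof.
move=> Dx fE; rewrite (dirder_eq_on _ oD fE Dx) (dirder_monomial _ a m n oD su Dx).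
rewrite dirder_std // eqxx mulr1 expr0; move: (_ - _) (cosh _ ^- 3) => p q; ring.
Qed.

Lemma dirder_std1 e (f : plane R -> R) (a : R) m n x : D x ->
  (forall y, D y -> f y = a * (sinh (u y) ^+ m * cosh (u y) ^- n)) ->
  dirder (std_frame 1 e) f x = 0.
Proof.
move=> Dx fE; rewrite (dirder_eq_on _ oD fE Dx) (dirder_monomial _ a m n oD su Dx).
by rewrite dirder_std // mulr0 mul0r mulr0.
Qed.

Lemma std_frame_ip i j e d x : D x ->
  ip h x (std_frame i e x) (std_frame j d x) = e * d * (i == j)%:R.
Proof.
move=> Dx; rewrite /ip hE // -scalemxAr -scalemxAl.
rewrite mulmxA -(mulmxA _ ('J F x)^T) -trmx_mul !std_frame_jacobian //.
rewrite linearZ /= -scalemxAl -scalemxAr !scalerA trmx_delta mul_delta_mx_cond.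
have E : C * cosh (u x) ^+ 6 * (e * (c * (sinh (u x) ^+ 0 * cosh (u x) ^- 3))) *
   (d * (c * (sinh (u x) ^+ 0 * cosh (u x) ^- 3))) = e * d.
  rewrite expr0; transitivity (e * d * (c * c * C)); last by rewrite ccC mulr1.
  have := cosh_gt0 (u x); move: (cosh (u x)) => v v0.
  by field; rewrite gt_eqF.
by rewrite E [LHS]mxE; congr (_ * _); case: (i == j); rewrite ?mulr1n ?mulr0n !mxE.
Qed.

Lemma std_orthonormal e d x : e * e = 1 -> d * d = 1 -> D x ->
  [/\ ip h x (std_frame 0 e x) (std_frame 0 e x) = 1,
     ip h x (std_frame 1 d x) (std_frame 1 d x) = 1 &
     ip h x (std_frame 0 e x) (std_frame 1 d x) = 0].
Proof. by move=> ee dd Dx; rewrite !std_frame_ip // ee dd !mulr1 mulr0. Qed.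

(** As the Jacobian is invertible, it suffices to apply both sides to the
    coordinates of [F], on which the frame acts by explicit functions of [u]. *)
Lemma std_bracket e d x : D x -> bracket (std_frame 0 e) (std_frame 1 d) x
  = (- (3 * e * c) * (sinh (u x) ^+ 1 * cosh (u x) ^- 4)) *: std_frame 1 d x.
Proof.
move=> Dx; apply: (can_inj (mulmxK (uJ Dx))).
rewrite -[in RHS]scalemxAl std_frame_jacobian // scalerA.
apply/rowP => j; rewrite -(dirderJ _ _ Dx).
rewrite (dirder_bracket oD (smooth_std_frame 0 e) (smooth_std_frame 1 d) (sF j) Dx).
have E1 y : D y -> dirder (std_frame 1 d) (fun z => F z 0 j) y =
    d * (1 == j)%:R * c * (sinh (u y) ^+ 0 * cosh (u y) ^- 3).
  by move=> Dy; rewrite dirder_std // !mulrA.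
have E0 y : D y -> dirder (std_frame 0 e) (fun z => F z 0 j) y =
    e * (0 == j)%:R * c * (sinh (u y) ^+ 0 * cosh (u y) ^- 3).
  by move=> Dy; rewrite dirder_std // !mulrA.
rewrite (dirder_std0 e Dx E1) (dirder_std1 d Dx E0) subr0 !mxE eqxx /= eq_sym.
move: (cosh (u x) ^- 3) (cosh (u x) ^- 4) (sinh (u x)) => *; ring.
Qed.

Lemma std_frame_geometry e d x : e * e = 1 -> d * d = 1 -> D x ->
  local_nabla h (std_frame 1 d) (std_frame 1 d) x =
    (- (3 * e * c) * (sinh (u x) ^+ 1 * cosh (u x) ^- 4)) *: std_frame 0 e x /\
  local_gauss h x = - (3 * c * c) * (sinh (u x) ^+ 0 * cosh (u x) ^- 8).
Proof.
move=> ee dd Dx.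
have brk y k : D y -> dirder (std_frame 0 e) (fun z => std_frame 1 d z 0 k) y
    - dirder (std_frame 1 d) (fun z => std_frame 0 e z 0 k) y =
    (- (3 * e * c) * (sinh (u y) ^+ 1 * cosh (u y) ^- 4)) * std_frame 1 d y 0 k.
  move=> Dy; have := congr1 (fun v : plane R => v 0 k) (std_bracket e d Dy).
  by rewrite [X in X = _]mxE [X in _ = X]mxE.
have [E1 ->] := frame_curvature oD sh (smooth_std_frame 0 e) (smooth_std_frame 1 d)
  (smooth_monomial (- (3 * e * c)) 1 4) hT (fun y Dy => std_orthonormal ee dd Dy) brk Dx.
split; first exact: E1.
rewrite (dirder_std0 e Dx (fun y _ => erefl)).
have := cosh2E (u x); have := cosh_gt0 (u x); move: (sinh (u x)) (cosh (u x)) => a v v0 v2.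
have v1 : v != 0 by rewrite gt_eqF.
have -> : - (3 * c * c) * (a ^+ 0 * v ^- 8) = - (3 * c * c) * (v ^+ 2 - a ^+ 2) * v ^- 8.
  by rewrite v2; ring.
have -> : e * (c * - (3 * e * c)) = - (3 * c * c) * (e * e) by ring.
have -> : (- (3 * e * c) * (a ^+ 1 * v ^- 4)) ^+ 2 = 9 * c * c * (a * v ^- 4) ^+ 2 * (e * e).
  by ring.
by rewrite ee; field.
Qed.

Lemma std_curvature x : D x ->
  local_gauss h x = - (3 * c * c) * (sinh (u x) ^+ 0 * cosh (u x) ^- 8).
Proof.
move=> Dx; exact: (std_frame_geometry (mulr1 1) (mulr1 1) Dx).2.
Qed.

Lemma dirder_std_gauss e x : D x -> dirder (std_frame 0 e) (local_gauss h) x =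
  24 * e * c ^+ 3 * (sinh (u x) ^+ 1 * cosh (u x) ^- 12).
Proof.
move=> Dx; rewrite (dirder_std0 e Dx std_curvature).
have := cosh_gt0 (u x); move: (sinh (u x)) (cosh (u x)) => a v v0.
by field; rewrite gt_eqF.
Qed.

Hypothesis h_pos : forall x, D x -> forall v, v != 0 -> 0 < ip h x v v.
Let K := local_gauss h.
Let G := local_grad h K.
Let f (e : R) x := 24 * e * c ^+ 3 * (sinh (u x) ^+ 1 * cosh (u x) ^- 12).

Lemma std_grad x : D x -> G x = f 1 x *: std_frame 0 1 x.
Proof.
move=> Dx; have ort y (Dy : D y) := std_orthonormal (mulr1 1) (mulr1 1) Dy.
rewrite [LHS](frame_expand hT ort _ Dx) -!(dirder_ip_grad h_pos _ Dx).
by rewrite (dirder_std_gauss 1 Dx) (dirder_std1 1 Dx std_curvature) scale0r addr0.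
Qed.

Lemma std_grad_norm x : D x -> ip h x (G x) (G x) = f 1 x ^+ 2.
Proof.
move=> Dx; rewrite -(dirder_ip_grad h_pos _ Dx).
rewrite /dirder; transitivity (f 1 x * dirder (std_frame 0 1) K x).
  rewrite /dirder mulr_sumr; apply: eq_bigr => i _.
  have -> : local_grad h (local_gauss h) x 0 i = f 1 x * std_frame 0 1 x 0 i.
    by have := congr1 (fun v : plane R => v 0 i) (std_grad Dx); rewrite [X in _ = X]mxE.
  by rewrite mulrA.
by rewrite (dirder_std_gauss 1 Dx) expr2.
Qed.

(** By [std_grad] the gradient is a multiple of the first frame vector, with the
    sign of [sinh u], that is, of [u]. *)
Lemma std_unit_grad e x : e * e = 1 -> 0 < e * u x -> D x ->
  unit_grad h K x = std_frame 0 e x.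
Proof.
move=> ee eu Dx; have es := sinh_sign eu.
rewrite /unit_grad -/K -/G std_grad_norm // sqrtr_sqr std_grad // scalerA.
have fE : f 1 x = e * (24 * c ^+ 3 * (e * sinh (u x)) * cosh (u x) ^- 12).
  by rewrite /f; transitivity (e * e * (24 * c ^+ 3 * sinh (u x) * cosh (u x) ^- 12));
    [rewrite ee|]; ring.
have g0 : 0 < 24 * c ^+ 3 * (e * sinh (u x)) * cosh (u x) ^- 12.
  have c3 : 0 < 24 * c ^+ 3 by rewrite mulr_gt0 // exprn_gt0.
  have ch : 0 < cosh (u x) ^- 12 by rewrite invr_gt0 exprn_gt0 // cosh_gt0.
  exact: mulr_gt0 (mulr_gt0 c3 es) ch.
have e1 : `|e| = 1.
  by apply/eqP; rewrite -sqrp_eq1 // -normrX expr2 ee normr1.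
rewrite fE normrM e1 mul1r gtr0_norm //; move: (24 * _ * _ * _) g0 => g g0.
rewrite mulrCA mulVf ?gt_eqF // mulr1 /std_frame scalerA; congr (_ *: _).
by rewrite mul1r.
Qed.

(** Near [x0] the two fields form a standard frame: the sign [e] of [u] is constant
    there, and [Y] is plus or minus the second coordinate direction, with a sign
    that is continuous and hence constant. *)
Lemma std_condition (Y : plane R -> plane R) x0 : smooth_mx D Y ->
  (forall x, D x -> [/\ ip h x (unit_grad h K x) (unit_grad h K x) = 1, ip h x (Y x) (Y x) = 1
     & ip h x (unit_grad h K x) (Y x) = 0]) ->
  D x0 -> u x0 != 0 ->
  dirder Y (dirder (unit_grad h K) K) x0 = 0 /\
  local_nabla h Y Y x0
     = (3 * dirder (unit_grad h K) K x0 / (8 * K x0)) *: unit_grad h K x0.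
Proof.
move=> sY ort Dx0 u0.
pose e := Num.sg (u x0); pose X := std_frame 0 e; pose Y1 := std_frame 1 1.
have ee : e * e = 1 by rewrite -expr2 sqr_sg u0.
have eu : 0 < e * u x0 by rewrite /e -normrEsg normr_gt0.
pose k x := ip h x (Y x) (Y1 x).
have sk : smooth_on D k := smooth_ip oD sh sY (smooth_std_frame 1 1).
have XE x : D x -> 0 < e * u x -> unit_grad h K x = X x by move=> Dx ex; exact: std_unit_grad.
have YE x : D x -> 0 < e * u x -> Y x = k x *: Y1 x /\ k x * k x = 1.
  move=> Dx ex; have [_ YY XY] := ort x Dx; rewrite XE // in XY.
  have ort1 y (Dy : D y) := std_orthonormal ee (mulr1 1) Dy.
  have E : Y x = k x *: Y1 x.
    by rewrite [LHS](frame_expand hT ort1 _ Dx) (ipC hT _ _ Dx) XY scale0r add0r.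
  split => //; rewrite -YY [in ip _ _ (Y x)]E ipZ (ipC hT _ _ Dx).
  by rewrite -/(k x).
have [W [oW Wx0 WD We Wk]] : exists W, [/\ open W, W x0, W `<=` D,
    forall x, W x -> 0 < e * u x & forall x, W x -> k x = k x0].
  have seu : smooth_on D (fun x => e * u x) := smooth_mul oD (smooth_cst oD e) su.
  have := smooth_cont seu Dx0 => /(cvgr_gt _)/(_ _ eu) => nu.
  have := smooth_cont sk Dx0 => /cvgrPdist_lt /(_ _ ltr01) nk.
  have : \forall x \near x0, [/\ D x, 0 < e * u x & k x = k x0].
    apply: filterS3 (open_near oD Dx0) nu nk => x Dx ex kx; split; [exact: Dx|exact: ex|].
    exact: sign_close (YE x Dx ex).2 (YE x0 Dx0 eu).2 kx.
  move=> /nbhs_ballP[rho /= rho0 hW]; exists (ball x0 rho); split.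
  - exact: ball_open.
  - exact: ballxx.
  - by move=> x /hW[].
  - by move=> x /hW[].
  - by move=> x /hW[].
have dd : k x0 * k x0 = 1 := (YE x0 Dx0 eu).2.
pose Z := std_frame 1 (k x0).
have YZ x : W x -> Y x = Z x.
  move=> Wx; rewrite (YE x (WD x Wx) (We x Wx)).1 Wk // /Z /Y1 /std_frame !scalerA.
  by rewrite mul1r.
have dK x : W x -> dirder (unit_grad h K) K x = f e x.
  move=> Wx; rewrite /dirder XE; [|exact: WD|exact: We].
  exact: dirder_std_gauss (WD x Wx).
split.
  rewrite (dirder_eq_on Y oW dK Wx0) /dirder YZ //.
  exact: (dirder_std1 (k x0) Dx0 (fun y _ => erefl)).
rewrite (local_nabla_eq_on h oW YZ Wx0) (std_frame_geometry ee dd Dx0).1 dK //.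
rewrite XE //; congr (_ *: _); rewrite /K std_curvature // /f.
have := cosh_gt0 (u x0); move: (sinh (u x0)) (cosh (u x0)) c c_gt0 => a v b b0 v0.
by field; rewrite !gt_eqF.
Qed.

End StandardFrame.
End Reverse.

(** * Surfaces *)

Lemma conformal_pullback (R : realType) (a : R) (J A : 'M[R]_2) : J \in unitmx ->
  a *: (J *m J^T) = J *m A *m J^T -> A = a%:M.
Proof.
move=> uJ E; have uJT : J^T \in unitmx by rewrite unitmx_tr.
apply: (can_inj (mulKmx uJ)); apply: (can_inj (mulmxK uJT)).
by rewrite -E mul_mx_scalar -scalemxAl.
Qed.

Section Global.
Variables (R : realType) (M : surface R) (g : metric M).

Lemma gram_smooth_on (c : chart R M) (D : set (plane R)) : atlas c ->
  D `<=` chart_im c -> smooth_mx D (g c).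
Proof. by move=> Ac Dc i j; apply: smooth_sub Dc (gram_smooth g Ac i j). Qed.

Definition gC_chart (C : R) (d : chart R M) : Prop :=
  atlas d /\ forall x, chart_im d x -> x 0 0 != 0 /\ g d x = metric_gC C x.

Section Overlap.
Variables (C : R) (c d : chart R M).
Hypotheses (C0 : 0 < C) (Ac : atlas c) (gd : gC_chart C d).
Let D := overlap c d.
Let F := transition c d.

Let Dc : D `<=` chart_im c.
Proof. by move=> x [p [cp _] <-]; exists p. Qed.

Let oD : open D. Proof. exact: open_overlap. Qed.

Let Fd x : D x -> chart_im d (F x).
Proof. by move=> [p [cp dp] <-]; rewrite /F /transition /= chart_mapK //; exists p. Qed.

Let sh : smooth_mx D (g c). Proof. exact: gram_smooth_on. Qed.

Let hT x : D x -> (g c x)^T = g c x.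
Proof. by move=> /Dc; exact: gram_sym. Qed.

Let h_pos x : D x -> forall v, v != 0 -> 0 < ip (g c) x v v.
Proof. by move=> /Dc; exact: gram_pos. Qed.

Let sF j : smooth_on D (fun x => F x 0 j).
Proof. by apply: atlas_compat => //; case: gd. Qed.

Let hE x : D x -> g c x = (C * cosh (F x 0 0) ^+ 6) *: ('J F x *m ('J F x)^T).
Proof.
move=> Dx; have [Ad gdE] := gd.
rewrite (gram_law g Ac Ad Dx) (gdE _ (Fd Dx)).2 /metric_gC.
by rewrite mul_mx_scalar -scalemxAl.
Qed.

Let uJ x : D x -> 'J F x \in unitmx.
Proof.
move=> Dx; have gu := metric_unit h_pos Dx.
have := mulmxV gu; rewrite {1}hE // scalemxAr -mulmxA => /mulmx1_unit[].
by [].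
Qed.

Let ne0 x : D x -> F x 0 0 != 0.
Proof. by move=> Dx; exact: (gd.2 _ (Fd Dx)).1. Qed.

Lemma gC_invariants x : D x -> exists t : R,
  gauss_curvature g c x = - (3 * (Num.sqrt C)^-1 * (Num.sqrt C)^-1) * cosh t ^- 8 /\
  inner g (grad g (gauss_curvature g)) (grad g (gauss_curvature g)) c x
    = (24 * (Num.sqrt C)^-1 ^+ 3 * sinh t * cosh t ^- 12) ^+ 2.
Proof.
move=> Dx; exists (F x 0 0); split.
  rewrite /gauss_curvature (std_curvature oD sh hT sF uJ C0 hE Dx).
  by rewrite expr0 mul1r.
rewrite /inner /grad /gauss_curvature (std_grad_norm oD sh hT sF uJ C0 hE h_pos Dx).
by rewrite mulr1 expr1 !mulrA.
Qed.

Lemma gC_condition (X2 : tangent_field M) x :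
  let K := gauss_curvature g in let X1 := normalize g (grad g K) in
  is_vector_field X2 -> positive_orthonormal g X1 X2 -> D x ->
  apply_field X2 (apply_field X1 K) c x = 0 /\
  nabla g X2 X2 c x = scale (fun c x => 3 * apply_field X1 K c x / (8 * K c x)) X1 c x.
Proof.
move=> K X1 [sX2 _] [ort _] Dx.
have sY : smooth_mx D (X2 c).
  by move=> i j; rewrite (ord1 i); apply: smooth_sub Dc (sX2 c Ac j).
apply: (std_condition oD sh hT sF uJ C0 hE h_pos sY _ Dx (ne0 Dx)) => y /Dc Dy.
exact: ort c Ac y Dy.
Qed.

End Overlap.

(** The first equation says that [m = c ^ 2 / cosh ^ 8] agrees for the two data,
    the second one that [m ^ 3 * sinh ^ 2] does.  Hence [sinh ^ 2], then [cosh], and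
    finally [c] agree. *)
Lemma invariants_inj (c c' t t' : R) : 0 < c -> 0 < c' ->
  - (3 * c * c) * cosh t ^- 8 = - (3 * c' * c') * cosh t' ^- 8 ->
  (24 * c ^+ 3 * sinh t * cosh t ^- 12) ^+ 2 = (24 * c' ^+ 3 * sinh t' * cosh t' ^- 12) ^+ 2 ->
  c = c'.
Proof.
have v0 := cosh_gt0 t; have w0 := cosh_gt0 t'; have v2 := cosh2E t; have w2 := cosh2E t'.
move: (cosh t) (cosh t') (sinh t) (sinh t') v0 w0 v2 w2 => v w a b v0 w0 v2 w2 c0 c'0 E1 E2.
have H : c * c * v ^- 8 = c' * c' * w ^- 8.
  have h (p q : R) : - (3 * p * p) * q = - 3 * (p * p * q) by ring.
  by move: E1; rewrite !h => /mulfI; apply; rewrite oppr_eq0 pnatr_eq0.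
have S (p q r : R) : q != 0 -> (24 * p ^+ 3 * r * q ^- 12) ^+ 2 =
  576 * (p * p * q ^- 8) ^+ 3 * r ^+ 2.
  by move=> q0; field.
rewrite !S ?gt_eqF // -H in E2.
have ab : a ^+ 2 = b ^+ 2.
  apply: mulfI E2; rewrite mulf_neq0 ?pnatr_eq0 // expf_neq0 // !mulf_neq0 ?gt_eqF //.
  by rewrite invr_gt0 exprn_gt0.
have vw : v = w.
  by apply: (pexpIrn (n := 2)) => //; rewrite ?nnegrE ?ltW // v2 w2 ab.
move: H; rewrite vw => /mulIf cc; apply: (pexpIrn (n := 2)); rewrite ?nnegrE ?ltW // !expr2.
by apply: cc; rewrite gt_eqF // invr_gt0 exprn_gt0.
Qed.

Lemma overlap_point (c d : chart R M) p : chart_dom c p -> chart_dom d p -> overlap c d (c p).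
Proof. by move=> cp dp; exists p. Qed.

Lemma locally_gC_unique C C' p : 0 < C -> 0 < C' ->
  locally_gC g C p -> locally_gC g C' p -> C = C'.
Proof.
move=> C0 C'0 [d [Ad dp gd]] [d' [Ad' dp' gd']].
have [t [K1 G1]] := gC_invariants C0 Ad (conj Ad gd) (overlap_point dp dp).
have [t' [K2 G2]] := gC_invariants C'0 Ad (conj Ad' gd') (overlap_point dp dp').
rewrite K1 in K2; rewrite G1 in G2.
have s0 (B : R) : 0 < B -> 0 < (Num.sqrt B)^-1 by move=> B0; rewrite invr_gt0 sqrtr_gt0.
have /invr_inj E := invariants_inj (s0 _ C0) (s0 _ C'0) K2 G2.
by rewrite -[LHS]sqr_sqrtr ?ltW // E sqr_sqrtr // ltW.
Qed.

Lemma open_locally_gC C : open [set p | locally_gC g C p].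
Proof.
rewrite openE => p [d [Ad dp gd]].
apply: filterS (open_nbhs_nbhs (conj (@chart_dom_open _ _ d) dp)) => q dq.
by exists d.
Qed.

(** The sets on which [g] has the form [g_C] for a given [C] are open, and they are
    disjoint for different values of [C]. *)
Lemma gC_constant : connected [set: M] ->
  (forall p : M, exists2 C : R, 0 < C & locally_gC g C p) ->
  exists2 C : R, 0 < C & forall p : M, locally_gC g C p.
Proof.
move=> cM gM; have [[p0]|noM] := pselect (exists p : M, True); last first.
  by exists 1 => // p; case: noM; exists p.
move=> _; have [C C0 gp0] := gM p0; exists C => // p.
pose A := [set p | locally_gC g C p].
suff AT : A = [set: M] by have : A p by rewrite AT.
have oA : open A := @open_locally_gC C.
have oB : open (\bigcup_(C' in [set C' | 0 < C' /\ C' != C]) [set p | locally_gC g C' p]).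
  by apply: bigcup_open => C' _; exact: open_locally_gC.
have AB : ~` A = \bigcup_(C' in [set C' | 0 < C' /\ C' != C]) [set p | locally_gC g C' p].
  apply/seteqP; split => [q Aq|q [C' [C'0 CC'] gq] Aq].
    have [C' C'0 gq] := gM q; exists C' => //; split => //.
    by apply/eqP => CC'; apply: Aq; rewrite /A /= -CC'.
  by move/eqP: CC'; apply; exact: locally_gC_unique C'0 C0 gq Aq.
apply: cM; first by exists p0.
  by exists A => //; rewrite setTI.
by exists A; [rewrite -openC AB|rewrite setTI].
Qed.

Lemma condition_locally_gC (X2 : tangent_field M) (p : M) :
  let K := gauss_curvature g in let X1 := normalize g (grad g K) in
  everywhere (fun c x => grad g K c x != 0) -> everywhere (fun c x => K c x < 0) ->
  is_vector_field X2 -> positive_orthonormal g X1 X2 ->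
  everywhere (fun c x => apply_field X2 (apply_field X1 K) c x = 0) ->
  everywhere (fun c x => nabla g X2 X2 c x
      = scale (fun c x => 3 * apply_field X1 K c x / (8 * K c x)) X1 c x) ->
  exists2 C : R, 0 < C & locally_gC g C p.
Proof.
move=> K X1 G0 Kneg [sX2 _] [ort _] c1 c2.
have [c /positive_atlas Ac cp] := positive_cover p.
pose D := chart_im c; have oD : open D := @chart_im_open _ _ c.
have sh : smooth_mx D (g c) := gram_smooth_on Ac (@subset_refl _ _).
have hT x : D x -> (g c x)^T = g c x by exact: gram_sym.
have h_pos x : D x -> forall v, v != 0 -> 0 < ip (g c) x v v by exact: gram_pos.
have sY : smooth_mx D (X2 c) by move=> i j; rewrite (ord1 i); exact: sX2.
have [C [W [F [[C0 oW Wp WD] [sF uJ F0 hE]]]]] :=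
  condition_coordinates oD sh hT h_pos (G0 c Ac) (Kneg c Ac) sY (ort c Ac) (c1 c Ac) (c2 c Ac)
    (chart_imP cp).
have [W' [Y [[oW' W'p W'W] [oFW YF sY']]]] := local_inverse oW Wp sF uJ.
have W'D : W' `<=` chart_im c by move=> x /W'W /WD.
have sF' j : smooth_on W' (fun x => F x 0 j) by apply: smooth_sub (sF j).
pose d := new_chart oW' W'D oFW YF sF' sY'.
exists C => //; exists d; split.
- exact: new_chart_atlas.
- by split.
move=> _ [q [cq Wq] <-]; have Wx := W'W _ Wq.
have -> : d q = F (c q) by [].
have [ov [tE JE]] := new_chart_jacobian oW' W'D oFW YF sF' sY' Wq.
split; first exact: F0.
have := gram_law g Ac (new_chart_atlas Ac oW' W'D oFW YF sF' sY') ov.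
cbv zeta; rewrite JE tE (hE _ Wx).
exact: conformal_pullback (uJ _ Wx).
Qed.

End Global.

Theorem proposition3p3 (R : realType) (M : surface R) (g : metric M)
    (X2 : tangent_field M) :
  let K : scalar_field M := gauss_curvature g in
  let X1 : tangent_field M := normalize g (grad g K) in
  everywhere (fun c x => grad g K c x != 0) ->
  everywhere (fun c x => K c x < 0) ->
  is_vector_field X2 ->
  positive_orthonormal g X1 X2 ->
  let condition : Prop :=
    everywhere (fun c x => apply_field X2 (apply_field X1 K) c x = 0) /\
    everywhere (fun c x => nabla g X2 X2 c x
      = scale (fun c x => 3 * apply_field X1 K c x / (8 * K c x)) X1 c x) in
  (condition <-> (forall p : M, exists2 C : R, 0 < C & locally_gC g C p)) /\
  (connected [set: M] ->
    (condition <-> (exists2 C : R, 0 < C & forall p : M, locally_gC g C p))).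
Proof.
move=> K X1 G0 Kneg fX2 ort condition.
have local_iff : condition <-> (forall p : M, exists2 C : R, 0 < C & locally_gC g C p).
  split => [[c1 c2] p|gM].
    exact: condition_locally_gC p G0 Kneg fX2 ort c1 c2.
  have cond c x : atlas c -> chart_im c x ->
      apply_field X2 (apply_field X1 K) c x = 0 /\
      nabla g X2 X2 c x = scale (fun c x => 3 * apply_field X1 K c x / (8 * K c x)) X1 c x.
    move=> Ac [p cp <-]; have [C C0 [d [Ad dp gd]]] := gM p.
    exact: (gC_condition C0 Ac (conj Ad gd) fX2 ort (overlap_point cp dp)).
  by split => c Ac x cx; have [] := cond c x Ac cx.
split => // cM; rewrite local_iff; split; first exact: gC_constant.
by move=> [C C0 gM] p; exists C.
Qed.
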